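(* Let $\alpha,\beta,\gamma\in(0,1)$ satisfy $\alpha+\beta+\gamma<1$, let $s_1,s_2>0$, $R>0$, and let $N>\frac{16\|w^2\|_\infty}{M^2}$. With $\bar s=\frac{2}{1/s_1+1/s_2}$, there exists a constant $C_0=C_0(M,N,w,s_1,s_2,R,\alpha,\beta,\gamma)>0$ (not depending on $n,m$ except through the fixed constants $c,C$ in the standing assumption $cm\le n\le Cm$) such that $$\rho^\dagger_{n+m}\left(\mathcal{S}_2^{s_1,s_2}(R),\alpha,\beta,w,M,N\right)\ge C_0\,(n+m)^{-\bar s/(2\bar s+1)} .$$
   Context: **Diagrams and intensities.** $\Omega=\{(x,y)\in\mathbb{R}^2: y>x\ge 0\}$ and, for $M>0$, $\Omega(M)=\{(x,y)\in\Omega:y<M\}$. $\mathbf{PD}$ is the set of locally finite integer-valued (counting) measures on $\Omega$, i.e. persistence diagrams, identified with multisets $D=\sum_{\mathbf{x}\in D}\delta_{\mathbf{x}}$; it carries the $\sigma$-field generated by the maps $D\mapsto D(A)$, $A\subset\Omega$ relatively compact Borel. $|D|$ is the number of points of $D$ with multiplicity. For a random $D$, $\mathbb{E}(D)$ is the measure $A\mapsto\mathbb{E}(D(A))$; if it has a density $p$ with respect to Lebesgue measure $\mathrm{Leb}_2$, $p$ is the persistence intensity function, and if $D\sim P$ one writes $\mathbb{E}(P)=p$. For a filtration $\mathcal{K}(\mathcal{X})=\{\mathcal{K}(\mathcal{X},r)\}_{r>0}$ (increasing family of simplicial complexes built on a point cloud $\mathcal{X}$, e.g. the Čech filtration of a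 finite subset of a Euclidean space), $\mathrm{PD}_k(\mathcal{K}(\mathcal{X}))$ is the multiset of (birth, death) pairs in $\Omega$ of its $k$-dimensional persistent homology; the map $\mathcal{X}\mapsto \mathrm{PD}_k(\mathcal{K}(\mathcal{X}))$ is assumed measurable. **Weight.** $w:\Omega(M)\to(0,\infty)$ is smooth, nondecreasing in $y-x$, with $\|w^2\|_\infty<\infty$ (supremum over $\Omega(M)$); it admits a compactly supported smooth extension to $\mathbb{R}^2$, still denoted $w$. **Class $\mathcal{P}=\mathcal{P}(M,N)$** ($M,N>0$ fixed): all distributions $P$ on $\mathbf{PD}$ such that $D\sim P$ satisfies: (i) $D=\mathrm{PD}_k(\mathcal{K}(\mathcal{X}))$ for some $k\ge0$, some filtration $\mathcal{K}$ and some random point cloud $\mathcal{X}$; (ii) every $(x,y)\in D$ has $y<M$; (iii) there are a discrete random variable $Z$ with values in $\mathbb{N}$ and a function $h:\mathbb{N}\to\mathbb{R}$ such that, conditionally on $Z=\ell$, $|D|\le h(\ell)$; for each $\ell$ the density $p_\ell=d\mathbb{E}[D\mid Z=\ell]/d\mathrm{Leb}_2$ exists; and $\sum_{\ell\ge1}h(\ell)\|w^2 p_\ell\|_\infty\mathbb{P}(Z=\ell)\le N$. **Sobolev ball.** With $\hat f(\xi)=\int e^{-i\langle x,\xi\rangle}f(x)dx$, $$\mathcal{S}_2^{s_1,s_2}(R)=\left\{f\in L^1(\mathbb{R}^2)\cap L^2(\mathbb{R}^2):\int_{\mathbb{R}^2}(|\xi_1|^{2s_1}+|\xi_2|^{2s_2})|\hat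 f(\xi)|^2d\xi\le(2\pi)^2R^2\right\}.$$ **Minimax rate of testing.** Sample sizes satisfy $cm\le n\le Cm$ for fixed constants $0<c\le C<\infty$. One observes independent samples $\mathbb{X}_n=(X_1,\dots,X_n)$ i.i.d. from $P$ and $\mathbb{Y}_m=(Y_1,\dots,Y_m)$ i.i.d. from $Q$; a test is a measurable $\{0,1\}$-valued function $\Delta(\mathbb{X}_n,\mathbb{Y}_m)$. For a function class $\mathcal{C}$ and $\rho>0$, $\mathcal{F}_\rho(\mathcal{C},w)=\{(p,q): w\cdot(p-q)\in\mathcal{C},\ \|w\cdot(p-q)\|_2\ge\rho\}$ (functions extended by $0$ to $\mathbb{R}^2$), and $\mathcal{P}^{\otimes2}_{\mathcal{F}}=\{(P,Q)\in\mathcal{P}\times\mathcal{P}:(p,q)\in\mathcal{F},\ \mathbb{E}(P)=p,\ \mathbb{E}(Q)=q\}$. Then $$\rho_{n+m}(\Delta,\mathcal{C},\beta,w,M,N)=\inf\left\{\widetilde\rho>0:\sup_{(P,Q)\in\mathcal{P}^{\otimes2}_{\mathcal{F}_{\widetilde\rho}(\mathcal{C},w)}}\mathbb{P}_{P\times Q}(\Delta(\mathbb{X}_n,\mathbb{Y}_m)=0)\le\beta\right\},$$ $$\rho^\dagger_{n+m}(\mathcal{C},\alpha,\beta,w,M,N)=\inf\{\rho_{n+m}(\Delta_\alpha,\mathcal{C},\beta,w,M,N):\Delta_\alpha\in\Psi_\alpha\},$$ where $\Psi_\alpha$ is the set of tests with $\sup_{P\in\mathcal{P}}\mathbb{P}_{P\times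 P}(\Delta_\alpha(\mathbb{X}_n,\mathbb{Y}_m)=1)\le\alpha$. *)

(* Defs.v *)
From HB Require Import structures.
From mathcomp Require Import all_boot all_order all_algebra finmap.
From mathcomp Require Import all_classical all_reals all_analysis.
From mathcomp Require Import measurable_realfun ess_sup_inf.
From mathcomp Require Import complex.

Set Implicit Arguments.
Unset Strict Implicit.
Unset Printing Implicit Defensive.

Import Order.TTheory GRing.Theory Num.Theory.
Import numFieldNormedType.Exports.

Local Open Scope classical_set_scope.
Local Open Scope ring_scope.

(* [lebesgue_measure] lives on the alias [measurableTypeR R] of R. *)
Notation plane R := (measurableTypeR R * measurableTypeR R)%type.

Definition Leb2 (R : realType) : {measure set (plane R) -> \bar R} :=
  (@lebesgue_measure R \x @lebesgue_measure R)%E.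

Definition Omega (R : realType) : set (plane R) :=
  [set z | 0 <= z.1 /\ z.1 < z.2].

Definition OmegaM (R : realType) (M : R) : set (plane R) :=
  Omega (R:=R) `&` [set z | z.2 < M].

Definition relatively_compact (R : realType) (A : set (plane R)) : Prop :=
  exists K : set (plane R), [/\ compact K, K `<=` Omega (R:=R) & A `<=` K].

(* The diagram D = sum_z mult(z) delta_z, given by its multiplicity function. *)
Record diagram (R : realType) := Diagram {
  mult :> plane R -> nat;
  mult_Omega : forall z, ~ Omega z -> mult z = 0%N;
  mult_locally_finite : forall K : set (plane R),
    compact K -> K `<=` Omega (R:=R) ->
    finite_set (K `&` [set z | mult z != 0%N]) }.

Section empty_diagram.
Variable R : realType.

Lemma empty_locally_finite (K : set (plane R)) :
  compact K -> K `<=` Omega (R:=R) ->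
  finite_set (K `&` [set z | 0%N != 0%N :> nat]).
Proof. by move=> _ _; apply: (sub_finite_set _ (finite_set0 _)) => z []. Qed.

Definition empty_diagram : diagram R :=
  @Diagram R (fun=> 0%N) (fun _ _ => erefl) empty_locally_finite.

End empty_diagram.

HB.instance Definition _ (R : realType) := gen_eqMixin (diagram R).
HB.instance Definition _ (R : realType) := gen_choiceMixin (diagram R).
HB.instance Definition _ (R : realType) :=
  isPointed.Build (diagram R) (empty_diagram R).

Definition mass (R : realType) (D : diagram R) (A : set (plane R)) : \bar R :=
  (\esum_(z in A) (D z)%:R%:E)%E.

Definition PD_generators (R : realType) : set (set (diagram R)) :=
  [set S | exists A : set (plane R), exists B : set (\bar R),
    [/\ measurable A, relatively_compact A, measurable B
      & S = (fun D => mass D A) @^-1` B]].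

Definition PD (R : realType) := g_sigma_algebraType (@PD_generators R).

Section homology.
Variables (F : fieldType) (V : finType).

Definition simplicial_complex (S : {set {set V}}) : Prop :=
  finset.set0 \notin S /\
  forall sigma tau : {set V}, sigma \in S -> tau \subset sigma ->
    tau != finset.set0 -> tau \in S.

Definition chain := {ffun {set V} -> F^o}.
HB.instance Definition _ := GRing.Lmodule.on chain.
HB.instance Definition _ := Vector.on chain.

Definition elementary (sigma : {set V}) : chain :=
  [ffun tau => (tau == sigma)%:R].

Definition chains (S : {set {set V}}) (k : nat) : {vspace chain} :=
  <<[seq elementary sigma | sigma in [set sigma in S | #|sigma| == k.+1]%SET]>>%VS.

(* Vertices are ordered by [enum_rank]; v |: tau contributes to its face tau
   with the sign (-1)^(position of v). The value at set0 is 0, i.e. homology is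
   not reduced. *)
Definition boundary (c : chain) : chain :=
  [ffun tau : {set V} => if tau == finset.set0 then 0 else
    \sum_(v | v \notin tau)
      (-1) ^+ #|[set u in tau | (enum_rank u < enum_rank v)%N]| * c (v |: tau)].

Lemma boundary_is_linear : linear boundary.
Proof.
move=> a b c; apply/ffunP => tau; rewrite !ffunE.
case: ifP => _; first by rewrite scaler0 addr0.
rewrite scaler_sumr -big_split; apply: eq_bigr => v _.
by rewrite !ffunE mulrDr scalerAr.
Qed.

HB.instance Definition _ :=
  GRing.isLinear.Build F chain chain _ boundary boundary_is_linear.

Definition cycles (S : {set {set V}}) (k : nat) : {vspace chain} :=
  (chains S k :&: lker (linfun boundary))%VS.

Definition boundaries (S : {set {set V}}) (k : nat) : {vspace chain} :=
  (linfun boundary @: chains S k.+1)%VS.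

(* Rank of H_k(S) -> H_k(S'), i.e. the dimension of Z_k(S) / (Z_k(S) & B_k(S')),
   for S \subset S'. *)
Definition persistent_betti (k : nat) (S S' : {set {set V}}) : nat :=
  (\dim (cycles S k) - \dim (cycles S k :&: boundaries S' k))%N.

End homology.

(* A filtration is indexed by r > 0; it is empty at r <= 0. *)
Definition betti (R : realType) (F : fieldType) (V : finType)
    (K : R -> {set {set V}}) (k : nat) (r s : R) : nat :=
  let at_ (t : R) := if 0 < t then K t else finset.set0 in
  persistent_betti F k (at_ r) (at_ s).

(* The multiplicity of (x, y) in PD_k is, for all small e > 0,
     b(x+e, y-e) - b(x-e, y-e) - b(x+e, y+e) + b(x-e, y+e),
   b being the persistent Betti numbers; it is written without subtraction.
   Classes that never die give no point. *)
Definition is_PD (R : realType) (F : fieldType) (V : finType)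
    (K : R -> {set {set V}}) (k : nat) (D : diagram R) : Prop :=
  let b := betti F K k in
  forall x y : R, Omega (x, y) -> \forall e \near 0^'+,
    (D (x, y) + b (x - e)%R (y - e)%R + b (x + e)%R (y + e)%R =
     b (x + e)%R (y - e)%R + b (x - e)%R (y + e)%R)%N.

Section clouds.
Variables (R : realType) (d : nat).

Definition cloud := {fset 'rV[R]_d}.
HB.instance Definition _ := Choice.on cloud.
HB.instance Definition _ := isPointed.Build cloud fset0.

Definition borel_cloud : set (set 'rV[R]_d) :=
  <<s [set U : set 'rV[R]_d | open U] >>.

Definition cloud_count (B : set 'rV[R]_d) (X : cloud) : nat :=
  #|` [fset x in X | `[< B x >]]%fset |.

Definition cloud_generators : set (set cloud) :=
  [set S | exists B : set 'rV[R]_d, exists j : nat,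
    borel_cloud B /\ S = [set X | cloud_count B X = j]].

Definition PointCloud := g_sigma_algebraType cloud_generators.

Definition filtered := forall X : {fset 'rV[R]_d}, R -> {set {set X}}.

Definition is_filtration (K : filtered) : Prop :=
  forall X : {fset 'rV[R]_d},
    (forall r, 0 < r -> simplicial_complex (K X r)) /\
    (forall r s, 0 < r -> r <= s -> K X r \subset K X s).

End clouds.

(* Density with respect to Leb2; densities on Omega are extended by 0. *)
Definition is_density (R : realType) (nu : set (plane R) -> \bar R)
    (p : plane R -> R) : Prop :=
  [/\ measurable_fun setT p, forall z, 0 <= p z
    & forall A : set (plane R), measurable A ->
        nu A = (\int[@Leb2 R]_(z in A) (p z)%:E)%E].

Definition mean (R : realType) (P : probability (PD R) R) (A : set (plane R)) :
  \bar R := (\int[P]_D mass D A)%E.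

(* E[D(A) | Z = l]; it is 0 if Z = l has probability 0. *)
Definition cond_mean (R : realType) (dT : measure_display)
    (T : measurableType dT) (Pr : probability T R) (Z : T -> nat)
    (D : T -> PD R) (l : nat) (A : set (plane R)) : \bar R :=
  ((fine (Pr (Z @^-1` [set l])))^-1%:E *
   \int[Pr]_(t in Z @^-1` [set l]) mass (D t) A)%E.

Section weights.
Variable R : realType.
Implicit Types w f : plane R -> R.

Fixpoint C_k (k : nat) (f : plane R -> R) : Prop :=
  continuous f /\
  if k is k'.+1 then
    forall v : plane R, v = (1, 0) \/ v = (0, 1) ->
      (forall z, derivable f z v) /\ C_k k' (fun z => 'D_v f z)
  else True.

Definition smooth f : Prop := forall k, C_k k f.

Definition w2_norm (M : R) w : R := sup [set w z ^+ 2 | z in OmegaM M].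

(* w is the smooth compactly supported extension to the plane. *)
Definition is_weight (M : R) w : Prop :=
  [/\ smooth w,
      compact (closure [set z | w z != 0]),
      forall z, OmegaM M z -> 0 < w z,
      forall z z', OmegaM M z -> OmegaM M z' -> z.2 - z.1 <= z'.2 - z'.1 ->
        w z <= w z'
    & has_ubound [set w z ^+ 2 | z in OmegaM M]].

End weights.

(* Z takes its values in {1, 2, ...}, the range of the sum. *)
Definition class_P (R : realType) (F : fieldType) (w : plane R -> R) (M N : R)
    (P : probability (PD R) R) : Prop :=
  exists (dT : measure_display) (T : measurableType dT) (Pr : probability T R)
    (d k : nat) (K : filtered R d) (pd : PointCloud R d -> PD R)
    (X : T -> PointCloud R d) (Z : T -> nat) (h : nat -> R)
    (p : nat -> plane R -> R),
  let D := pd \o X in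
  [/\ [/\ is_filtration K,
          measurable_fun setT pd /\
            (forall x : PointCloud R d, is_PD F (K x) k (pd x)),
          measurable_fun setT X
        & forall S : set (PD R), measurable S -> P S = Pr (D @^-1` S)],
      {ae Pr, forall t, forall z, D t z != 0%N -> z.2 < M}
    & [/\ measurable_fun setT Z /\ (forall t, (0 < Z t)%N),
          {ae Pr, forall t, (mass (D t) setT <= (h (Z t))%:E)%E},
          forall l, (0 < l)%N -> is_density (cond_mean Pr Z D l) (p l)
        & (\sum_(1 <= l <oo)
             ((h l)%:E * ess_sup (@Leb2 R) (fun z => (w z ^+ 2 * p l z)%:E)
              * Pr (Z @^-1` [set l])) <= N%:E)%E]].

Section sobolev.
Variable R : realType.

(* e^(-it) = cos t - i sin t *)
Definition fourier (f : plane R -> R) (xi : plane R) : R[i] :=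
  (\int[@Leb2 R]_x (cos (x.1 * xi.1 + x.2 * xi.2) * f x) -i*
   \int[@Leb2 R]_x (sin (x.1 * xi.1 + x.2 * xi.2) * f x))%C.

Definition sobolev_ball (s1 s2 L : R) : set (plane R -> R) :=
  [set f | [/\ measurable_fun setT f,
      ('N[@Leb2 R]_1%:E [EFin \o f] < +oo)%E,
      ('N[@Leb2 R]_2%:E [EFin \o f] < +oo)%E
    & (\int[@Leb2 R]_xi
         ((`|xi.1| `^ (2 * s1) + `|xi.2| `^ (2 * s2)) *
          ComplexField.Normc.normc (fourier f xi) ^+ 2)%:E
       <= ((2 * pi) ^+ 2 * L ^+ 2)%:E)%E]].

End sobolev.

Section iid.
Context {dT : measure_display} {T : measurableType dT} {R : realType}.

Definition tcons (n : nat) (z : T * n.-tuple T) : n.+1.-tuple T :=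
  [the n.+1.-tuple T of z.1 :: z.2].

Lemma measurable_tcons n : measurable_fun setT (@tcons n).
Proof. by apply: measurable_cons; [exact: measurable_fst|exact: measurable_snd]. Qed.

HB.instance Definition _ n :=
  isMeasurableFun.Build _ _ _ _ (@tcons n) (@measurable_tcons n).

Fixpoint iid (P : probability T R) (n : nat) : probability (n.-tuple T) R :=
  if n is n'.+1 then distribution (P \x iid P n')%E (@tcons n')
  else \d_[tuple].

End iid.

Section testing.
Variables (R : realType) (F : fieldType) (w : plane R -> R) (M N : R).
Variables (n m : nat).

Definition test := {mfun (n.-tuple (PD R) * m.-tuple (PD R))%type >-> bool}.

Definition prob_test (P Q : probability (PD R) R) (Delta : test) (b : bool) :
  \bar R := (iid P n \x iid Q m)%E (Delta @^-1` [set b]).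

Definition separated_pair (C : set (plane R -> R)) (rho : R) (p q : plane R -> R) :
  Prop :=
  let f := fun z => w z * (p z - q z) in
  C f /\ (rho%:E <= 'N[@Leb2 R]_2%:E [EFin \o f])%E.

Definition alternatives (C : set (plane R -> R)) (rho : R) :
    set (probability (PD R) R * probability (PD R) R) :=
  [set PQ | [/\ class_P F w M N PQ.1, class_P F w M N PQ.2
    & exists p q, [/\ is_density (mean PQ.1) p, is_density (mean PQ.2) q
                    & separated_pair C rho p q]]].

Definition rate_test (C : set (plane R -> R)) (beta : R) (Delta : test) :
  \bar R :=
  ereal_inf [set rho%:E | rho in [set rho : R | 0 < rho /\
    (ereal_sup [set prob_test PQ.1 PQ.2 Delta false
                | PQ in alternatives C rho] <= beta%:E)%E]].

Definition level_tests (alpha : R) : set test :=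
  [set Delta | (ereal_sup [set prob_test P P Delta true
                           | P in class_P F w M N] <= alpha%:E)%E].

Definition minimax_rate (C : set (plane R -> R)) (alpha beta : R) : \bar R :=
  ereal_inf [set rate_test C beta Delta | Delta in level_tests alpha].

End testing.

(* Main.v *)
Require Import Defs.
From HB Require Import structures.
From mathcomp Require Import all_boot all_order all_algebra finmap.
From mathcomp Require Import all_classical all_reals all_analysis.
From mathcomp Require Import measurable_realfun ess_sup_inf.
From mathcomp Require Import complex.
From mathcomp Require Import ring lra zify.

Set Implicit Arguments.
Unset Strict Implicit.
Unset Printing Implicit Defensive.

Import Order.TTheory GRing.Theory Num.Theory.
Import numFieldNormedType.Exports.

Local Open Scope classical_set_scope.
Local Open Scope ring_scope.

(* Ingster's second moment method. Every point of Omega is the diagram of a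
   two-point cloud on the line (both points appear at time x, the edge at time y),
   so any density p on Omega(M) is the mean of the law of a one-point random
   diagram. Null: a mixture p_0 of the uniform density on a box and of bumps
   divided by w, one per half-cell of a k1 x k2 grid. Alternatives: p_v, where the
   two bumps of cell j get weights tilted by 1 +- delta v_j, v in {-1, 1}^J; then
   w (p_0 - p_v) is a signed sum of bumps with disjoint supports.

   The laws P_v are mixtures of finitely many fixed laws, so the average over v of
   the m-fold products is compared with the null by a finite chi-square
   computation: chi2 + 1 <= cosh(y)^K with K = k1 k2 and y of order
   m delta^2 / K. The anisotropic Sobolev norm needs no Plancherel theorem:
   the bumps are even polynomials cut off at +-1/2, the transform of a sum is
   b(h1 xi1) b(h2 xi2) T(xi) with b decaying polynomially and T trigonometric, and
   |T|^2 is integrated period by period. With r = (n + m)^(-s / (2 s + 1)) the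
   choice delta ~ r, k1 ~ r^(-1/s1), k2 ~ r^(-1/s2) makes all bounds uniform. *)

(** * A point of Omega as the diagram of a two-point cloud *)

(** Each cell has two bumps because moving mass from one to the other keeps the total mass equal to
    1 whatever the signs, and because the terms linear in [delta] then cancel within each cell in
    the second moment. Dividing the bumps by [w] makes [w (p_0 - p_v)] an exact sum of polynomial
    bumps, so derivatives of [w] never enter. The box [[0, M/4] x [M/2, M]] keeps [y - x >= M/4],
    where the monotone weight has a positive lower bound. Its area is [M^2 / 8], so the uniform
    density contributes at most [8 |w^2| / M^2]; the bumps get a total mass small enough to
    contribute no more, and the constant 16 is the sum of the two. Null and alternatives mix the
    same components: a test of diagrams becomes a randomised test of the labels of the components,
    and all likelihoods live on a finite set of label tuples instead of the space of diagrams. Only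
    the law of the second sample is perturbed; the first keeps the null law. *)

Section two_point_homology.
Variables (F : fieldType) (V : finType).

Let singletons : {set {set V}} := [set sigma : {set V} | #|sigma| == 1%N]%SET.
Let nonempty : {set {set V}} := [set sigma : {set V} | sigma != finset.set0]%SET.

Lemma chains_eq0 (S : {set {set V}}) k :
  (forall sigma, sigma \in S -> #|sigma| != k.+1) -> chains F S k = 0%VS.
Proof.
move=> h; rewrite /chains [X in <<X>>%VS](_ : _ = [::]) ?span_nil//.
apply/eqP; rewrite -size_eq0 size_map -cardE; apply/eqP/eq_card0 => s.
by rewrite !inE; apply/negbTE/negP => /andP[/h /negbTE ->].
Qed.

Lemma boundaries0 (S : {set {set V}}) k :
  (forall sigma, sigma \in S -> #|sigma| != k.+2) -> boundaries F S k = 0%VS.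
Proof. by move=> /chains_eq0; rewrite /boundaries => ->; rewrite limg0. Qed.

Lemma betti0l (S : {set {set V}}) k :
  persistent_betti F k finset.set0 S = 0%N.
Proof.
by rewrite /persistent_betti /cycles chains_eq0 ?cap0v ?dimv0// => s; rewrite inE.
Qed.

Lemma chains_nonempty : chains F nonempty 0 = chains F singletons 0.
Proof.
rewrite /chains; congr (<<_>>%VS); congr map; apply: eq_enum => s; rewrite !inE.
by case: (#|s| =P 1%N) => [e|]; rewrite ?andbF// -card_gt0 e.
Qed.

Lemma mem_chains (S : {set {set V}}) k (c : chain F V) :
  (forall tau, c tau != 0 -> (tau \in S) && (#|tau| == k.+1)) ->
  c \in chains F S k.
Proof.
move=> h.
have -> : c = \sum_(tau : {set V}) c tau *: elementary F tau.
  apply/ffunP => s; rewrite sum_ffunE (bigD1 s)//= !ffunE eqxx [_ *: _]mulr1.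
  rewrite big1 ?addr0// => t ts; rewrite !ffunE eq_sym (negbTE ts).
  exact: mulr0.
apply: memv_suml => t _; have [->|/h ht] := eqVneq (c t) 0.
  by rewrite scale0r mem0v.
by apply/memvZ/memv_span/fintype.imageP; exists t; rewrite ?inE.
Qed.

(** A nonempty [tau] together with a vertex outside it has at least two elements, where a 0-chain
    vanishes; at the empty set [boundary] is 0 because homology is not reduced. *)
Lemma cycles0 (S : {set {set V}}) : cycles F S 0 = chains F S 0.
Proof.
apply/capv_idPl/span_subvP => _ /fintype.imageP[s sS ->].
rewrite memv_ker lfunE /=; apply/eqP/ffunP => t; rewrite !ffunE.
case: ifPn => // t0; rewrite big1// => v vt; rewrite !ffunE.
case: eqP => [e|]; rewrite ?mulr0//.
move: sS; rewrite inE -e cardsU1 vt add1n eqSS cards_eq0.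
by rewrite (negbTE t0) andbF.
Qed.

Hypothesis V2 : #|V| = 2%N.

Let edge : chain F V := elementary F [set: V]%SET.

(** At a single vertex the sum over the other vertices has one term, a sign, which is nonzero in
    every characteristic. *)
Lemma boundary_edge_neq0 : boundary edge != 0.
Proof.
have /card_gt0P[a _] : (0 < #|V|)%N by rewrite V2.
apply/eqP => /ffunP /(_ [set a]%SET); rewrite !ffunE.
case: ifPn => [/eqP/setP/(_ a)|_]; first by rewrite !inE eqxx.
have : #|~: [set a]%SET| == 1%N.
  by rewrite -(eqn_add2l #|[set a]%SET|) cardsC cards1 V2.
move=> /cards1P[b /setP hb]; have hb' v : (v \notin [set a]%SET) = (v == b).
  by have := hb v; rewrite !inE.
rewrite (eq_bigl (pred1 b) _ hb') big_pred1_eq !ffunE.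
rewrite (_ : (_ == _) = true) ?mulr1 => [/eqP|]; first by rewrite signr_eq0.
apply/eqP/setP => v; rewrite !inE; have := hb' v; rewrite !inE.
by case: (v == a) => /= <-.
Qed.

Lemma boundary_edge_cycle : boundary edge \in chains F singletons 0.
Proof.
apply: mem_chains => t; rewrite ffunE inE andbb.
case: ifPn => [_|t0]; first by rewrite eqxx.
apply: contraR => t1; rewrite big1// => v vt; rewrite !ffunE.
case: eqP => [e|]; rewrite ?mulr0//.
have : #|(v |: t)%SET| = 2%N by rewrite e cardsT V2.
by rewrite cardsU1 vt => -[/eqP]; rewrite (negbTE t1).
Qed.

Lemma boundaries_edge : boundaries F nonempty 0 = <[boundary edge]>%VS.
Proof.
rewrite /boundaries /chains (_ : [set _ in _ | _]%SET = [set [set: V]%SET]%SET).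
  by rewrite /image_mem enum_set1/= span_seq1 limg_line lfunE.
apply/setP => t; rewrite !inE; apply/andP/eqP => [[_ /eqP t2]|->].
  apply/eqP; rewrite eqEcard; apply/andP; split; last by rewrite cardsT V2 t2.
  by apply/fintype.subsetP => x; rewrite inE.
by rewrite -card_gt0 cardsT V2.
Qed.

Lemma dim_chains_gt0 : (0 < \dim (chains F singletons 0))%N.
Proof.
apply: (@leq_trans (\dim <[boundary edge]>%VS)).
  by rewrite dim_vline boundary_edge_neq0.
by apply: dimvS; rewrite -memvE boundary_edge_cycle.
Qed.

(** For two vertices, the three complexes met by the filtration: empty, two isolated points, one
    edge. *)
Definition stage (j : nat) : {set {set V}} :=
  if j is j'.+1 then if j' is _.+1 then nonempty else singletons
  else finset.set0.

(** Once the edge is in the target, the boundaries are the line spanned by [boundary edge], and the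
    rank drops by one. The dimension of the 0-chains stays symbolic: the multiplicity computed later
    only uses that it is positive. *)
Lemma betti_stage (i j : nat) :
  persistent_betti F 0 (stage i) (stage j) =
  if i is 0%N then 0%N
  else (\dim (chains F singletons 0) - (1 < j))%N.
Proof.
case: i => [|i]; first exact: betti0l.
rewrite /persistent_betti; have -> : cycles F (stage i.+1) 0 = chains F singletons 0.
  by rewrite cycles0; case: i => [//|i]; exact: chains_nonempty.
case: j => [|[|j]] /=; last first.
- rewrite boundaries_edge (capv_idPr _) ?dim_vline ?boundary_edge_neq0//.
  by rewrite -memvE boundary_edge_cycle.
- by rewrite boundaries0 ?capv0 ?dimv0// => s; rewrite inE => /eqP ->.
- by rewrite boundaries0 ?capv0 ?dimv0// => s; rewrite inE.
Qed.

End two_point_homology.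

(** * The filtration of two-point clouds and its persistence diagram *)

Section two_point_filtration.
Variable R : realType.
Implicit Types (z : plane R) (r t : R).

Definition pair_cloud z : {fset 'rV[R]_1} :=
  [fset const_mx z.1; const_mx z.2]%fset.

Lemma const_mx_rV1_inj : injective (@const_mx R 1 1).
Proof. by move=> x y /matrixP /(_ 0 0); rewrite !mxE. Qed.

Lemma ordered_pair_inj (x y x' y' : R) : x < y -> x' < y' ->
  (forall u, (u == x) || (u == y) = (u == x') || (u == y')) ->
  x = x' /\ y = y'.
Proof.
move=> xy xy' e; have := e x; have := e y; have := e x'.
rewrite !eqxx/= ?orbT => /orP h1 /esym/orP h2 /esym/orP h3.
by split; case: h1 h2 h3 => /eqP h1 [|] /eqP h2 [|] /eqP h3; lra.
Qed.

Lemma pair_cloud_inj z z' : Omega z -> Omega z' ->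
  pair_cloud z = pair_cloud z' -> z = z'.
Proof.
case: z z' => [x y] [x' y'] [/= _ xy] [/= _ xy'] /fsetP e.
have inj (u v : R) : (const_mx u == const_mx v :> 'rV_1) = (u == v).
  exact/inj_eq/const_mx_rV1_inj.
have [|->->//] := ordered_pair_inj xy xy' _.
by move=> u; have := e (const_mx u); rewrite !in_fset2 !inj.
Qed.

(** The existential reads the birth and death times off the positions of the two points; a cloud of
    any other form gets the empty complex at all times. *)
Definition pair_filtration : filtered R 1 := fun X r =>
  [set sigma : {set X} | (sigma != finset.set0) &&
    `[< exists z, [/\ Omega z, X = pair_cloud z, z.1 <= r
                    & #|sigma| = 1%N \/ z.2 <= r] >]]%SET.

Lemma pair_filtration_is_filtration : is_filtration pair_filtration.
Proof.
move=> X; split => [r r0|r t r0 rt].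
  split=> [|s u]; first by rewrite !inE eqxx.
  rewrite !inE => /andP[s0 /asboolP[z [oz Xz zr h]]] us u0; rewrite u0/=.
  apply/asboolP; exists z; split=> //; case: h => [s1|]; [left|by right].
  by apply/eqP; rewrite eqn_leq card_gt0 u0 (leq_trans (subset_leq_card us)) ?s1.
apply/fintype.subsetP => s; rewrite !inE => /andP[-> /asboolP[z [oz Xz zr h]]] /=.
apply/asboolP; exists z; split=> //; first exact: le_trans rt.
by case: h => [|h]; [left|right; exact: le_trans rt].
Qed.

Definition pair_stage z r : nat :=
  if (0 < r) && (z.1 <= r) then (if z.2 <= r then 2 else 1) else 0.

Lemma pair_filtrationE z r : Omega z -> 0 < r ->
  pair_filtration (pair_cloud z) r = stage _ (pair_stage z r).
Proof.
move=> oz r0; apply/setP => s; rewrite /pair_stage r0/= inE.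
have [zr|zr] := leP z.1 r; last first.
  rewrite inE; apply/negbTE/negP => /andP[_ /asboolP[z' [oz' zz' zr' _]]].
  by move: zr zr'; rewrite (pair_cloud_inj oz oz' zz') => /lt_geF ->.
have [yr|yr] := leP z.2 r; rewrite inE.
  by case: (s != _) => //=; apply/asboolP; exists z; split=> //; right.
apply/andP/eqP => [[s0 /asboolP[z' [oz' zz' _ [//|]]]]|s1].
  by rewrite -(pair_cloud_inj oz oz' zz') (lt_geF yr).
split; first by rewrite -card_gt0 s1.
by apply/asboolP; exists z; split=> //; left.
Qed.

Lemma pair_filtration_eq0 (X : {fset 'rV[R]_1}) r :
  (forall z, Omega z -> X <> pair_cloud z) -> pair_filtration X r = finset.set0.
Proof.
move=> h; apply/setP => s; rewrite !inE; apply/negbTE/negP.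
by move=> /andP[_ /asboolP[z [/h]]].
Qed.

Definition pair_mult (X : cloud R 1) z : nat :=
  `[< Omega z /\ X = pair_cloud z >].

Lemma pair_mult_Omega X z : ~ Omega z -> pair_mult X z = 0%N.
Proof. by move=> nz; rewrite /pair_mult; case: asboolP => // -[]. Qed.

Lemma pair_mult_finite X (K : set (plane R)) :
  compact K -> K `<=` Omega (R:=R) ->
  finite_set (K `&` [set z | pair_mult X z != 0%N]).
Proof.
move=> _ _.
have [[z [oz Xz]]|nz] := pselect (exists z, Omega z /\ X = pair_cloud z).
  apply: sub_finite_set (finite_set1 z) => z' [_] /=; rewrite /pair_mult.
  case: asboolP => // -[oz' Xz'] _.
  by apply: pair_cloud_inj => //; rewrite -Xz.
apply: sub_finite_set (finite_set0 _) => z [_] /=; rewrite /pair_mult.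
by case: asboolP => // oz _; apply: nz; exists z.
Qed.

Definition pair_diagram (X : PointCloud R 1) : PD R :=
  Diagram (@pair_mult_Omega X) (@pair_mult_finite X).

Lemma card_pair_cloud z : Omega z -> #|` pair_cloud z| = 2%N.
Proof.
case=> z0 zz; rewrite cardfs2 (inj_eq const_mx_rV1_inj).
by move: zz; rewrite lt_neqAle => /andP[->].
Qed.

(** The persistent Betti number is a product-like step function: it vanishes until the first
    argument reaches [z.1], and drops by one when the second reaches [z.2]. Its mixed difference is
    1 at [z] and 0 elsewhere. *)
Lemma pair_diagram_is_PD (F : fieldType) (X : PointCloud R 1) :
  is_PD F (pair_filtration X) 0 (pair_diagram X).
Proof.
move=> x y [/= x0 xy].
have [[z [oz Xz]]|nz] := pselect (exists z, Omega z /\ X = pair_cloud z); last first.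
  apply: nearW => e; rewrite /betti.
  have E r : (if 0 < r then pair_filtration X r else finset.set0) = finset.set0.
    case: ifP => // _; apply: pair_filtration_eq0 => z oz Xz.
    by apply: nz; exists z.
  by rewrite !E betti0l /= /pair_mult; case: asboolP => // oz; case: nz; exists (x, y).
have bE r t : betti F (pair_filtration X) 0 r t =
    if pair_stage z r is 0%N then 0%N
    else (\dim (chains F [set s : {set X} | #|s| == 1%N]%SET 0)
           - (1 < pair_stage z t))%N.
  have E u : (if 0 < u then pair_filtration X u else finset.set0) =
      stage X (pair_stage z u).
    rewrite Xz; case: ifPn => [u0|u0]; first exact: pair_filtrationE.
    by rewrite /pair_stage (negbTE u0).
  rewrite /betti !E betti_stage//.
  by rewrite Xz -cardfE card_pair_cloud.
have c0 : (0 < \dim (chains F [set s : {set X} | #|s| == 1%N]%SET 0))%N.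
  by apply: dim_chains_gt0; rewrite Xz -cardfE card_pair_cloud.
set c := \dim _ in bE c0.
(* Unless [u = v], both [v - e] and [v + e] lie on the same side of [u] for small [e]. *)
have near1 (u v : R) : \forall e \near (0 : R)^'+,
    if u == v then true
    else ((u <= v - e) == (u < v)) && ((u <= v + e) == (u < v)).
  have [uv|vu|_] := ltgtP u v; last by apply: nearW.
    have h : 0 < v - u by rewrite subr_gt0.
    near=> e; have e0 : 0 < e by near: e; exact: nbhs_right_gt.
    have ev : e < v - u by near: e; exact: nbhs_right_lt.
    by rewrite !eqb_id; apply/andP; split; lra.
  have h : 0 < u - v by rewrite subr_gt0.
  near=> e; have e0 : 0 < e by near: e; exact: nbhs_right_gt.
  have ev : e < u - v by near: e; exact: nbhs_right_lt.
  by rewrite !eqbF_neg -!ltNge; apply/andP; split; lra.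
have stage2 r : (1 < pair_stage z r)%N = (z.2 <= r).
  rewrite /pair_stage; have [yr|yr] := leP z.2 r; last by case: (_ && _).
  rewrite ifT//; apply/andP; case: oz => z0 zz; split.
    exact: lt_le_trans (le_lt_trans z0 zz) yr.
  exact: le_trans (ltW zz) yr.
have stage0 r (T : Type) (u v : T) : (if pair_stage z r is 0%N then u else v) =
    if (0 < r) && (z.1 <= r) then v else u.
  by rewrite /pair_stage; case: ifP => //; case: ifP.
have Dxy : pair_mult X (x, y) = (z.1 == x) && (z.2 == y) :> nat.
  rewrite /pair_mult; congr (nat_of_bool _); apply/asboolP/andP => /= [[oxy Xxy]|].
    by rewrite -(pair_cloud_inj oxy oz) ?eqxx// -Xxy.
  move: (oz) (Xz); rewrite [in X in X -> _](surjective_pairing z).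
  by case: (z) => z1 z2 /= ? ? [/eqP <- /eqP <-].
have hx := near1 z.1 x; have hy := near1 z.2 y.
(* The filtration is empty at nonpositive times, so [x - e] must also stay positive. *)
have x' : \forall e \near (0 : R)^'+, z.1 < x -> 0 < x - e.
  have [zx|zx] := ltP z.1 x; last by near=> e.
  have h : 0 < x - z.1 by rewrite subr_gt0.
  near=> e; have ev : e < x - z.1 by near: e; exact: nbhs_right_lt.
  by case: oz => z0 _ _; move: ev z0; set z1 : R := z.1 => *; lra.
near=> e.
have e0 : 0 < e by near: e; exact: nbhs_right_gt.
rewrite /= Dxy !bE !stage0 !stage2.
have : if z.1 == x then true
    else ((z.1 <= x - e) == (z.1 < x)) && ((z.1 <= x + e) == (z.1 < x)).
  by near: e.
have : if z.2 == y then true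
    else ((z.2 <= y - e) == (z.2 < y)) && ((z.2 <= y + e) == (z.2 < y)).
  by near: e.
have : z.1 < x -> 0 < x - e by near: e.
have ye : 0 < y + e by apply: addr_gt0 => //; exact: le_lt_trans xy.
have xe : 0 < x + e by exact: ltr_wpDl.
rewrite xe/=.
case: (eqVneq z.1 x) => [->|_].
  move=> _ + _.
  have -> : (x <= x + e) by rewrite lerDl ltW.
  have -> : (x <= x - e) = false by apply/negbTE; rewrite -ltNge; lra.
  rewrite andbF/=.
  case: (eqVneq z.2 y) => [->|_].
    have -> : (y <= y - e) = false by apply/negbTE; rewrite -ltNge; lra.
    have -> : (y <= y + e) = true by lra.
    by move=> _ /=; move: c0; clear; lia.
  by move=> /andP[/eqP -> /eqP ->] /=; rewrite !addn0.
move=> + _ /andP[/eqP -> /eqP ->].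
case: (_ < _) => [/(_ isT) ->|_ /=].
  by rewrite /= add0n addnC.
by rewrite andbF.
Unshelve. all: by end_near. Qed.
End two_point_filtration.

(** * Measurability of the maps between points, clouds and diagrams *)

Section pair_diagram_measurability.
Variable R : realType.
Implicit Types (z : plane R) (A : set (plane R)).

Lemma measurable_Omega : measurable (Omega (R:=R)).
Proof.
have -> : Omega (R:=R) = (fun z => 0 <= z.1) @^-1` [set true]
    `&` (fun z => z.1 < z.2) @^-1` [set true].
  by apply/seteqP; split => z.
apply: measurableI; rewrite -[X in measurable X]setTI.
  by apply: (measurable_fun_ler (measurable_cst _) measurable_fst).
by apply: (measurable_fun_ltr measurable_fst measurable_snd).
Qed.

Lemma cloud_count_pair (B : set 'rV[R]_1) z : Omega z ->
  cloud_count B (pair_cloud z) =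
  (`[< B (const_mx z.1) >] + `[< B (const_mx z.2) >])%N.
Proof.
move=> [_ /lt_eqF z12]; rewrite /cloud_count /pair_cloud.
have -> : [fset x in [fset const_mx z.1; const_mx z.2]%fset | `[< B x >]]%fset =
  ((if `[< B (const_mx z.1) >] then [fset const_mx z.1] else fset0) `|`
   (if `[< B (const_mx z.2) >] then [fset const_mx z.2] else fset0))%fset.
  apply/fsetP => x; rewrite in_fsetU !inE /=.
  have memif p (v : 'rV[R]_1) :
      (x \in if p then [fset v]%fset else fset0) = p && (x == v).
    by case: p; rewrite !inE.
  rewrite !memif; have [->|x1] := eqVneq x (const_mx z.1) => /=.
    by rewrite (inj_eq (@const_mx_rV1_inj R)) z12 andbT andbF orbF.
  by have [->|] := eqVneq x (const_mx z.2); rewrite ?andbT ?andbF.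
case: ifP => _; case: ifP => _; rewrite ?fset0U ?fsetU0 ?cardfs1 ?cardfs0//.
by rewrite cardfs2 (inj_eq (@const_mx_rV1_inj R)) z12.
Qed.

Lemma measurable_cloud_count (B : set 'rV[R]_1) j : borel_cloud B ->
  measurable [set X : PointCloud R 1 | cloud_count B X = j].
Proof. by move=> bB; apply: sub_sigma_algebra; exists B, j. Qed.

Lemma borel_lt (t : R) : borel_cloud [set v : 'rV[R]_1 | v 0 0 < t].
Proof.
apply: sub_sigma_algebra => /=.
have -> : [set v : 'rV[R]_1 | v 0 0 < t] =
    (fun v : 'rV[R]_1 => v 0 0) @^-1` [set x | x < t] by [].
by apply: open_comp => [v _|]; [exact: coord_continuous|exact: open_lt].
Qed.

Let pair_set : set (PointCloud R 1) := [set X | exists z, Omega z /\ X = pair_cloud z].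

(** A description by counts only, hence measurable: two points, none of them negative. Sorting the
    two points then gives the element of [Omega]. *)
Let pair_setE : pair_set = [set X | cloud_count setT X = 2%N] `&`
  [set X | cloud_count [set v : 'rV[R]_1 | v 0 0 < 0] X = 0%N].
Proof.
apply/seteqP; split => [X [z [oz ->]]|X [/= X2 X0]].
  split=> /=; rewrite cloud_count_pair//; first by rewrite !asboolT.
  case: (oz) => z0 zz; rewrite /= !mxE !asboolF// => /= [|].
    by move=> /lt_trans/(_ (le_lt_trans z0 zz)); rewrite ltxx.
  by rewrite ltNge z0.
have : #|` X| = 2%N.
  rewrite -X2 /cloud_count; congr (size (enum_fset _)); apply/fsetP => x.
  by rewrite !inE asboolT ?andbT.
move=> Xsize; have [a [b [ab Xab]]] : exists a b, a != b /\ X = [fset a; b]%fset.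
  have := fset_uniq X; have memX : X =i enum_fset X by [].
  case: (enum_fset X) Xsize memX => [//|a [//|b [|//]]] _ memX /=.
  rewrite inE andbT => ab; exists a, b; split=> //.
  by apply/fsetP => x; rewrite memX !inE.
have pos (v : 'rV[R]_1) : v \in (X : {fset 'rV[R]_1}) -> 0 <= v 0 0.
  move=> vX; rewrite leNgt; apply/negP => v0; move: X0; rewrite /cloud_count.
  move/cardfs0_eq/fsetP/(_ v); rewrite !inE vX/= => /asboolP; exact.
have cE (v : 'rV[R]_1) : v = const_mx (v 0 0).
  by apply/rowP => i; rewrite !mxE (ord1 i).
have {}ab : a 0 0 != b 0 0.
  by apply: contra ab => /eqP e; rewrite [a]cE [b]cE e.
have [a0 b0] : 0 <= a 0 0 /\ 0 <= b 0 0.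
  by split; apply: pos; rewrite Xab !inE eqxx ?orbT.
have [lt_ab|lt_ba|] := ltgtP (a 0 0) (b 0 0); last by move/eqP: ab.
  by exists (a 0 0, b 0 0); split=> //; rewrite Xab/= /pair_cloud/= -!cE.
exists (b 0 0, a 0 0); split=> //; rewrite Xab/= /pair_cloud/= -!cE.
by rewrite fsetUC.
Qed.

Let measurable_pair_set : measurable pair_set.
Proof.
rewrite pair_setE; apply: measurableI; apply: measurable_cloud_count.
  by apply: sub_sigma_algebra; exact: openT.
exact: borel_lt.
Qed.

(** The inverse of [pair_cloud]; the default [(-1, -1)] lies outside [Omega], so that other clouds
    carry no mass. *)
Definition cloud_point (X : PointCloud R 1) : plane R :=
  xget (-1, -1) [set z | Omega z /\ X = pair_cloud z].

Lemma cloud_point_pair z : Omega z -> cloud_point (pair_cloud z) = z.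
Proof.
move=> oz; rewrite /cloud_point; case: xgetP => [_ -> [oz' /esym]|].
  exact: pair_cloud_inj.
by move=> /(_ z); case.
Qed.

Let cloud_pointN X : ~ pair_set X -> cloud_point X = (-1, -1).
Proof.
move=> nX; rewrite /cloud_point; case: xgetP => [z _ h|//].
by case: nX; exists z.
Qed.

(** A coordinate lies below [t] when more than [j] points of the cloud do: [j = 0] yields the
    smaller coordinate, [j = 1] the larger. The event is written by excluding the counts up to
    [j]. *)
Let measurable_comp_cloud_point (f : plane R -> R) (j : nat) :
  f (-1, -1) = -1 ->
  (forall t z, Omega z -> (f z < t) =
    (j < cloud_count [set v : 'rV[R]_1 | (v 0 0 < t)%R] (pair_cloud z))%N) ->
  measurable_fun setT (f \o cloud_point).
Proof.
move=> fN fE; apply: (measurability _ (RGenInftyO.measurableE R)).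
move=> _ [_ [t ->] <-]; rewrite setTI.
have -> : (f \o cloud_point) @^-1` `]-oo, t[%classic =
  (pair_set `&` \bigcap_(i in [set i | (i <= j)%N])
     ~` [set X | cloud_count [set v : 'rV[R]_1 | v 0 0 < t] X = i])
  `|` (~` pair_set `&` [set _ | -1 < t]).
  apply/seteqP; split => X; rewrite /= in_itv/=.
    have [[z [oz ->]]|nX] := pselect (pair_set X).
      rewrite cloud_point_pair// fE// => jc; left; split; first by exists z.
      by move=> i ij /= e; move: jc; rewrite e ltnNge ij.
    by rewrite cloud_pointN// fN => t1; right.
  move=> [[[z [oz ->]] h]|[nX t1]]; last by rewrite cloud_pointN// fN.
  rewrite cloud_point_pair// fE// ltnNge; apply/negP => h'.
  exact: (h _ h').
apply: measurableU.
  apply: measurableI => //; apply: bigcap_measurableType => i _.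
  by apply: measurableC; apply: measurable_cloud_count; exact: borel_lt.
apply: measurableI; first exact: measurableC.
have [t1|t1] := ltP (-1) t.
  by rewrite (_ : [set _ | _] = setT)//; apply/seteqP; split.
by rewrite (_ : [set _ | _] = set0)//; apply/seteqP; split.
Qed.

Lemma measurable_cloud_point : measurable_fun setT cloud_point.
Proof.
apply/measurable_fun_pairP; split.
  apply: (@measurable_comp_cloud_point _ 0) => // t z oz.
  rewrite cloud_count_pair//= !mxE; case: oz => _ zz.
  case: (asboolP (z.1 < t)) => [->//|/negP/negbTE z1t].
  by rewrite z1t asboolF// => /(lt_trans zz); rewrite z1t.
apply: (@measurable_comp_cloud_point _ 1) => // t z oz.
rewrite cloud_count_pair//= !mxE; case: oz => _ zz.
case: (asboolP (z.2 < t)) => [h|/negP/negbTE ->].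
  by rewrite h asboolT//; exact: lt_trans h.
by case: asboolP.
Qed.

Lemma mass_pair_diagram (X : PointCloud R 1) A :
  mass (pair_diagram X) A = (\1_(A `&` Omega (R:=R)) (cloud_point X) : R)%:E.
Proof.
rewrite /mass indicE; have m0 z : (0 <= (pair_diagram X z)%:R%:E :> \bar R)%E.
  by rewrite lee_fin.
have mE z : cloud_point X != z -> pair_mult X z = 0%N.
  move=> /eqP h; rewrite /pair_mult; case: asboolP => // -[oz Xz]; case: h.
  by rewrite Xz cloud_point_pair.
have [[Ac oc]|nA] := pselect ((A `&` Omega (R:=R)) (cloud_point X)); last first.
  rewrite memNset// esum1// => z Az /=; have [zc|/mE->//] := eqVneq (cloud_point X) z.
  move: nA; rewrite zc /= /pair_mult; case: asboolP => // -[oz _] [].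
  by split.
rewrite mem_set//= (esumID [set cloud_point X])//.
rewrite [X in (_ + X)%E]esum1 ?adde0; last first.
  by move=> z [_ /nesym/eqP/mE /= ->].
rewrite (_ : A `&` _ = [set cloud_point X]) ?esum_set1//; last first.
  by apply/seteqP; split=> [z []//|z ->].
congr (_%:R%:E); rewrite /= /pair_mult asboolT//; split=> //.
have [[z [oz Xz]]|nX] := pselect (pair_set X).
  by rewrite {2}Xz cloud_point_pair.
by case: oc; rewrite cloud_pointN//= oppr_ge0 ler10.
Qed.

Lemma measurable_indic_cloud_point A : measurable A ->
  measurable_fun setT (fun X => (\1_(A `&` Omega (R:=R)) (cloud_point X) : R)%:E).
Proof.
move=> mA; apply/measurable_EFinP; apply: measurableT_comp.
  by apply: measurable_indic; apply: measurableI => //; exact: measurable_Omega.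
exact: measurable_cloud_point.
Qed.

Lemma measurable_pair_diagram : measurable_fun setT (@pair_diagram R).
Proof.
apply: (@measurability _ _ (PointCloud R 1) (PD R) setT _ (@PD_generators R) erefl).
move=> _ [_ [A [B [mA _ mB ->]]] <-]; rewrite setTI -comp_preimage.
rewrite (_ : _ \o _ =
    fun X => (\1_(A `&` Omega (R:=R)) (cloud_point X) : R)%:E); last first.
  by apply/funext => X; exact: mass_pair_diagram.
by rewrite -[X in measurable X]setTI; exact: measurable_indic_cloud_point.
Qed.

(** A total map, so that measures on the whole plane can be pushed forward: points outside [Omega]
    give the empty cloud, hence the empty diagram. *)
Definition point_cloud z : PointCloud R 1 :=
  if `[< Omega z >] then pair_cloud z else fset0.

Lemma const_mx_continuous : continuous (@const_mx R 1 1).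
Proof.
move=> x; apply/cvg_ballP => e e0.
have := @nbhsx_ballx R R x e e0; apply: filterS => y xy.
by split=> // i j; rewrite !mxE.
Qed.

Lemma measurable_preimage_const_mx (B : set 'rV[R]_1) : borel_cloud B ->
  measurable [set x : measurableTypeR R | B (const_mx x)].
Proof.
pose C := [set B' : set 'rV[R]_1 |
             measurable [set x : measurableTypeR R | B' (const_mx x)]].
apply: (@smallest_sub _ _ _ C); first split => [|A mA|A mA].
- exact: measurable0.
- rewrite /C/= (_ : [set x | _] = ~` [set x | A (const_mx x)]).
    exact: measurableC.
  by apply/seteqP; split => [x []//|x].
- rewrite /C/= (_ : [set x | _] = \bigcup_k [set x | A k (const_mx x)]).
    exact: bigcupT_measurable.
  by apply/seteqP; split.
move=> U oU; apply: open_measurable.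
by apply: open_comp => // x _; exact: const_mx_continuous.
Qed.

Lemma measurable_point_cloud : measurable_fun setT point_cloud.
Proof.
apply: (@measurability _ _ (plane R) (PointCloud R 1) setT _ (@cloud_generators R 1) erefl).
move=> _ [_ [B [j [bB ->]]] <-]; rewrite setTI.
have mB := measurable_preimage_const_mx bB; set B' := [set x | _] in mB.
(* The count of the cloud of [z] in [B] as a measurable real function; the factor [\1_Omega]
   accounts for the empty cloud. *)
pose f z : R := \1_(Omega (R:=R)) z * (\1_B' z.1 + \1_B' z.2).
have mf : measurable_fun setT f.
  apply: measurable_funM; first by apply: measurable_indic; exact: measurable_Omega.
  by apply: measurable_funD; apply: measurableT_comp => //;
    apply: measurable_indic.
have -> : point_cloud @^-1` [set X | cloud_count B X = j] = f @^-1` [set j%:R].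
  have fE z : f z = (cloud_count B (point_cloud z))%:R.
    rewrite /f /point_cloud indicE; case: asboolP => oz.
      rewrite mem_set// mul1r cloud_count_pair// natrD !indicE.
      by congr (_%:R + _%:R).
    rewrite memNset// mul0r /cloud_count (_ : [fset _ in _ | _]%fset = fset0)//.
    by apply/fsetP => v; rewrite !inE.
  apply/seteqP; split => z /=; first by rewrite fE => ->.
  by rewrite fE => /eqP; rewrite eqr_nat => /eqP.
by rewrite -[X in measurable X]setTI; apply: mf => //; exact: measurable_set1.
Qed.

Definition point_diagram z : PD R := pair_diagram (point_cloud z).

Lemma measurable_point_diagram : measurable_fun setT point_diagram.
Proof. exact: measurableT_comp measurable_pair_diagram measurable_point_cloud. Qed.

Lemma mass_point_diagram z A :
  mass (point_diagram z) A = (\1_(A `&` Omega (R:=R)) z : R)%:E.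
Proof.
rewrite mass_pair_diagram /point_cloud; case: asboolP => oz.
  by rewrite cloud_point_pair.
rewrite !indicE !memNset => [//|[]//|[_]].
rewrite /cloud_point; case: xgetP => [z' _ [_ /fsetP/(_ (const_mx z'.1))]|_ []/=].
  by rewrite /pair_cloud !inE eqxx.
by rewrite oppr_ge0 ler10.
Qed.

Lemma point_diagram_support z z' : point_diagram z z' != 0%N -> z' = z.
Proof.
rewrite /= /pair_mult /point_cloud; case: asboolP => // -[oz'].
case: asboolP => [oz /pair_cloud_inj->//|_ /fsetP/(_ (const_mx z'.1))].
by rewrite /pair_cloud !inE eqxx.
Qed.

Let exhaustion n : set (plane R) :=
  [set z | [/\ 0 <= z.1, z.2 <= n%:R & n.+1%:R^-1 <= z.2 - z.1]].

Let exhaustion_compact n : compact (exhaustion n).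
Proof.
have -> : exhaustion n = (`[0, n%:R] `*` `[0, n%:R]) `&`
    [set z | n.+1%:R^-1 <= z.2 - z.1].
  apply/seteqP; split => [[x y] [/= x0 yn h]|[x y] [[/=]]].
    have h0 : 0 < n.+1%:R^-1 :> R by rewrite invr_gt0.
    have xy : x <= y by rewrite -subr_ge0; exact: le_trans (ltW h0) h.
    rewrite /= !in_itv/=; split=> //; split; apply/andP; split=> //.
      exact: le_trans yn.
    exact: le_trans xy.
  by rewrite !in_itv/= => /andP[? ?] /andP[? ?] ?; split.
apply: compact_closedI.
  by apply: compact_setX; exact: segment_compact.
apply: (@closed_comp _ _ (fun z : R * R => z.2 - z.1) [set x | n.+1%:R^-1 <= x]).
  move=> z _; apply: continuousB; [exact: cvg_snd|exact: cvg_fst].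
exact: closed_ge.
Qed.

(** The σ-field only knows masses of relatively compact sets. The compact sets [exhaustion n] cover
    [Omega], so [A] splits into countably many relatively compact pieces and a part outside [Omega],
    which has no mass. *)
Lemma measurable_mass A : measurable A ->
  measurable_fun setT (fun D : PD R => mass D A).
Proof.
move=> mA.
pose E := seqDU (fun n => A `&` exhaustion n).
have mexh n : measurable (exhaustion n).
  have -> : exhaustion n = (fun z => 0 <= z.1) @^-1` [set true]
      `&` (fun z => z.2 <= n%:R) @^-1` [set true]
      `&` (fun z => n.+1%:R^-1 <= z.2 - z.1) @^-1` [set true].
    by apply/seteqP; split => [z [? ? ?]|z [[? ?] ?]].
  apply: measurableI; first apply: measurableI; rewrite -[X in measurable X]setTI.
  - by apply: (measurable_fun_ler (measurable_cst _) measurable_fst).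
  - by apply: (measurable_fun_ler measurable_snd (measurable_cst _)).
  - by apply: (measurable_fun_ler (measurable_cst _)
      (measurable_funB measurable_snd measurable_fst)).
have mE n : measurable (E n).
  by apply: measurableD; [exact: measurableI|
    apply: bigsetU_measurable => i _; exact: measurableI].
have exhO n : exhaustion n `<=` Omega (R:=R).
  move=> z [z1 _ h]; split=> //; rewrite -subr_gt0; apply: lt_le_trans h.
  by rewrite invr_gt0.
have massE (D : PD R) : mass D A = (\sum_(n <oo) mass D (E n))%E.
  have D0 z : (0 <= (D z)%:R%:E :> \bar R)%E by rewrite lee_fin.
  rewrite nneseries_esumT => [|n]; last by apply: esum_ge0.
  rewrite /mass -esum_bigcupT//; last exact: trivIset_seqDU.
  rewrite (esumID (Omega (R:=R)))// [X in (_ + X)%E]esum1 ?adde0; last first.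
    by move=> z [_ nz]; rewrite mult_Omega.
  congr esum; rewrite -seqDU_bigcup_eq; apply/seteqP; split.
    move=> z [Az [z0 zz]].
    pose k1 := Num.truncn z.2; pose k2 := Num.truncn (z.2 - z.1)^-1.
    exists (maxn k1.+1 k2) => //; split=> //; split=> //.
      apply: ltW; apply: (lt_le_trans (truncnS_gt z.2)).
      by rewrite ler_nat leq_max leqnn.
    rewrite -[leRHS]invrK lef_pV2 ?posrE ?invr_gt0 ?subr_gt0 ?ltr0n//.
    apply: ltW; apply: (lt_le_trans (truncnS_gt _)).
    by rewrite ler_nat ltnS leq_max leqnn orbT.
  by move=> z [n _ [Az /exhO]].
rewrite (_ : (fun _ => _) = fun D : PD R => (\sum_(n <oo) mass D (E n))%E); last first.
  exact/funext.
apply: (@ge0_emeasurable_sum _ _ _ _ _ xpredT) => [n D _ _|n _].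
  by apply: esum_ge0 => z _; rewrite lee_fin.
move=> _ B mB; rewrite setTI; apply: sub_sigma_algebra.
exists (E n), B; split=> //; exists (exhaustion n); split=> //.
by apply: subset_trans (@subDsetl _ _ _) (@subIsetr _ _ _).
Qed.
End pair_diagram_measurability.

(** * Laws of one-point diagrams with a prescribed density *)

Lemma ex_density_probability (d : measure_display) (T : measurableType d)
    (R : realType) (mu : {measure set T -> \bar R}) (p : T -> R) :
  measurable_fun setT p -> (forall x, 0 <= p x) ->
  (\int[mu]_x (p x)%:E = 1)%E ->
  exists P : probability T R, forall A, P A = (\int[mu]_(x in A) (p x)%:E)%E.
Proof.
move=> mp p0 p1; pose nu A := (\int[mu]_(x in A) (p x)%:E)%E.
have nu0 : nu set0 = 0%E by rewrite /nu integral_set0.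
have nu_ge0 A : (0 <= nu A)%E by apply: integral_ge0 => x _; rewrite lee_fin.
have nu_sigma : semi_sigma_additive nu.
  by apply: semi_sigma_additive_nng_induced => //; exact/measurable_EFinP.
pose nuM := isMeasure.Build _ _ _ nu nu0 nu_ge0 nu_sigma.
pose nu' : {measure set T -> \bar R} := HB.pack nu nuM.
pose nuP := Measure_isProbability.Build _ _ _ nu' p1.
by pose P : probability T R := HB.pack nu nuM nuP; exists P.
Qed.

Section diagram_law.
Variables (R : realType) (F : fieldType) (w : plane R -> R) (M N : R).
Implicit Types p : plane R -> R.

HB.instance Definition _ :=
  isMeasurableFun.Build _ _ _ _ (@point_diagram R) (@measurable_point_diagram R).

Record diagram_density p : Prop := DiagramDensity {
  density_measurable : measurable_fun setT p;
  density_ge0 : forall z, 0 <= p z;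
  density_int1 : (\int[@Leb2 R]_z (p z)%:E = 1)%E;
  density_support : forall z, p z != 0 -> OmegaM M z }.

Definition law_of p (P : probability (PD R) R) :=
  forall S, measurable S ->
    P S = (\int[@Leb2 R]_(z in @point_diagram R @^-1` S) (p z)%:E)%E.

Lemma density_integral_Omega p A : diagram_density p -> measurable A ->
  (\int[@Leb2 R]_(z in A `&` Omega (R:=R)) (p z)%:E =
   \int[@Leb2 R]_(z in A) (p z)%:E)%E.
Proof.
move=> [mp p0 p1 pM] mA; rewrite integral_mkcondr.
apply: eq_integral => z _; rewrite patchE; case: ifPn => //.
rewrite notin_setE => nz; congr EFin; apply/esym/eqP.
by apply/negPn/negP => /pM [].
Qed.

Lemma measurable_OmegaM : measurable (OmegaM M).
Proof.
apply: measurableI; first exact: measurable_Omega.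
rewrite (_ : [set _ | _] = (fun z => z.2 < M) @^-1` [set true])//.
rewrite -[X in measurable X]setTI.
by apply: (measurable_fun_ltr measurable_snd (measurable_cst _)).
Qed.

(** The probability space is the plane with density [p], and both [Z] and [h] are constantly 1: a
    one-point diagram has mass at most 1, the only nontrivial conditional density is [p] itself, and
    the series in the class reduces to the supremum of [w^2 p]. *)
Lemma ex_diagram_law p : diagram_density p ->
  exists P : probability (PD R) R, [/\ law_of p P, is_density (mean P) p &
    (forall z, w z ^+ 2 * p z <= N) -> class_P F w M N P].
Proof.
move=> hp; have [mp p0 p1 pM] := hp.
have [mu muE] := ex_density_probability mp p0 p1.
have mass_int A : measurable A ->
    (\int[mu]_z mass (point_diagram z) A)%E = (\int[@Leb2 R]_(z in A) (p z)%:E)%E.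
  move=> mA; rewrite (eq_integral (fun z => (\1_(A `&` Omega (R:=R)) z : R)%:E)).
    rewrite integral_indic//; last by apply: measurableI => //; exact: measurable_Omega.
    by rewrite setIT; apply: etrans (muE _) _; exact: density_integral_Omega.
  by move=> z _; exact: mass_point_diagram.
exists (distribution mu (@point_diagram R)); split.
- by move=> S mS; exact: muE.
- split=> // A mA; rewrite /mean ge0_integral_pushforward//=.
  + by rewrite preimage_setT; exact: mass_int.
  + exact: measurable_mass.
  + by move=> D _; apply: esum_ge0 => z _; rewrite lee_fin.
move=> wp.
exists _, (plane R), mu, 1%N, 0%N, (@pair_filtration R), (@pair_diagram R),
  (@point_cloud R), (fun=> 1%N), (fun=> 1),
  (fun l => if l == 1%N then p else fun=> 0); split.
- split.
  + exact: pair_filtration_is_filtration.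
  + by split; [exact: measurable_pair_diagram|exact: pair_diagram_is_PD].
  + exact: measurable_point_cloud.
  + by [].
- exists (~` OmegaM M); split.
  + exact: measurableC measurable_OmegaM.
  + apply: (etrans (muE _)); apply: integral0_eq => z /= nz; congr EFin; apply/eqP.
    by apply/negPn/negP => /pM.
  + by apply: subsetC => z [_ zM] z' /point_diagram_support ->.
- split.
  + by split.
  + apply: aeW => z /=; rewrite mass_point_diagram indicE.
    by case: (_ \in _); rewrite lee_fin ?ler01.
  + move=> l l0; case: eqVneq => [->|l1].
      split=> // A mA; rewrite /cond_mean (_ : _ @^-1` _ = setT); last first.
        by apply/seteqP; split.
      by rewrite probability_setT/= invr1 mul1e mass_int.
    split=> [|//|A mA]; first exact: measurable_cst.
    rewrite /cond_mean (_ : _ @^-1` _ = set0); last first.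
      by apply/seteqP; split=> // z /esym/eqP; rewrite (negbTE l1).
    by rewrite integral_set0 mule0 integral0.
  (* Only the term [l = 1] survives, since [Z] takes no other value. *)
  + have sum1 (u : nat -> \bar R) : (forall l, l != 1%N -> u l = 0%E) ->
        (\sum_(1 <= l <oo) u l = u 1%N)%E.
      move=> u0; apply: lim_near_cst => //; exists 2%N => // n /= n2.
      rewrite big_ltn// big_nat_cond big1 ?adde0// => l /andP[/andP[l1 _] _].
      by rewrite u0// gtn_eqF.
    rewrite sum1 /= => [|l l1]; last first.
      rewrite (_ : _ @^-1` _ = set0) ?measure0 ?mule0// preimage_cst ifN//.
      by rewrite notin_setE => /esym/eqP; rewrite (negbTE l1).
    rewrite (_ : _ @^-1` _ = setT); last by apply/seteqP; split.
    rewrite probability_setT mule1 mul1e; apply/ess_supP.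
    by apply: aeW => z /=; rewrite lee_fin.
Qed.
End diagram_law.

(** * Products of finite mixtures and the chi-square bound *)

Section mixture.
Context (d : measure_display) (T : measurableType d) (R : realType) (S : finType).
Variables (nu : S -> probability T R).

(** The law of independent observations whose labels are the entries of [t]; the recursion mirrors
    that of [iid]. *)
Fixpoint niid (n : nat) : n.-tuple S -> probability (n.-tuple T) R :=
  if n is n'.+1 then fun t : n'.+1.-tuple S =>
    distribution (nu (thead t) \x niid (behead_tuple t))%E (@tcons d T n')
  else fun=> \d_[tuple].

Lemma sum_tupleS (V : nmodType) n (f : n.+1.-tuple S -> V) :
  \sum_t f t = \sum_s \sum_(t : n.-tuple S) f [tuple of s :: t].
Proof.
rewrite pair_bigA (reindex (fun q : S * n.-tuple S => [tuple of q.1 :: q.2]))//=.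
exists (fun t => (thead t, behead_tuple t)) => [[s t] _|t _] /=.
  by rewrite theadE; congr pair; apply/val_inj.
by rewrite [RHS]tuple_eta; apply/val_inj.
Qed.

Definition tuple_weight (f : S -> R) n (t : n.-tuple S) : R := \prod_(i < n) f (tnth t i).

Lemma tuple_weightS (f : S -> R) n s (t : n.-tuple S) :
  tuple_weight f [tuple of s :: t] = f s * tuple_weight f t.
Proof.
rewrite /tuple_weight big_ord_recl tnth0; congr (_ * _).
by apply: eq_bigr => i _; rewrite tnthS.
Qed.

(** Serves twice: with probability weights it gives total mass 1, with ratios of weights it
    tensorises the second moment. *)
Lemma sum_tuple_weight (f : S -> R) n :
  \sum_(t : n.-tuple S) tuple_weight f t = (\sum_s f s) ^+ n.
Proof.
elim: n => [|n ih].
  rewrite (eq_bigr (fun=> 1)) => [|t _]; last by rewrite /tuple_weight big_ord0.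
  by rewrite sumr_const card_tuple expn0.
rewrite sum_tupleS exprS mulr_suml; apply: eq_bigr => s _.
by rewrite -ih mulr_sumr; apply: eq_bigr => t _; rewrite tuple_weightS.
Qed.

Lemma niidS n s (t : n.-tuple S) A : niid [tuple of s :: t] A =
  (\int[nu s]_x niid t (xsection (@tcons d T n @^-1` A) x))%E.
Proof.
rewrite -[LHS]/(\int[nu (thead [tuple of s :: t])]_x
  niid (@behead_tuple n.+1 S [tuple of s :: t]) (xsection (@tcons d T n @^-1` A) x))%E.
rewrite theadE; congr integral; apply/funext => x; congr (niid _ _).
exact/val_inj.
Qed.

Variables (P : probability T R) (f : S -> R).
Hypothesis f0 : forall s, 0 <= f s.
Hypothesis Pmix : forall A, measurable A -> (P A = \sum_s (f s)%:E * nu s A)%E.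

Lemma ge0_integral_mixture (g : T -> \bar R) : measurable_fun setT g ->
  (forall x, 0 <= g x)%E ->
  (\int[P]_x g x = \sum_s (f s)%:E * \int[nu s]_x g x)%E.
Proof.
move=> mg g0.
(* An empty [S] would give [P] total mass 0; [s0] is the default value for [nth]. *)
have s0 : S.
  have [//|] := pickP (predT : pred S) => S0.
  have := Pmix measurableT; rewrite probability_setT big_pred0//.
  by move=> /eqP; rewrite onee_eq0.
pose m k : {measure set T -> \bar R} :=
  mscale (NngNum (f0 (nth s0 (enum S) k))) (nu (nth s0 (enum S) k)).
have sumE (h : S -> \bar R) : (\sum_s h s = \sum_(k < #|S|) h (nth s0 (enum S) k))%E.
  by rewrite -big_enum (big_nth s0)/= big_mkord -cardE.
rewrite (@eq_measure_integral _ _ _ _ (msum m #|S|)).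
  rewrite ge0_integral_measure_sum// sumE; apply: eq_bigr => k _.
  by rewrite ge0_integral_mscale.
by move=> A mA _; apply: etrans (Pmix mA) _; exact: sumE.
Qed.

(** Sampling from a mixture amounts to drawing the labels independently and then each observation
    from the law of its label. *)
Lemma iid_mixture n A : measurable A ->
  (iid P n A = \sum_t (tuple_weight f t)%:E * niid t A)%E.
Proof.
elim: n A => [|n ih] A mA.
  rewrite (eq_bigr (fun=> \d_[tuple] A)) => [|t _]; last first.
    by rewrite /tuple_weight big_ord0 mul1e.
  by rewrite big_const card_tuple expn0 /= adde0.
have mB : measurable (@tcons d T n @^-1` A).
  by rewrite -[X in measurable X]setTI; exact: measurable_tcons.
set B := _ @^-1` A in mB.
have w0 (t : n.-tuple S) : (0 <= (tuple_weight f t)%:E)%E.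
  by rewrite lee_fin; apply: prodr_ge0 => i _.
have mx (t : n.-tuple S) : measurable_fun setT (fun x => niid t (xsection B x)).
  exact: measurable_fun_xsection.
have mwx (t : n.-tuple S) :
    measurable_fun setT (fun x => (tuple_weight f t)%:E * niid t (xsection B x))%E.
  exact: measurable_funeM.
rewrite sum_tupleS -[LHS]/(\int[P]_x iid P n (xsection B x))%E.
rewrite (eq_integral (fun x =>
    (\sum_t (tuple_weight f t)%:E * niid t (xsection B x))%E)); last first.
  by move=> x _; apply: ih; exact: measurable_xsection.
rewrite ge0_integral_mixture; last 2 first.
- exact: emeasurable_sum.
- by move=> x; apply: sume_ge0 => t _; rewrite mule_ge0.
apply: eq_bigr => s _.
rewrite ge0_integral_sum//; last by move=> t x _; exact: mule_ge0.
rewrite ge0_sume_distrr => [|t _]; last first.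
  by apply: integral_ge0 => x _; exact: mule_ge0.
apply: eq_bigr => t _; rewrite tuple_weightS EFinM -muleA; congr (_ * _)%E.
rewrite ge0_integralZl//; congr (_ * _)%E.
by rewrite niidS.
Qed.

End mixture.

(** * Chi-square bound for random signs on the cells *)

Section second_moment.
Variable R : realType.

(** From [exp x <= 1 / (1 - x)], applied to [y] and to [- y]. *)
Lemma cosh_le (y : R) : y ^+ 2 < 1 -> expR y + expR (- y) <= 2 / (1 - y ^+ 2).
Proof.
move=> y1; have [l r] : - 1 < y /\ y < 1 by split; nra.
have h (x : R) : x < 1 -> expR x <= (1 - x)^-1.
  move=> x1; rewrite -[expR x]invrK -expRN lef_pV2 ?posrE ?expR_gt0//; last lra.
  by have := expR_ge1Dx (- x).
have := h _ r; have := h (- y); rewrite opprK => /(_ _)H1 H2.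
have e : 2 / (1 - y ^+ 2) = (1 + y)^-1 + (1 - y)^-1.
  by field; rewrite !gt_eqF //; lra.
by rewrite e; have := H1 ltac:(lra); lra.
Qed.

Lemma bernoulli_le (y : R) n : 0 <= y -> y <= 1 -> 1 - n%:R * y <= (1 - y) ^+ n.
Proof.
move=> y0 y1; elim: n => [|n ih]; first by rewrite mul0r subr0.
have : 0 <= n%:R * y by rewrite mulr_ge0.
rewrite exprS -natr1; have := ler_wpM2l (_ : 0 <= 1 - y) ih.
by move=> /(_ ltac:(lra)); nra.
Qed.

(* Cauchy-Schwarz in the form 2 |x| <= eta p + x ^ 2 / (eta p), summed over X. *)
Lemma sum_diff_le (X : finType) (p q a : X -> R) (eta chi : R) :
  0 < eta -> (forall x, 0 < p x) -> \sum_x p x = 1 -> \sum_x q x = 1 ->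
  (forall x, 0 <= a x <= 1) -> \sum_x q x ^+ 2 / p x <= 1 + chi ->
  \sum_x q x * a x <= \sum_x p x * a x + (eta + chi / eta) / 2.
Proof.
move=> eta0 p0 p1 q1 a01 hchi.
have H x : q x * a x <= p x * a x + (eta / 2 * p x +
    (q x ^+ 2 / p x - 2 * q x + p x) / (2 * eta)).
  have px := p0 x; set D := q x - p x.
  have -> : q x ^+ 2 / p x - 2 * q x + p x = D ^+ 2 / p x.
    by rewrite /D; field; rewrite gt_eqF.
  have amgm : `|D| <= eta / 2 * p x + D ^+ 2 / p x / (2 * eta).
    rewrite -(real_normK (num_real D)); set v := `|D|.
    have -> : eta / 2 * p x + v ^+ 2 / p x / (2 * eta) =
        v + (eta * p x - v) ^+ 2 / (2 * eta * p x) by field; rewrite !gt_eqF.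
    by rewrite lerDl divr_ge0 ?sqr_ge0// !mulr_ge0// ltW.
  have : D * a x <= `|D|.
    have /andP[a0 a1] := a01 x; apply: le_trans (ler_norm _) _.
    by rewrite normrM [X in _ * X]ger0_norm// ler_piMr.
  by rewrite /D in amgm *; lra.
apply: le_trans (ler_sum _ (fun x _ => H x)) _.
rewrite big_split/=; apply: lerD; first exact: lexx.
rewrite big_split/= -mulr_sumr p1 -mulr_suml.
rewrite big_split/= sumrB -mulr_sumr q1 p1 !mulr1.
rewrite (_ : (eta + chi / eta) / 2 = eta / 2 + chi / (2 * eta)); last first.
  by field; rewrite gt_eqF.
apply: lerD; first exact: lexx.
by rewrite ler_pM2r ?invr_gt0 ?mulr_gt0//; lra.
Qed.

Variables (J : finType) (eps : R).
Hypotheses (J0 : (0 < #|J|)%N) (eps01 : 0 < eps < 1).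

Local Notation K := (#|J|%:R : R).
Local Notation sgn := (fun b : bool => (-1) ^+ b : R).

(** [None] is the label of the uniform law. A cell has mass [eps / K] for every [v] and [delta]; the
    sign only decides which of its two bumps is favoured. *)
Definition cell_weight (delta : R) (v : J -> bool) (s : option (J * bool)) : R :=
  if s is Some q then eps * (1 + delta * sgn (v q.1) * sgn q.2) / (2 * K)
  else 1 - eps.

Let K0 : 0 < K. Proof. by rewrite ltr0n. Qed.

Lemma sum_option (I : finType) (f : option I -> R) :
  \sum_s f s = f None + \sum_i f (Some i).
Proof.
rewrite (bigD1 None)//=; congr (_ + _).
rewrite (reindex_omap Some id) => [|[]//].
by apply: eq_bigl => i; rewrite eqxx.
Qed.

Lemma sum_option_cells (f : option (J * bool) -> R) :
  \sum_s f s = f None + \sum_j (f (Some (j, false)) + f (Some (j, true))).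
Proof.
rewrite sum_option; congr (_ + _).
rewrite (eq_bigr (fun q => f (Some (q.1, q.2)))) => [|[]//].
rewrite -(pair_bigA _ (fun j b => f (Some (j, b))))/=.
by apply: eq_bigr => j _; rewrite big_bool addrC.
Qed.

Lemma cell_weight_ge0 delta v s : 0 <= delta <= 1 -> 0 <= cell_weight delta v s.
Proof.
move=> /andP[d0 d1]; have /andP[e0 e1] := eps01.
case: s => [[j b]|] /=; last by lra.
rewrite divr_ge0// mulr_ge0//; first exact: ltW.
by case: (v j) b => [] []; rewrite ?expr0 ?expr1; lra.
Qed.

Lemma cell_weight0_gt0 v s : 0 < cell_weight 0 v s.
Proof.
have /andP[e0 e1] := eps01; case: s => [[j b]|] /=; last by lra.
by rewrite !mul0r addr0 mulr1 divr_gt0// mulr_gt0.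
Qed.

Lemma sum_cell_weight delta v : \sum_s cell_weight delta v s = 1.
Proof.
rewrite sum_option_cells/= (eq_bigr (fun=> eps / K)); last first.
  by move=> j _; rewrite expr0 expr1; field; rewrite gt_eqF.
rewrite sumr_const -[_ *+ _]mulr_natr -mulrA mulVf ?gt_eqF// mulr1; lra.
Qed.

(** In each cell the terms linear in [delta] have opposite signs for the two bumps and cancel; only
    the product of the two perturbations remains. *)
Lemma cell_weight_affinity delta v v' v0 :
  \sum_s cell_weight delta v s * cell_weight delta v' s / cell_weight 0 v0 s =
  1 + \sum_j eps * delta ^+ 2 / K * (sgn (v j) * sgn (v' j)).
Proof.
have /andP[e0 e1] := eps01.
rewrite sum_option_cells/= mulfK; last by rewrite gt_eqF//; lra.
rewrite (eq_bigr (fun j => eps / K + eps * delta ^+ 2 / K * (sgn (v j) * sgn (v' j)))).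
  rewrite big_split/= sumr_const -[_ *+ _]mulr_natr -mulrA mulVf ?gt_eqF// mulr1.
  by ring.
move=> j _; rewrite !mul0r !addr0 mulr1 expr0 expr1.
by field; rewrite !gt_eqF.
Qed.

(** The exponential factorises over the cells, and either value of [v j] gives the same two terms,
    so the sum is the same for all [v]. *)
Lemma sum_exp_signs (v : {ffun J -> bool}) (y : R) :
  \sum_(v' : {ffun J -> bool}) expR (\sum_j y * (sgn (v j) * sgn (v' j))) =
  (expR y + expR (- y)) ^+ #|J|.
Proof.
under eq_bigr do rewrite expR_sum.
rewrite -(bigA_distr_bigA (fun j b => expR (y * (sgn (v j) * sgn b)))) /=.
rewrite -prodr_const; apply: eq_bigr => j _; rewrite big_bool/=.
by case: (v j); rewrite expr0 expr1 !(mul1r, mulrN1, mulr1, mulrN, opprK) // addrC.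
Qed.

Lemma tuple_weight_affinity (f g h : option (J * bool) -> R) n
    (t : n.-tuple (option (J * bool))) :
  tuple_weight f t * tuple_weight g t / tuple_weight h t =
  tuple_weight (fun s => f s * g s / h s) t.
Proof. by rewrite /tuple_weight -big_split/= -prodf_div. Qed.

(** The chain [cosh(y)^K <= (1 - y^2)^(-K) <= 1 / (1 - K y^2) <= 1 + 2 K y^2] bounds the chi-square
    of the label laws by [eta^2], and [sum_diff_le] turns this into a difference of at most [eta].
    The function [a] is a randomised test on the labels. *)
Lemma average_tuple_weight_le (delta eta : R) m v0
    (a : m.-tuple (option (J * bool)) -> R) (y := m%:R * (eps * delta ^+ 2 / K)) :
  0 <= delta <= 1 -> 0 < eta -> (forall t, 0 <= a t <= 1) ->
  K * y ^+ 2 <= 2^-1 -> 2 * (K * y ^+ 2) <= eta ^+ 2 ->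
  \sum_(v : {ffun J -> bool}) \sum_t tuple_weight (cell_weight delta v) t * a t <=
  #|{ffun J -> bool}|%:R * (\sum_t tuple_weight (cell_weight 0 v0) t * a t + eta).
Proof.
move=> d01 eta0 a01 yK yeta; set V := #|_|%:R : R.
have V2 : V = 2 ^+ #|J| by rewrite /V card_ffun card_bool natrX.
have V0 : 0 < V by rewrite V2 exprn_gt0.
(* The label law averaged uniformly over all sign vectors. *)
pose q (t : m.-tuple (option (J * bool))) :=
  V^-1 * \sum_(v : {ffun J -> bool}) tuple_weight (cell_weight delta v) t.
have W0 (v : J -> bool) (t : m.-tuple (option (J * bool))) :
    0 <= tuple_weight (cell_weight delta v) t :> R.
  by apply: prodr_ge0 => i _; exact: cell_weight_ge0.
have qsum : \sum_(t : m.-tuple (option (J * bool))) q t = 1.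
  rewrite -mulr_sumr exchange_big/= (eq_bigr (fun=> 1)) => [|v _]; last first.
    by rewrite sum_tuple_weight sum_cell_weight expr1n.
  by rewrite sumr_const mulVf// gt_eqF.
have psum : \sum_(t : m.-tuple (option (J * bool))) tuple_weight (cell_weight 0 v0) t = 1.
  by rewrite sum_tuple_weight sum_cell_weight expr1n.
have p0 (t : m.-tuple (option (J * bool))) : 0 < tuple_weight (cell_weight 0 v0) t.
  by apply: prodr_gt0 => i _; exact: cell_weight0_gt0.
have y2 : y ^+ 2 <= 2^-1.
  apply: le_trans yK; rewrite ler_peMl ?sqr_ge0//.
  by rewrite -[1]/(1%:R) ler_nat.
have chi2 : \sum_(t : m.-tuple (option (J * bool))) q t ^+ 2 / tuple_weight (cell_weight 0 v0) t <=
    1 + 2 * (K * y ^+ 2).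
  (* One observation contributes a factor [1 + x], and [(1 + x)^m <= exp (m x)]. *)
  have step v v' : \sum_(t : m.-tuple (option (J * bool))) tuple_weight (cell_weight delta v) t *
      tuple_weight (cell_weight delta v') t / tuple_weight (cell_weight 0 v0) t <=
      expR (\sum_j y * (sgn (v j) * sgn (v' j))).
    under eq_bigr do rewrite tuple_weight_affinity.
    rewrite sum_tuple_weight cell_weight_affinity.
    rewrite /y; under [X in expR X]eq_bigr do rewrite -mulrA.
    rewrite -[X in expR X]mulr_sumr expRM_natl; apply: lerXn2r; rewrite ?nnegrE ?expR_ge0//.
      rewrite -(cell_weight_affinity _ _ _ v0); apply: sumr_ge0 => s _.
      apply: divr_ge0; last exact/ltW/cell_weight0_gt0.
      by apply: mulr_ge0; exact: cell_weight_ge0.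
    exact: expR_ge1Dx.
  have -> : \sum_(t : m.-tuple (option (J * bool))) q t ^+ 2 / tuple_weight (cell_weight 0 v0) t =
      V^-2 * \sum_(v : {ffun J -> bool}) \sum_(v' : {ffun J -> bool})
        \sum_(t : m.-tuple (option (J * bool))) tuple_weight (cell_weight delta v) t *
        tuple_weight (cell_weight delta v') t / tuple_weight (cell_weight 0 v0) t.
    under [in RHS]eq_bigr do rewrite exchange_big/=.
    rewrite exchange_big/= mulr_sumr; apply: eq_bigr => t _.
    rewrite /q exprMn exprVn -mulrA; congr (_ * _).
    rewrite expr2 mulr_suml mulr_suml; apply: eq_bigr => v _.
    by rewrite mulr_sumr mulr_suml.
  apply: (@le_trans _ _ (V^-2 * \sum_(v : {ffun J -> bool}) (expR y + expR (- y)) ^+ #|J|)).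
    rewrite ler_wpM2l ?invr_ge0 ?sqr_ge0//; apply: ler_sum => v _.
    by rewrite -(sum_exp_signs v); apply: ler_sum => v' _; exact: step.
  rewrite sumr_const -[_ *+ _]mulr_natr -/V.
  rewrite (_ : V ^- 2 * _ = ((expR y + expR (- y)) / 2) ^+ #|J|); last first.
    have aux (E W : R) : 0 < W -> W ^- 2 * (E * W) = E / W.
      by move=> W1; field; rewrite gt_eqF.
    by rewrite expr_div_n -V2 aux.
  apply: (@le_trans _ _ (((1 - y ^+ 2)^-1) ^+ #|J|)).
    apply: lerXn2r; rewrite ?nnegrE.
    - by rewrite divr_ge0// addr_ge0 ?expR_ge0.
    - by rewrite invr_ge0; lra.
    - rewrite ler_pdivrMr// mulrC; apply: cosh_le; lra.
  rewrite exprVn; apply: (@le_trans _ _ (1 - K * y ^+ 2)^-1).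
    rewrite lef_pV2 ?posrE; [|by apply: exprn_gt0; lra|lra].
    by apply: bernoulli_le; rewrite ?sqr_ge0//; lra.
  have : 0 <= K * y ^+ 2 by rewrite mulr_ge0 ?sqr_ge0.
  move: (K * y ^+ 2) yK => z z2 z0.
  by rewrite -[leLHS]mul1r ler_pdivrMr; nra.
have := sum_diff_le eta0 p0 psum qsum a01 chi2.
have -> : \sum_t q t * a t =
    V^-1 * \sum_(v : {ffun J -> bool}) \sum_t tuple_weight (cell_weight delta v) t * a t.
  rewrite exchange_big/= mulr_sumr; apply: eq_bigr => t _.
  by rewrite /q -mulrA mulr_suml.
rewrite -(ler_pM2l V0) mulVKf ?gt_eqF// => /le_trans; apply.
rewrite ler_pM2l// lerD2l ler_pdivrMr// mulr_natr mulr2n lerD2l.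
by rewrite ler_pdivrMr// -expr2.
Qed.

End second_moment.

(** * Fourier transform of sums of bumps *)

Section oscillatory_integrals.
Variable R : realType.
Local Notation mu := (@lebesgue_measure R).
Implicit Types (f F : R -> R) (a b c h u t x theta xi : R) (q : {poly R}).

Lemma continuous_itv_integrable f a b : continuous f ->
  mu.-integrable `[a, b] (EFin \o f).
Proof.
move=> cf; apply: (@continuous_compact_integrable R f `[a, b]).
  exact: segment_compact.
by apply: continuous_subspaceT => x; exact: cf.
Qed.

Lemma FTC_is_derive f F a b : a < b -> (forall x, is_derive x 1 F (f x)) ->
  continuous f -> \int[mu]_(x in `[a, b]) f x = F b - F a.
Proof.
move=> ab dF cf; rewrite /Rintegral (@continuous_FTC2 _ _ F)//.
- by apply: continuous_subspaceT => x; exact: cf.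
- have cF : continuous F.
    move=> x; apply/differentiable_continuous.
    by apply/derivable1_diffP; exact: ex_derive.
  split=> [x _||]; first exact: ex_derive.
    by apply: cvg_at_right_filter; exact: cF.
  by apply: cvg_at_left_filter; exact: cF.
- by move=> x _; rewrite derive1E; exact: derive_val.
Qed.

Lemma continuous_osc u theta : continuous (fun t => cos (u * t + theta)).
Proof.
move=> t; apply: continuous_comp; last exact: continuous_cos.
by apply: continuousD; [apply: continuousM; [exact: cst_continuous|]|exact: cst_continuous].
Qed.

Lemma is_derive_osc_sin u theta t :
  is_derive t (1 : R) (fun t => sin (u * t + theta)) (u * cos (u * t + theta)).
Proof.
have d : is_derive t (1 : R) (fun t => u * t + theta) u.
  apply: is_derive_eq; by rewrite /GRing.scale/=; ring.
rewrite mulrC; exact: (@is_derive1_comp R sin (fun t => u * t + theta) t _ _ (is_derive_sin _) d).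
Qed.

(** The free phase covers cosine and sine at once: an integration by parts shifts it by [pi / 2]. *)
Definition pol_osc q u theta : R :=
  \int[mu]_(t in `[- 2^-1, 2^-1]) (q.[t] * cos (u * t + theta)).

(** Zero at both ends of the interval, so that integrations by parts leave no boundary term. *)
Definition vanishing : {poly R} := (2^-1)%:P ^+ 2 - 'X ^+ 2.

Lemma continuous_pol_osc q u theta :
  continuous (fun t => q.[t] * cos (u * t + theta)).
Proof.
by move=> t; apply: continuousM; [exact: continuous_horner|exact: continuous_osc].
Qed.

Lemma pol_osc_le q u theta :
  `|pol_osc q u theta| <= \int[mu]_(t in `[- 2^-1, 2^-1]) `|q.[t]|.
Proof.
have iq := continuous_itv_integrable (- 2^-1) 2^-1 (@continuous_pol_osc q u theta).
apply: le_trans (le_normr_Rintegral _ iq) _ => //.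
apply: le_Rintegral => //.
- by have := integrable_norm iq.
- apply: continuous_itv_integrable => t.
  by apply: continuous_comp; [exact: continuous_horner|exact: norm_continuous].
move=> t _; rewrite normrM ler_piMr//.
by rewrite ler_norml cos_geN1 cos_le1.
Qed.

Lemma pol_osc_by_parts q u theta :
  u * pol_osc (vanishing * q) u theta =
  - pol_osc ((vanishing * q)^`()) u (theta - pi / 2).
Proof.
set g := vanishing * q.
have dF t : is_derive t (1 : R) (fun t => g.[t] * sin (u * t + theta))
    (u * (g.[t] * cos (u * t + theta)) + g^`().[t] * cos (u * t + (theta - pi / 2))).
  have := is_deriveM (is_derive_poly g t) (is_derive_osc_sin u theta t).
  move=> /is_derive_eq; apply; rewrite /GRing.scale/=.
  by rewrite addrA cosB cos_pihalf sin_pihalf mulr0 add0r mulr1; ring.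
have half : - 2^-1 < 2^-1 :> R by lra.
have cg t := @continuous_pol_osc g u theta t.
have cg' t := @continuous_pol_osc g^`() u (theta - pi / 2) t.
have cu : continuous (fun t => u * (g.[t] * cos (u * t + theta))).
  move=> t; apply: (@continuousM _ _ (cst u) (fun t => g.[t] * cos (u * t + theta)) t).
    exact: cst_continuous.
  exact: cg.
have := @FTC_is_derive _ _ _ _ half dF.
have -> : g.[2^-1] = 0 by rewrite /g /vanishing !hornerE; ring.
have -> : g.[- 2^-1] = 0 by rewrite /g /vanishing !hornerE; ring.
rewrite !mul0r subr0 RintegralD//; last 2 first.
- exact: continuous_itv_integrable.
- exact: continuous_itv_integrable.
rewrite RintegralZl//; last exact: continuous_itv_integrable.
move=> h; apply/eqP; rewrite -addr_eq0; apply/eqP; apply: h => t.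
exact: continuousD (cu t) (cg' t).
Qed.

(** Each integration by parts gains a factor [1 / u] and uses up one factor [vanishing]: the
    derivative of [vanishing^(j+1) q] is [vanishing^j] times another polynomial. Hence the induction
    for all [q] simultaneously. *)
Lemma pol_osc_decay j q : exists2 A : R, 0 <= A &
  forall u theta, `|u| ^+ j * `|pol_osc (vanishing ^+ j * q) u theta| <= A.
Proof.
elim: j q => [|j ih] q.
  exists (\int[mu]_(t in `[- 2^-1, 2^-1]) `|q.[t]|).
    by apply: Rintegral_ge0.
  by move=> u theta; rewrite expr0 !mul1r; exact: pol_osc_le.
have [A A0 hA] := ih ((vanishing^`() * q) *+ j.+1 + vanishing * q^`()).
exists A => // u theta; apply: le_trans (hA u (theta - pi / 2)).
have e : (vanishing ^+ j.+1 * q)^`() =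
    vanishing ^+ j * ((vanishing^`() * q) *+ j.+1 + vanishing * q^`()).
  rewrite derivM deriv_exp/= exprS mulrDr !mulrA; congr (_ + _).
    by rewrite mulrnAr mulrnAl mulrA [vanishing ^+ j * _]mulrC.
  by rewrite [vanishing * _]mulrC.
rewrite exprSr -[leLHS]mulrA; apply: ler_wpM2l; first exact: exprn_ge0.
rewrite -normrM [vanishing ^+ _]exprS -[_ * _ * q]mulrA pol_osc_by_parts normrN.
by rewrite mulrA -exprS e.
Qed.

Definition bump p t : R := if `|t| <= 2^-1 then (vanishing ^+ p).[t] else 0.

Definition bump_cos p u : R := pol_osc (vanishing ^+ p) u 0.

(* The sine part vanishes because the bump is even. *)
Lemma pol_osc_even p u theta :
  pol_osc (vanishing ^+ p) u theta = bump_cos p u * cos theta.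
Proof.
have half : - 2^-1 <= 2^-1 :> R by lra.
have reflect v :
    pol_osc (vanishing ^+ p) u v = pol_osc (vanishing ^+ p) (- u) v.
  have := @integration_by_substitution_oppr R
    (fun t => (vanishing ^+ p).[t] * cos (u * t + v)) (- 2^-1) 2^-1.
  rewrite opprK => /(_ half) h; rewrite /pol_osc /Rintegral h; last first.
    by apply: continuous_subspaceT => t; exact: continuous_pol_osc.
  congr fine; apply: eq_integral => t _ /=; congr EFin.
  by rewrite mulNr mulrN; congr (_ * _); rewrite /vanishing !hornerE /= sqrrN.
have intg v := continuous_itv_integrable (- 2^-1) 2^-1
  (@continuous_pol_osc (vanishing ^+ p) u v).
have intg' v := continuous_itv_integrable (- 2^-1) 2^-1
  (@continuous_pol_osc (vanishing ^+ p) (- u) v).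
apply: (@mulfI _ 2); first by rewrite pnatr_eq0.
rewrite mulr_natl mulr2n {2}reflect -RintegralD//.
rewrite mulrCA /bump_cos /pol_osc -RintegralZr//.
apply: eq_Rintegral => t _.
by rewrite addr0 !cosD mulNr cosN sinN; ring.
Qed.

Let bump_cos_restrict p c h xi theta : 0 < h ->
  (fun x => bump p ((x - c) / h) * cos (xi * x + theta)) =
  (fun x => (vanishing ^+ p).[(x - c) / h] * cos (xi * x + theta))
    \_ `[h * - 2^-1 + c, h * 2^-1 + c].
Proof.
move=> h0; apply/funext => x; rewrite patchE mem_setE in_itv/= /bump.
have -> : (`|(x - c) / h| <= 2^-1) = (h * - 2^-1 + c <= x <= h * 2^-1 + c).
  by rewrite ler_norml ler_pdivlMr// ler_pdivrMr//; apply/idP/idP => /andP[? ?];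
    apply/andP; split; lra.
by case: ifP; rewrite ?mul0r.
Qed.

Let continuous_bump_cos p c h xi theta :
  continuous (fun x => (vanishing ^+ p).[(x - c) / h] * cos (xi * x + theta)).
Proof.
move=> x; apply: (@continuousM _ _ (fun x => (vanishing ^+ p).[(x - c) / h])
  (fun x => cos (xi * x + theta)) x); last exact: continuous_osc.
apply: (@continuous_comp _ _ _ (fun x => (x - c) / h) (horner (vanishing ^+ p)));
  last exact: continuous_horner.
apply: (@continuousM _ _ (fun x => x - c) (cst h^-1) x); last exact: cst_continuous.
by apply: (@continuousB _ _ _ id (cst c)); [exact: cvg_id|exact: cst_continuous].
Qed.

Lemma bump_cos_integrable p c h xi theta : 0 < h ->
  mu.-integrable setT
    (EFin \o (fun x => bump p ((x - c) / h) * cos (xi * x + theta))).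
Proof.
move=> h0; rewrite bump_cos_restrict// -restrict_EFin.
apply/integrable_restrict => //=; rewrite setTI.
by apply: continuous_itv_integrable; exact: continuous_bump_cos.
Qed.

(** By the substitution [x = h t + c]; the centre survives only in the phase. *)
Lemma bump_fourier p c h xi theta : 0 < h ->
  \int[mu]_x (bump p ((x - c) / h) * cos (xi * x + theta)) =
  h * bump_cos p (h * xi) * cos (xi * c + theta).
Proof.
move=> h0; pose f x := (vanishing ^+ p).[(x - c) / h] * cos (xi * x + theta).
rewrite bump_cos_restrict//.
rewrite -Rintegral_mkcond.
pose F t := h * t + c.
have dF t : is_derive t (1 : R) F h.
  by apply: is_derive_eq; rewrite /GRing.scale/=; ring.
have F'E : F^`()%classic = cst h.
  by apply/funext => t; rewrite derive1E; exact: derive_val.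
have cF : continuous F.
  move=> x; apply/differentiable_continuous.
  by apply/derivable1_diffP; exact: ex_derive.
have cf : continuous f by exact: continuous_bump_cos.
have lt_half : - 2^-1 < 2^-1 :> R by lra.
rewrite /Rintegral (_ : h * - 2^-1 + c = F (- 2^-1))// (_ : h * 2^-1 + c = F 2^-1)//.
rewrite (@integration_by_substitution_increasing _ F)//; first last.
- by apply: continuous_subspaceT => t; exact: cf.
- split=> [t _||]; first exact: ex_derive.
    by apply: cvg_at_right_filter; exact: cF.
  by apply: cvg_at_left_filter; exact: cF.
- by rewrite F'E; exact: is_cvg_cst.
- by rewrite F'E; exact: is_cvg_cst.
- by rewrite F'E => t _; exact: cst_continuous.
- by move=> t t' _ _ tt'; rewrite /F ltrD2r ltr_pM2l.
- exact: ltW.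
transitivity (pol_osc (vanishing ^+ p) (h * xi) (xi * c + theta) * h); last first.
  by rewrite pol_osc_even; ring.
rewrite /pol_osc.
rewrite -RintegralZr//; last exact/continuous_itv_integrable/continuous_pol_osc.
congr fine; apply: eq_integral => t _; congr EFin.
rewrite F'E -[LHS]/(f (F t) * h) /f /F addrK [h * t]mulrC mulfK ?gt_eqF//.
by congr (_ * cos _ * _); ring.
Qed.
End oscillatory_integrals.

(** * Size and Fourier decay of the bumps *)

Section bump_properties.
Variable R : realType.
Local Notation mu := (@lebesgue_measure R).
Implicit Types (p : nat) (t u s : R).

Lemma vanishing_bounds t : `|t| <= 2^-1 -> 0 <= (vanishing R).[t] <= 4^-1.
Proof.
by rewrite ler_norml /vanishing !hornerE => /andP[t1 t2]; apply/andP; split; nra.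
Qed.

Lemma bump_ge0 p t : 0 <= bump p t.
Proof.
rewrite /bump; case: ifP => // /vanishing_bounds/andP[h _].
by rewrite horner_exp exprn_ge0.
Qed.

Lemma bump_le1 p t : bump p t <= 1.
Proof.
rewrite /bump; case: ifP => // /vanishing_bounds/andP[h1 h2].
by rewrite horner_exp exprn_ile1//; lra.
Qed.

(** The family is closed under squares, so L2 norms of bumps are integrals of bumps. *)
Lemma bump_sqr p t : bump p t ^+ 2 = bump (2 * p) t.
Proof.
rewrite /bump; case: ifP => _; last by rewrite expr2 mul0r.
by rewrite !horner_exp mulnC exprM.
Qed.

(** With a positive exponent the endpoints are excluded; adjacent grid cells then share no point of
    the supports. *)
Lemma bump_neq0 p t : bump p.+1 t != 0 -> - 2^-1 < t < 2^-1.
Proof.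
rewrite /bump; case: ifPn; last by rewrite eqxx.
rewrite ler_norml horner_exp expf_eq0/= => /andP[t1 t2] h.
rewrite !lt_neqAle t1 t2 !andbT; apply/andP; split; apply: contra h => /eqP;
  by [move=> <-; rewrite /vanishing !hornerE; apply/eqP; ring
     |move=> ->; rewrite /vanishing !hornerE; apply/eqP; ring].
Qed.

Lemma measurable_bump p : measurable_fun setT (@bump R p).
Proof.
have -> : @bump R p = (fun t => (vanishing R ^+ p).[t]) \_ `[- 2^-1, 2^-1].
  by apply/funext => t; rewrite patchE mem_setE in_itv/= /bump ler_norml.
apply/(measurable_restrictT _ _).1 => //; apply: measurable_funTS.
by apply: continuous_measurable_fun; exact: continuous_horner.
Qed.

Lemma bump_cos0_bounds p : 0 < bump_cos p (0 : R) <= 1.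
Proof.
have cp : continuous (fun t => (vanishing R ^+ p).[t]) by exact: continuous_horner.
have -> : bump_cos p (0 : R) = \int[mu]_(t in `[- 2^-1, 2^-1]) (vanishing R ^+ p).[t].
  by apply: eq_Rintegral => t _; rewrite mul0r addr0 cos0 mulr1.
have v0 t : t \in `[- 2^-1, 2^-1] -> 0 <= (vanishing R ^+ p).[t] <= 1.
  move=> ht; have := bump_ge0 p t; have := bump_le1 p t.
  by rewrite /bump ler_norml; move: ht; rewrite in_itv/= => -> -> ->.
have mes a b : a <= b -> fine (mu `[a, b]) = b - a :> R.
  by move=> ab; rewrite lebesgue_measure_itv/= lte_fin; case: ltgtP ab => //= -> _; rewrite subrr.
have i1 a b r : mu.-integrable `[a, b] (EFin \o cst r).
  by apply: continuous_itv_integrable; exact: cst_continuous.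
apply/andP; split; last first.
  apply: (@le_trans _ _ (\int[mu]_(t in `[- 2^-1, 2^-1]) cst 1 t)).
    apply: le_Rintegral => //; first exact: continuous_itv_integrable.
    by move=> t /v0/andP[].
  by rewrite Rintegral_cst// mes; lra.
(* On [[- 1/4, 1/4]] the polynomial is at least 3/16, hence at least 1/8. *)
apply: (@lt_le_trans _ _ (\int[mu]_(t in `[- 4^-1, 4^-1]) cst (8^-1 ^+ p) t)).
  by rewrite Rintegral_cst// mes ?mulr_gt0 ?exprn_gt0//; lra.
apply: (@le_trans _ _ (\int[mu]_(t in `[- 4^-1, 4^-1]) (vanishing R ^+ p).[t])).
  apply: le_Rintegral => //; first exact: continuous_itv_integrable.
  move=> t /=; rewrite in_itv/= horner_exp => /andP[t1 t2].
  by apply: lerXn2r; rewrite ?nnegrE; [lra|..]; rewrite /vanishing !hornerE; nra.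
have sub : `[- 4^-1, 4^-1] `<=` `[- 2^-1, (2^-1 : R)].
  by move=> t /=; rewrite !in_itv/= => /andP[? ?]; apply/andP; split; lra.
apply: fine_le.
- by apply: integrable_fin_num => //; exact: continuous_itv_integrable.
- by apply: integrable_fin_num => //; exact: continuous_itv_integrable.
apply: ge0_subset_integral => //.
- apply/measurable_EFinP/measurable_funTS.
  by apply: continuous_measurable_fun.
- by move=> t /v0/andP[? _]; rewrite lee_fin.
Qed.

(** Boundedness settles [|u| <= 1]. Beyond, [p >= s + 1] integrations by parts absorb [|u|^(2 s)]
    and leave [u^2] to spare: this is the integrable weight [1 / (1 + u^2)] against which
    trigonometric sums are integrated later. *)
Lemma bump_cos_decay p s : 0 < s -> s + 1 <= p%:R ->
  exists2 A : R, 0 < A & forall u,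
    (1 + `|u| `^ (2 * s)) * bump_cos p u ^+ 2 <= A / (1 + u ^+ 2).
Proof.
move=> s0 sp.
have [A0 A00 h0] := pol_osc_decay 0 (vanishing R ^+ p).
have [A1 A10 h1] := pol_osc_decay p (1 : {poly R}).
exists (4 * A0 ^+ 2 + 4 * A1 ^+ 2 + 1); first nra.
move=> u; rewrite ler_pdivlMr; last nra.
have {}h0 : `|bump_cos p u| <= A0.
  by have := h0 u 0; rewrite expr0 mul1r expr0 mul1r.
have {}h1 : `|u| ^+ p * `|bump_cos p u| <= A1.
  by have := h1 u 0; rewrite mulr1.
rewrite -(real_normK (num_real (bump_cos p u))) -(real_normK (num_real u)).
set b := `|bump_cos p u| in h0 h1 *; have b0 : 0 <= b by exact: normr_ge0.
set v := `|u| in h1 *; have v0 : 0 <= v by exact: normr_ge0.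
have bb : b ^+ 2 <= A0 ^+ 2 by apply: lerXn2r; rewrite ?nnegrE /=.
have [v1|v1] := leP v 1.
  have : v `^ (2 * s) <= 1.
    have s2 : 0 <= 2 * s by lra.
    by have := ge0_ler_powR s2 (v0 : v \in Num.nneg) (ler01 : 1 \in Num.nneg) v1; rewrite powR1.
  have := powR_ge0 v (2 * s); move: (_ `^ _) => z z0 z1.
  have v2 : v ^+ 2 <= 1 by rewrite expr_le1.
  have : (1 + z) * b ^+ 2 * (1 + v ^+ 2) <= 2 * A0 ^+ 2 * 2.
    have ? := sqr_ge0 v; have ? := sqr_ge0 b.
    by apply: ler_pM; [nra|nra|apply: ler_pM; lra|lra].
  by have ? := sqr_ge0 A1; lra.
have hz : v `^ (2 * s) * v ^+ 2 <= (v ^+ p) ^+ 2.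
  rewrite -exprM -!powR_mulrn// -powRD; last first.
    by apply/implyP => _; rewrite gt_eqF//; lra.
  by apply: ler_powR; [exact: ltW|rewrite natrM; lra].
have hz1 : 1 <= v `^ (2 * s) 
  by rewrite -[leLHS](powRr0 v); apply: ler_powR; [exact: ltW|lra].
have : (v ^+ p) ^+ 2 * b ^+ 2 <= A1 ^+ 2.
  by rewrite -exprMn; apply: lerXn2r; rewrite ?nnegrE// mulr_ge0// exprn_ge0.
move: hz hz1; move: (v `^ _) => z hz hz1 hA.
have v2 : 1 <= v ^+ 2 by rewrite expr_ge1// ltW.
have : (1 + z) * b ^+ 2 * (1 + v ^+ 2) <= 4 * ((z * v ^+ 2) * b ^+ 2).
  rewrite mulrAC mulrA ler_wpM2r ?sqr_ge0//.
  by apply: (@le_trans _ _ ((2 * z) * (2 * v ^+ 2))); [apply: ler_pM|]; lra.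
have : (z * v ^+ 2) * b ^+ 2 <= (v ^+ p) ^+ 2 * b ^+ 2 by rewrite ler_wpM2r ?sqr_ge0.
by have ? := sqr_ge0 A0; lra.
Qed.
End bump_properties.

(** * Integrals of nonnegative trigonometric sums against a decaying weight *)

Section periodization.
Variable R : realType.
Local Notation mu := (@lebesgue_measure R).
Implicit Types (a h u theta : R) (k n : nat).

Lemma sinDpi2z (z : int) x : sin (x + z%:~R * (pi *+ 2)) = sin x :> R.
Proof.
case: z => n; first by rewrite -pmulrn mulr_natl (periodicn (@sinD2pi R)).
rewrite NegzE mulrNz mulNr -[in RHS](subrK (n.+1%:~R * (pi *+ 2)) x).
by rewrite -pmulrn mulr_natl (periodicn (@sinD2pi R)).
Qed.

Lemma fine_lebesgue_itv (a b : R) : a <= b -> fine (mu `[a, b]) = b - a.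
Proof.
move=> ab; rewrite lebesgue_measure_itv/= lte_fin.
by case: ltgtP ab => //= -> _; rewrite subrr.
Qed.

Lemma period_cos_integral (z : int) a h theta : 0 < h ->
  \int[mu]_(u in `[a, a + pi *+ 2 / h]) cos (z%:~R * h * u + theta) =
  if z == 0 then pi *+ 2 / h * cos theta else 0.
Proof.
move=> h0; have T0 : 0 < pi *+ 2 / h by rewrite divr_gt0// mulrn_wgt0// pi_gt0.
case: eqP => [->|/eqP z0].
  rewrite (@eq_Rintegral _ _ _ _ _ (cst (cos theta))); last first.
    by move=> u _; rewrite !mul0r add0r.
  rewrite Rintegral_cst// mulrC; congr (_ * _).
  by rewrite [LHS]fine_lebesgue_itv ?lerDl ?ltW// addrAC subrr add0r.
have zh : z%:~R * h != 0 by rewrite mulf_neq0 ?intr_eq0// gt_eqF.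
have dF u : is_derive u (1 : R)
    (fun u => (z%:~R * h)^-1 * sin (z%:~R * h * u + theta))
    (cos (z%:~R * h * u + theta)).
  have := is_deriveZ (z%:~R * h)^-1 (is_derive_osc_sin (z%:~R * h) theta u).
  by move=> /is_derive_eq; apply; rewrite /GRing.scale/= mulKf.
rewrite (FTC_is_derive _ dF); last 2 first.
- by rewrite ltrDl.
- exact: continuous_osc.
rewrite mulrDr addrAC [_ * (_ / h)]mulrC -mulrA.
have -> : (pi *+ 2) / h * (z%:~R * h) = z%:~R * (pi *+ 2) by field; rewrite gt_eqF.
by rewrite sinDpi2z subrr.
Qed.

Lemma continuous_weight h : continuous (fun u => (1 + (h * u) ^+ 2)^-1).
Proof.
move=> u; apply: (@continuousV _ _ (fun u => 1 + (h * u) ^+ 2) u).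
  by apply/eqP; have ? := sqr_ge0 (h * u); lra.
rewrite (_ : (fun u => _) = (fun u => (1 + (h *: 'X) ^+ 2).[u])).
  exact: continuous_horner.
by apply/funext => v; rewrite !hornerE.
Qed.

Section trig_sum.
Variables (Q : finType) (d : Q -> R) (z : Q -> int) (th : Q -> R) (h : R).
Hypothesis h0 : 0 < h.

Definition trig_sum u := \sum_q d q * cos ((z q)%:~R * h * u + th q).
(** The average of [trig_sum] over the period [2 pi / h]: nonzero frequencies integrate to 0. *)
Definition trig_mean := \sum_(q | z q == 0) d q * cos (th q).

Local Notation g := trig_sum.
Local Notation avg := trig_mean.

Let cterm q : continuous (fun u => d q * cos ((z q)%:~R * h * u + th q)).
Proof.
move=> u; apply: (@continuousM _ _ (cst (d q)) (fun u => cos ((z q)%:~R * h * u + th q)) u).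
  exact: cst_continuous.
exact: continuous_osc.
Qed.

Lemma continuous_trig_sum : continuous g.
Proof.
have cs s : continuous (fun u => \sum_(q <- s) d q * cos ((z q)%:~R * h * u + th q)).
  elim: s => [|q s ih] u.
    rewrite (_ : (fun u => _) = cst 0); first exact: cst_continuous.
    by apply/funext => v; rewrite big_nil.
  rewrite (_ : (fun u => _) = (fun u => d q * cos ((z q)%:~R * h * u + th q) +
      \sum_(q <- s) d q * cos ((z q)%:~R * h * u + th q))); last first.
    by apply/funext => v; rewrite big_cons.
  exact: continuousD (@cterm q u) (ih u).
exact: cs.
Qed.

Lemma period_trig_integral a :
  (\int[mu]_(u in `[a, (a + pi *+ 2 / h)%R]) (g u)%:E = (pi *+ 2 / h * avg)%R%:E)%E.
Proof.
have int q : mu.-integrable `[a, (a + pi *+ 2 / h)%R]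
    (EFin \o (fun u => d q * cos ((z q)%:~R * h * u + th q))).
  exact: continuous_itv_integrable.
transitivity (\sum_q \int[mu]_(u in `[a, (a + pi *+ 2 / h)%R])
    (d q * cos ((z q)%:~R * h * u + th q))%R%:E)%E.
  rewrite -integral_sum//; apply: eq_integral => u _; rewrite sumEFin//.
rewrite /trig_mean mulr_sumr -sumEFin [RHS]big_mkcond/=; apply: eq_bigr => q _.
rewrite -[LHS]fineK; last by apply: integrable_fin_num => //; exact: int.
rewrite -[fine _]/(\int[mu]_(u in `[a, (a + pi *+ 2 / h)%R])
  (d q * cos ((z q)%:~R * h * u + th q))) RintegralZl//; last first.
  by apply: continuous_itv_integrable; exact: continuous_osc.
by rewrite period_cos_integral//; case: ifP => _; rewrite ?mulr0// mulrCA.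
Qed.

Hypothesis g0 : forall u, 0 <= g u.

Let f u := (1 + (h * u) ^+ 2)^-1 * g u.

Let mf : measurable_fun setT (EFin \o f).
Proof.
apply/measurable_EFinP; apply: measurable_funM; apply: continuous_measurable_fun.
  exact: continuous_weight.
exact: continuous_trig_sum.
Qed.

Let T := pi *+ 2 / h.

(** One half-line cut into periods. On the [k]-th, the weight is at most [W k] and [g >= 0]
    integrates to the period length times its mean; the [W k] sum to at most 3. *)
Let cells_le (b : nat -> R) :
  trivIset setT (fun k => `[b k, (b k + T)%R[%classic) ->
  (forall k u, b k <= u < b k + T -> k%:R <= h * `|u|) ->
  (\int[mu]_(u in \bigcup_k `[b k, (b k + T)%R[%classic) (f u)%:E <= (3 * (T * avg))%:E)%E.
Proof.
move=> tb bh.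
have f0 u : (0 <= (f u)%:E)%E.
  by rewrite lee_fin mulr_ge0// invr_ge0; have ? := sqr_ge0 (h * u); lra.
have avg0 : 0 <= T * avg.
  by rewrite -lee_fin -(period_trig_integral 0); apply: integral_ge0 => u _; rewrite lee_fin.
rewrite ge0_integral_bigcup//; last exact: measurable_funTS.
have mWg (r : R) : measurable_fun setT (fun u => (r * g u)%:E).
  apply/measurable_EFinP; apply: measurable_funM.
    exact: measurable_cst.
  by apply: continuous_measurable_fun; exact: continuous_trig_sum.
(* A telescoping majorant of 1 / (1 + k^2). *)
pose W k : R := 3 * ((k.+1%:R)^-1 - (k.+2%:R)^-1).
have W0 k : 0 <= W k.
  by rewrite mulr_ge0// subr_ge0 lef_pV2 ?posrE// ler_nat.
have WP k (x : R) : k%:R <= x -> (1 + x ^+ 2)^-1 <= W k.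
  move=> kx; have k0 : 0 <= k%:R :> R by [].
  apply: (@le_trans _ _ (1 + k%:R ^+ 2)^-1).
    rewrite lef_pV2 ?posrE; [|by have ? := sqr_ge0 x; lra|by have ? := sqr_ge0 (k%:R : R); lra].
    by rewrite lerD2l lerXn2r ?nnegrE//; exact: le_trans kx.
  have e1 : k.+1%:R = k%:R + 1 :> R by rewrite natr1.
  have e2 : k.+2%:R = k%:R + 2 :> R by rewrite -natrD addn2.
  (* The bound [1 / (1 + k^2) <= W k] amounts to this product being nonnegative, which holds at
     integers but fails strictly between 1/2 and 1. *)
  rewrite /W e1 e2; have k2 : 0 <= (k%:R - 1) * (2 * k%:R - 1) :> R.
    case: k {kx k0 e1 e2} => [|k]; first lra.
    by rewrite -natr1; have : 0 <= k%:R :> R by []; nra.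
  move: (k%:R : R) k0 k2 => y y0 y2.
  rewrite (_ : 3 * _ = 3 / ((y + 1) * (y + 2))); last by field; apply/andP; split; apply/eqP; lra.
  have y3 : 0 < 1 + y ^+ 2 by have := sqr_ge0 y; lra.
  have y4 : 0 < (y + 1) * (y + 2) by apply: mulr_gt0; lra.
  by rewrite ler_pdivlMr// mulrC ler_pdivrMr//; lra.
apply: (@le_trans _ _ (\sum_(k <oo) (W k * (T * avg))%:E)%E).
  apply: lee_nneseries => [k _ _|k _]; first exact: integral_ge0.
  apply: (@le_trans _ _ (\int[mu]_(u in `[b k, (b k + T)%R[%classic) (W k * g u)%:E)%E).
    apply: ge0_le_integral => //.
    - by apply: measurable_funTS.
    - by apply: measurable_funTS; exact: mWg.
    - move=> u /=; rewrite in_itv/= => bu; rewrite lee_fin ler_wpM2r//.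
      by rewrite -(real_normK (num_real (h * u))) normrM (gtr0_norm h0) WP// bh.
  apply: (@le_trans _ _ (\int[mu]_(u in `[b k, (b k + T)%R]%classic) (W k * g u)%:E)%E).
    apply: ge0_subset_integral => //.
    - by apply: measurable_funTS; exact: mWg.
    - by move=> u _; rewrite lee_fin mulr_ge0.
    - by apply: subset_itv; rewrite bnd_simp.
  under eq_integral do rewrite EFinM.
  rewrite ge0_integralZl_EFin//; last 2 first.
  - by move=> u _; rewrite lee_fin.
  - apply: measurable_funTS; apply/measurable_EFinP; apply: continuous_measurable_fun.
    exact: continuous_trig_sum.
  by rewrite period_trig_integral.
apply: lime_le.
  by apply: is_cvg_nneseries => k _ _; rewrite lee_fin mulr_ge0.
apply: nearW => n; rewrite sumEFin lee_fin -mulr_suml ler_wpM2r//.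
have -> : \sum_(0 <= k < n) W k = 3 * (1 - n.+1%:R^-1).
  elim: n => [|n ih]; first by rewrite big_geq// invr1 subrr mulr0.
  by rewrite big_nat_recr//= ih /W -mulrDr; congr (_ * _); ring.
by rewrite ger_pMr// lerBlDr lerDl invr_ge0.
Qed.

Let T0 : 0 < T.
Proof. by rewrite divr_gt0// mulrn_wgt0// pi_gt0. Qed.

(** The positive and the negative half-line each give [3 (2 pi / h)] times the mean, whence the
    factor 12. *)
Lemma weighted_trig_integral :
  (\int[mu]_u ((1 + (h * u) ^+ 2)^-1 * g u)%:E <= (12 * pi / h * avg)%:E)%E.
Proof.
have hT : h * T = pi *+ 2 by rewrite /T mulrC mulfVK// gt_eqF.
have pi1 : 1 <= pi *+ 2 :> R by have := pi_ge2 R; lra.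
pose cell (j : int) := `[j%:~R * T, (j%:~R * T + T)%R[%classic.
have in_cell j u : cell j u <-> Num.floor (u / T) = j.
  rewrite /cell/= in_itv/=; split => [/andP[u1 u2]|<-].
    apply/floor_def; rewrite ler_pdivlMr// ltr_pdivrMr// u1/=.
    by rewrite intrD mulrDl mul1r.
  have /andP[u1 u2] := floor_itv (u / T); apply/andP; split.
    by rewrite -ler_pdivlMr.
  by rewrite -[X in _ + X]mul1r -mulrDl -ltr_pdivrMr// -[1]/(1%:~R) -intrD.
have tcell (b : nat -> int) : injective b -> trivIset setT (cell \o b).
  by move=> bI i j _ _ [u [/in_cell + /in_cell]] => -> /bI.
have cells_le1 := @cells_le (fun k => (Posz k)%:~R * T) (tcell Posz _).
have cells_le2 := @cells_le (fun k => (Negz k)%:~R * T) (tcell Negz _).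
have U : setT = (\bigcup_k cell (Posz k)) `|` (\bigcup_k cell (Negz k)).
  apply/seteqP; split=> // u _; case e : (Num.floor (u / T)) => [k|k].
    by left; exists k => //; apply/in_cell.
  by right; exists k => //; apply/in_cell.
have mcell (b : nat -> int) : measurable (\bigcup_k cell (b k)).
  by apply: bigcup_measurable => k _; exact: measurable_itv.
rewrite [X in integral _ X _]U ge0_integral_setU//; last 5 first.
- exact: (mcell Posz).
- exact: (mcell Negz).
- by move: mf; rewrite U.
- by move=> u _; rewrite lee_fin mulr_ge0// invr_ge0; have ? := sqr_ge0 (h * u); lra.
- apply/disj_setPS => u [[k _ /in_cell e1] [k' _ /in_cell e2]].
  by move: e1; rewrite e2.
rewrite (_ : (12 * pi / h * avg)%:E = ((3 * (T * avg))%:E + (3 * (T * avg))%:E)%E); last first.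
  by rewrite -EFinD /T -mulr_natl; congr EFin; ring.
have far k u : k%:R * T <= `|u| -> k%:R <= h * `|u|.
  move=> ku; apply: (@le_trans _ _ (k%:R * (h * T))); first by rewrite hT ler_peMr.
  by rewrite mulrCA ler_wpM2l// ltW.
apply: leeD.
  apply: cells_le1 => [i j [] //|k u /andP[u1 _]].
  by apply: far; apply: le_trans u1 (ler_norm u).
(* [Negz k] stands for [- (k + 1)], so its cell ends at [- k T] and [|u|] exceeds [k T] on it. *)
apply: cells_le2 => [i j [] //|k u /andP[_ u2]].
apply: far; rewrite -normrN; apply: le_trans (ler_norm _); apply: ltW.
rewrite ltrNr; apply: lt_le_trans u2 _.
by rewrite NegzE mulrNz -pmulrn -natr1; lra.
Qed.

End trig_sum.
End periodization.

Section plane_fourier.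
Variable R : realType.
Local Notation mu := (@lebesgue_measure R).
Implicit Types (xi : plane R).

Let weight_ge0 (u : R) : 0 <= (1 + u ^+ 2)^-1.
Proof. by rewrite invr_ge0; have ? := sqr_ge0 u; lra. Qed.

Lemma measurable_weights (h1 h2 : R) : measurable_fun setT
  (fun xi : plane R => (1 + (h1 * xi.1) ^+ 2)^-1 * (1 + (h2 * xi.2) ^+ 2)^-1).
Proof.
have mW (h : R) (f : plane R -> R) : measurable_fun setT f ->
    measurable_fun setT (fun xi => (1 + (h * f xi) ^+ 2)^-1).
  move=> mf.
  exact: measurableT_comp (continuous_measurable_fun (@continuous_weight R h)) mf.
by apply: measurable_funM; apply: mW; [exact: measurable_fst|exact: measurable_snd].
Qed.

(** The one-dimensional bound is applied twice. Integrating out the second variable keeps the terms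
    with [z2 q = 0], which form a trigonometric sum in the first. *)
Lemma weighted_trig_integral2 (Q : finType) (d : Q -> R) (z1 z2 : Q -> int)
    (h1 h2 : R) (G := fun xi : plane R => \sum_q d q *
      cos ((z1 q)%:~R * h1 * xi.1 + (z2 q)%:~R * h2 * xi.2)) :
  0 < h1 -> 0 < h2 -> (forall xi, 0 <= G xi) -> measurable_fun setT G ->
  (\int[@Leb2 R]_xi ((1 + (h1 * xi.1) ^+ 2)^-1 * (1 + (h2 * xi.2) ^+ 2)^-1 * G xi)%:E
   <= ((12 * pi) ^+ 2 / (h1 * h2) * \sum_(q | (z1 q == 0) && (z2 q == 0)) d q)%:E)%E.
Proof.
move=> h10 h20 G0 mG.
pose d1 q := if z2 q == 0 then d q else 0.
have mF : measurable_fun setT (fun xi : plane R =>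
    ((1 + (h1 * xi.1) ^+ 2)^-1 * (1 + (h2 * xi.2) ^+ 2)^-1 * G xi)%:E).
  by apply/measurable_EFinP; apply: measurable_funM => //; exact: measurable_weights.
have F0 xi : (0 <= ((1 + (h1 * xi.1) ^+ 2)^-1 * (1 + (h2 * xi.2) ^+ 2)^-1 * G xi)%:E)%E.
  by rewrite lee_fin mulr_ge0// mulr_ge0.
have msum : measurable_fun setT (fun x =>
    ((1 + (h1 * x) ^+ 2)^-1 * trig_sum d1 z1 (fun=> 0) h1 x)%:E).
  apply/measurable_EFinP; apply: measurable_funM; apply: continuous_measurable_fun.
    exact: continuous_weight.
  exact: continuous_trig_sum.
rewrite /Leb2 fubini_tonelli1//.
have GE x y : G (x, y) = trig_sum d z2 (fun q => (z1 q)%:~R * h1 * x) h2 y.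
  by apply: eq_bigr => q _; rewrite addrC.
have meanE x : trig_mean d z2 (fun q => (z1 q)%:~R * h1 * x) =
    trig_sum d1 z1 (fun=> 0) h1 x.
  rewrite /trig_mean /trig_sum big_mkcond/=; apply: eq_bigr => q _.
  by rewrite addr0 /d1; case: ifP; rewrite ?mul0r.
have inner x : (\int[mu]_y ((1 + (h2 * y) ^+ 2)^-1 * G (x, y))%:E <=
    (12 * pi / h2 * trig_sum d1 z1 (fun=> 0) h1 x)%:E)%E.
  under eq_integral do rewrite GE.
  by rewrite -meanE; apply: weighted_trig_integral => // u; rewrite -GE.
have cpi h : 0 < h -> 0 < 12 * pi / h :> R by move=> ?; rewrite divr_gt0// mulr_gt0// pi_gt0.
(* Nonnegativity is inherited: up to a positive factor, the reduced sum bounds the integral of a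
   nonnegative function from above. *)
have d1_ge0 x : 0 <= trig_sum d1 z1 (fun=> 0) h1 x.
  rewrite -(pmulr_rge0 _ (cpi _ h20)) -lee_fin; apply: le_trans (inner x).
  by apply: integral_ge0 => y _; rewrite lee_fin mulr_ge0.
apply: (@le_trans _ _ (\int[mu]_x ((12 * pi / h2)%:E *
    ((1 + (h1 * x) ^+ 2)^-1 * trig_sum d1 z1 (fun=> 0) h1 x)%:E))%E).
  apply: ge0_le_integral => //.
  - by move=> x _; apply: integral_ge0 => y _; exact: F0.
  - exact: measurable_fun_fubini_tonelli_F.
  - exact: measurable_funeM.
  move=> x _ /=; rewrite /fubini_F/=.
  under eq_integral do rewrite -mulrA EFinM.
  rewrite ge0_integralZl_EFin//; last 2 first.
  - by move=> y _; rewrite lee_fin mulr_ge0.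
  - apply/measurable_EFinP; apply: measurable_funM.
      by apply: continuous_measurable_fun; exact: continuous_weight.
    by apply: measurableT_comp mG _; exact: measurable_pair1.
  apply: le_trans (lee_wpmul2l _ (inner x)) _; first by rewrite lee_fin.
  by rewrite -!EFinM lee_fin mulrCA.
rewrite ge0_integralZl_EFin//; last 2 first.
- by move=> x _; rewrite lee_fin mulr_ge0.
- exact/ltW/cpi.
apply: le_trans (lee_wpmul2l _ (weighted_trig_integral h10 d1_ge0)) _.
  exact/ltW/cpi.
rewrite -EFinM lee_fin le_eqVlt; apply/orP; left; apply/eqP.
have -> : trig_mean d1 z1 (fun=> 0) = \sum_(q | (z1 q == 0) && (z2 q == 0)) d q.
  rewrite /trig_mean big_mkcondr/=; apply: eq_bigr => q _.
  by rewrite cos0 mulr1.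
by field; rewrite !gt_eqF.
Qed.
End plane_fourier.

(** * Product bumps in the plane and their transforms *)

Section plane_bumps.
Variable R : realType.
Local Notation mu := (@lebesgue_measure R).
Implicit Types (xi z : plane R) (h c theta : R) (p : nat).

Lemma bump_fourier_ereal p c h v theta : 0 < h ->
  (\int[mu]_x (bump p ((x - c) / h) * cos (v * x + theta))%:E =
   (h * bump_cos p (h * v) * cos (v * c + theta))%:E)%E.
Proof.
move=> h0; rewrite -bump_fourier// /Rintegral fineK//.
by apply: integrable_fin_num => //; exact: bump_cos_integrable.
Qed.

Lemma bump_integral p c h : 0 < h ->
  (\int[mu]_x (bump p ((x - c) / h))%:E = (h * bump_cos p (0 : R))%:E)%E.
Proof.
move=> h0; have := bump_fourier_ereal p c 0 0 h0.
rewrite mulr0 mul0r add0r cos0 mulr1 => <-.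
by apply: eq_integral => x _; rewrite mul0r add0r cos0 mulr1.
Qed.

Definition plane_bump p x0 h1 h2 z : R :=
  bump p ((z.1 - x0.1) / h1) * bump p ((z.2 - x0.2) / h2).

Lemma plane_bump_ge0 p x0 h1 h2 z : 0 <= plane_bump p x0 h1 h2 z.
Proof. by rewrite mulr_ge0// bump_ge0. Qed.

Lemma plane_bump_le1 p x0 h1 h2 z : plane_bump p x0 h1 h2 z <= 1.
Proof. by rewrite mulr_ile1// ?bump_ge0 ?bump_le1. Qed.

Lemma plane_bump_sqr p x0 h1 h2 z :
  plane_bump p x0 h1 h2 z ^+ 2 = plane_bump (2 * p) x0 h1 h2 z.
Proof. by rewrite exprMn !bump_sqr. Qed.

Lemma measurable_plane_bump p x0 h1 h2 :
  measurable_fun setT (plane_bump p x0 h1 h2).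
Proof.
have m (f : plane R -> R) c h : measurable_fun setT f ->
    measurable_fun setT (fun z => bump p ((f z - c) / h)).
  move=> mf; apply: (measurableT_comp (@measurable_bump R p)).
  by apply: measurable_funM => //; apply: measurable_funB.
by apply: measurable_funM; apply: m; [exact: measurable_fst|exact: measurable_snd].
Qed.

Lemma plane_bump_integral p x0 h1 h2 : 0 < h1 -> 0 < h2 ->
  (\int[@Leb2 R]_z (plane_bump p x0 h1 h2 z)%:E =
   (h1 * h2 * bump_cos p (0 : R) ^+ 2)%:E)%E.
Proof.
move=> h10 h20; rewrite /Leb2 fubini_tonelli1; last 2 first.
- by apply/measurable_EFinP; exact: measurable_plane_bump.
- by move=> z; rewrite lee_fin plane_bump_ge0.
have mb c h : measurable_fun setT (fun x : R => (bump p ((x - c) / h))%:E).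
  apply/measurable_EFinP; apply: (measurableT_comp (@measurable_bump R p)).
  by apply: measurable_funM => //; apply: measurable_funB.
have inner x : fubini_F mu (fun z : plane R => (plane_bump p x0 h1 h2 z)%:E) x =
    ((bump p ((x - x0.1) / h1))%:E * (h2 * bump_cos p (0 : R))%:E)%E.
  rewrite /fubini_F -(bump_integral p x0.2 h20) -ge0_integralZl_EFin ?bump_ge0//.
  by move=> y _; rewrite lee_fin bump_ge0.
  exact: mb.
rewrite (eq_integral _ _ (fun x _ => inner x)).
rewrite ge0_integralZr//=; last 3 first.
- exact: mb.
- by move=> x _; rewrite lee_fin bump_ge0.
- by rewrite lee_fin mulr_ge0 ?ltW//; have /andP[] := bump_cos0_bounds R p.
by rewrite bump_integral// -EFinM; congr EFin; ring.
Qed.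

Lemma plane_bump_cos_integrable p x0 h1 h2 xi theta : 0 < h1 -> 0 < h2 ->
  (@Leb2 R).-integrable setT (EFin \o (fun z =>
    plane_bump p x0 h1 h2 z * cos (z.1 * xi.1 + z.2 * xi.2 + theta))).
Proof.
move=> h10 h20.
have ib : (@Leb2 R).-integrable setT (EFin \o plane_bump p x0 h1 h2).
  apply/integrableP; split; first by apply/measurable_EFinP; exact: measurable_plane_bump.
  under eq_integral do rewrite /= ger0_norm ?plane_bump_ge0//.
  by rewrite plane_bump_integral// ltry.
apply: le_integrable ib => //.
  apply/measurable_EFinP; apply: measurable_funM; first exact: measurable_plane_bump.
  apply: measurableT_comp; first by apply: continuous_measurable_fun; exact: continuous_cos.
  do 2 apply: measurable_funD => //; apply: measurable_funM;
    by [exact: measurable_cst|exact: measurable_fst|exact: measurable_snd].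
move=> z _; rewrite lee_fin normrM ler_piMr// ler_norml.
by rewrite cos_geN1 cos_le1.
Qed.

(** By Fubini; the phase coming from the outer variable is absorbed into the free phase of the inner
    integral. *)
Lemma plane_bump_fourier p x0 h1 h2 xi theta : 0 < h1 -> 0 < h2 ->
  \int[@Leb2 R]_z (plane_bump p x0 h1 h2 z * cos (z.1 * xi.1 + z.2 * xi.2 + theta)) =
  h1 * h2 * bump_cos p (h1 * xi.1) * bump_cos p (h2 * xi.2) *
  cos (x0.1 * xi.1 + x0.2 * xi.2 + theta).
Proof.
move=> h10 h20; rewrite /Rintegral.
have := plane_bump_cos_integrable p x0 xi theta h10 h20.
rewrite /Leb2 => int; rewrite -(integral12_prod_meas1 int).
have inner x : fubini_F mu (EFin \o (fun z : plane R =>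
    plane_bump p x0 h1 h2 z * cos (z.1 * xi.1 + z.2 * xi.2 + theta))) x =
  ((h2 * bump_cos p (h2 * xi.2))%:E *
    (bump p ((x - x0.1) / h1) * cos (xi.1 * x + (x0.2 * xi.2 + theta)))%:E)%E.
  rewrite /fubini_F/=.
  have -> : (fun y => (plane_bump p x0 h1 h2 (x, y) * cos (x * xi.1 + y * xi.2 + theta))%:E) =
      (fun y => (bump p ((x - x0.1) / h1))%:E *
        (bump p ((y - x0.2) / h2) * cos (xi.2 * y + (xi.1 * x + theta)))%:E)%E.
    apply/funext => y; rewrite -EFinM /plane_bump/= -mulrA; congr (_ * (_ * cos _))%:E.
    by ring.
  rewrite integralZl//; last exact: bump_cos_integrable.
  rewrite bump_fourier_ereal// -!EFinM; congr EFin.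
  rewrite mulrCA; congr (_ * (_ * cos _)); by ring.
rewrite (eq_integral _ _ (fun x _ => inner x)).
rewrite integralZl//; last exact: bump_cos_integrable.
rewrite bump_fourier_ereal//= [xi.1 * _]mulrC addrA; ring.
Qed.
End plane_bumps.

(** The integral of a nonnegative function is a supremum over the simple functions below it, so
    monotonicity holds for arbitrary functions, such as the integrand of the Sobolev norm. *)
Lemma ge0_le_integralT (d : measure_display) (T : measurableType d)
    (R : realType) (mu : {measure set T -> \bar R}) (f g : T -> \bar R) :
  (forall x, 0 <= f x)%E -> (forall x, f x <= g x)%E ->
  (\int[mu]_x f x <= \int[mu]_x g x)%E.
Proof.
move=> f0 fg; have g0 x : (0 <= g x)%E by exact: le_trans (f0 x) (fg x).
rewrite !ge0_integralTE//; apply: le_ereal_sup => _ [h hf <-].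
by exists h => // x; exact: le_trans (hf x) (fg x).
Qed.

(** * Sums of bumps on a grid: Fourier transform and Sobolev energy *)

Section bump_sum.
Variables (R : realType) (p : nat) (I : finType) (n1 n2 : I -> nat) (a : plane R).
Variables (h1 h2 : R) (c : I -> R).
Hypotheses (h10 : 0 < h1) (h20 : 0 < h2).
Hypothesis n_inj : injective (fun i => (n1 i, n2 i)).
Implicit Types xi z : plane R.

Definition grid_point i : plane R := (a.1 + h1 * (n1 i)%:R, a.2 + h2 * (n2 i)%:R).

Definition bump_sum z := \sum_i c i * plane_bump p (grid_point i) h1 h2 z.

Let phase i xi := (grid_point i).1 * xi.1 + (grid_point i).2 * xi.2.

(** The transform of one bump up to its phase, common to all the cells. *)
Let amp xi := h1 * h2 * bump_cos p (h1 * xi.1) * bump_cos p (h2 * xi.2).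

Lemma measurable_bump_sum : measurable_fun setT bump_sum.
Proof.
apply: measurable_sum => i.
by apply: measurable_funM; [exact: measurable_cst|exact: measurable_plane_bump].
Qed.

Let bump_sum_cos xi theta :
  \int[@Leb2 R]_z (cos (z.1 * xi.1 + z.2 * xi.2 + theta) * bump_sum z) =
  amp xi * \sum_i c i * cos (phase i xi + theta).
Proof.
have int i := plane_bump_cos_integrable p (grid_point i) xi theta h10 h20.
transitivity (fine (\sum_i \int[@Leb2 R]_z ((c i)%:E *
    (plane_bump p (grid_point i) h1 h2 z * cos (z.1 * xi.1 + z.2 * xi.2 + theta))%:E))%E).
  congr fine; rewrite -integral_sum//; last by move=> i; apply: integrableZl => //; exact: int.
  apply: eq_integral => z _; rewrite /bump_sum mulr_sumr -sumEFin; apply: eq_bigr => i _.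
  by rewrite -EFinM; congr EFin; ring.
rewrite mulr_sumr -[RHS]/(fine (_%:E)) -sumEFin; congr fine; apply: eq_bigr => i _.
rewrite integralZl//; last exact: int.
rewrite -[X in (_ * X)%E]fineK; last first.
  by apply: integrable_fin_num => //; exact: int.
rewrite -EFinM; congr EFin.
have := plane_bump_fourier p (grid_point i) xi theta h10 h20.
rewrite /Rintegral => ->.
by rewrite /amp /phase; ring.
Qed.

(** The squared modulus of the trigonometric factor. Differences of grid points lose the offset [a]
    and are integer multiples of the widths, which gives the periodicity. *)
Let G xi := \sum_(q : I * I) c q.1 * c q.2 *
  cos (((n1 q.1)%:Z - (n1 q.2)%:Z)%:~R * h1 * xi.1 +
       ((n2 q.1)%:Z - (n2 q.2)%:Z)%:~R * h2 * xi.2).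

Let GE xi : G xi = (\sum_i c i * cos (phase i xi)) ^+ 2 + (\sum_i c i * sin (phase i xi)) ^+ 2.
Proof.
rewrite !expr2 !big_distrlr/= -big_split/= /G -(pair_bigA _ (fun i j => c i * c j *
  cos (((n1 i)%:Z - (n1 j)%:Z)%:~R * h1 * xi.1 + ((n2 i)%:Z - (n2 j)%:Z)%:~R * h2 * xi.2)))/=.
apply: eq_bigr => i _; rewrite -big_split/=; apply: eq_bigr => j _.
rewrite (_ : _ + _ * xi.2 = phase i xi - phase j xi); last first.
  by rewrite /phase !intrD !mulrNz -!pmulrn /=; ring.
by rewrite cosB; ring.
Qed.

Lemma fourier_bump_sum xi :
  ComplexField.Normc.normc (fourier bump_sum xi) ^+ 2 = amp xi ^+ 2 * G xi.
Proof.
rewrite /fourier /ComplexField.Normc.normc/= sqr_sqrtr; last by rewrite addr_ge0 ?sqr_ge0.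
have -> : \int[@Leb2 R]_x (cos (x.1 * xi.1 + x.2 * xi.2) * bump_sum x) =
    amp xi * \sum_i c i * cos (phase i xi).
  have := bump_sum_cos xi 0; under eq_bigr do rewrite addr0.
  by move=> <-; apply: eq_Rintegral => x _; rewrite addr0.
have -> : \int[@Leb2 R]_x (sin (x.1 * xi.1 + x.2 * xi.2) * bump_sum x) =
    amp xi * \sum_i c i * sin (phase i xi).
  have := bump_sum_cos xi (- (pi / 2)); under eq_bigr do rewrite cosBpihalf.
  by move=> <-; apply: eq_Rintegral => x _; rewrite cosBpihalf.
by rewrite GE sqrrN !exprMn mulrDr.
Qed.

Let G_ge0 xi : 0 <= G xi.
Proof. by rewrite GE addr_ge0 ?sqr_ge0. Qed.

Let measurable_G : measurable_fun setT G.
Proof.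
apply: measurable_sum => q; apply: measurable_funM; first exact: measurable_cst.
apply: measurableT_comp; first by apply: continuous_measurable_fun; exact: continuous_cos.
apply: measurable_funD; apply: measurable_funM;
  by [exact: measurable_cst|exact: measurable_fst|exact: measurable_snd].
Qed.

(** Rescaling [|xi| = |h xi| / h] produces the powers of the widths, and the decay of [bump_cos]
    leaves the weights in front of [G]. By injectivity of the indexing, the zero frequencies of [G]
    are the diagonal pairs, whence the sum of squares. *)
Lemma bump_sum_energy_le (s1 s2 A1 A2 : R) : 0 < A1 -> 0 < A2 ->
  (forall u : R, (1 + `|u| `^ (2 * s1)) * bump_cos p u ^+ 2 <= A1 / (1 + u ^+ 2)) ->
  (forall u : R, (1 + `|u| `^ (2 * s2)) * bump_cos p u ^+ 2 <= A2 / (1 + u ^+ 2)) ->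
  (\int[@Leb2 R]_xi ((`|xi.1| `^ (2 * s1) + `|xi.2| `^ (2 * s2)) *
      ComplexField.Normc.normc (fourier bump_sum xi) ^+ 2)%:E <=
   ((12 * pi) ^+ 2 * A1 * A2 * (h1 * h2) *
      (h1 `^ (- (2 * s1)) + h2 `^ (- (2 * s2))) * \sum_i c i ^+ 2)%:E)%E.
Proof.
move=> A10 A20 hA1 hA2.
pose B := A1 * A2 * (h1 * h2) ^+ 2 * (h1 `^ (- (2 * s1)) + h2 `^ (- (2 * s2))).
have B0 : 0 <= B.
  by rewrite mulr_ge0 ?addr_ge0 ?powR_ge0// mulr_ge0 ?sqr_ge0// mulr_ge0// ltW.
apply: (@le_trans _ _ (\int[@Leb2 R]_xi (B%:E *
   ((1 + (h1 * xi.1) ^+ 2)^-1 * (1 + (h2 * xi.2) ^+ 2)^-1 * G xi)%:E)))%E.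
  apply: ge0_le_integralT => xi.
    by rewrite lee_fin mulr_ge0 ?sqr_ge0// addr_ge0 ?powR_ge0.
  rewrite fourier_bump_sum -EFinM lee_fin [leLHS]mulrA [leRHS]mulrA.
  apply: ler_wpM2r => //.
  have scale (h u t : R) : 0 < h -> `|u| `^ t = h `^ (- t) * `|h * u| `^ t.
    move=> h0; rewrite normrM (gtr0_norm h0) (powRM _ (ltW h0))// mulrA powRN.
    by rewrite mulVf ?mul1r// gt_eqF// powR_gt0.
  rewrite (scale h1 xi.1)// (scale h2 xi.2)// /amp.
  move: (hA1 (h1 * xi.1)) (hA2 (h2 * xi.2)).
  have := powR_ge0 `|h1 * xi.1| (2 * s1); have := powR_ge0 `|h2 * xi.2| (2 * s2).
  move: (_ `^ (2 * s2)) (_ `^ (2 * s1)) => P2 P1 P20 P10.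
  have := powR_ge0 h1 (- (2 * s1)); have := powR_ge0 h2 (- (2 * s2)).
  rewrite /B; move: (_ `^ (- (2 * s2))) (_ `^ (- (2 * s1))) => e2 e1 e20 e10.
  move: (bump_cos p (h2 * _)) (bump_cos p (h1 * _)) => b2 b1.
  set W1 := (1 + (h1 * _) ^+ 2)^-1; set W2 := (1 + (h2 * _) ^+ 2)^-1.
  rewrite !mulrDl !mul1r => H1 H2.
  have [b10 b20] := (sqr_ge0 b1, sqr_ge0 b2).
  have [P1b1 P2b2] : 0 <= P1 * b1 ^+ 2 /\ 0 <= P2 * b2 ^+ 2 by split; exact: mulr_ge0.
  have K1 : (P1 * b1 ^+ 2) * b2 ^+ 2 <= (A1 * W1) * (A2 * W2).
    by apply: ler_pM => //; lra.
  have K2 : b1 ^+ 2 * (P2 * b2 ^+ 2) <= (A1 * W1) * (A2 * W2).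
    by apply: ler_pM => //; lra.
  have hh : 0 <= (h1 * h2) ^+ 2 by exact: sqr_ge0.
  have E1 : 0 <= e1 * (h1 * h2) ^+ 2 by rewrite mulr_ge0.
  have E2 : 0 <= e2 * (h1 * h2) ^+ 2 by rewrite mulr_ge0.
  have := ler_wpM2l E1 K1; have := ler_wpM2l E2 K2.
  move=> F1 F2; have := lerD F2 F1.
  by congr (_ <= _); ring.
rewrite ge0_integralZl_EFin//; last 2 first.
- move=> xi _; rewrite lee_fin mulr_ge0// mulr_ge0// invr_ge0;
    by rewrite addr_ge0 ?sqr_ge0.
- by apply/measurable_EFinP; apply: measurable_funM => //; exact: measurable_weights.
apply: le_trans (lee_wpmul2l _ (weighted_trig_integral2 h10 h20 G_ge0 measurable_G)) _.
  by rewrite lee_fin.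
rewrite -EFinM lee_fin le_eqVlt; apply/orP; left; apply/eqP.
have -> : \sum_(q : I * I | ((n1 q.1)%:Z - (n1 q.2)%:Z == 0) && ((n2 q.1)%:Z - (n2 q.2)%:Z == 0))
    c q.1 * c q.2 = \sum_i c i ^+ 2.
  rewrite (eq_bigl (fun q : I * I => q.2 == q.1)); last first.
    move=> [i j] /=; rewrite !subr_eq0 !eqz_nat; apply/andP/eqP => [[/eqP e1 /eqP e2]|->//].
    by apply: n_inj; rewrite e1 e2.
  rewrite -(pair_big_dep predT (fun i j => j == i) (fun i j => c i * c j))/=.
  by apply: eq_bigr => i _; rewrite big_pred1_eq expr2.
by rewrite /B; field; rewrite !gt_eqF.
Qed.
End bump_sum.

(** * Borel measurability in the plane *)

Section plane_continuity.
Variable R : realType.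

(** An open set is a countable union of squares with rational centres and radii [1 / (n + 1)], and
    squares belong to the product σ-field. *)
Lemma open_plane_measurable (U : set (plane R)) : open U -> measurable U.
Proof.
move=> oU; pose e n : R := n.+1%:R^-1.
have e0 n : 0 < e n by rewrite invr_gt0.
pose square (q : rat * rat * nat) : set (plane R) :=
  ball (ratr q.1.1 : R) (e q.2) `*` ball (ratr q.1.2 : R) (e q.2).
pose cover n : set (plane R) :=
  if @choice.unpickle (rat * rat * nat)%type n is Some q
  then if `[< square q `<=` U >] then square q else set0
  else set0.
have -> : U = \bigcup_n cover n.
  apply/seteqP; split => [z Uz|z [n _]]; last first.
    by rewrite /cover; case: choice.unpickle => // q; case: asboolP => // + h; exact.
  have /nbhs_ballP[r /= r0 rU] : nbhs z U by exact: open_nbhs_nbhs.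
  pose n := Num.truncn (2 / r).
  have en : e n < r / 2.
    rewrite /e -[ltRHS]invrK ltf_pV2 ?posrE ?invr_gt0 ?divr_gt0//.
    by rewrite invf_div; exact: truncnS_gt.
  have rational (x : R) : exists q : rat, ball (ratr q : R) (e n) x.
    have : x - e n < x + e n by have := e0 n; lra.
    move=> /rat_in_itvoo[q]; rewrite in_itv/= => /andP[q1 q2].
    by exists q; rewrite /ball/= ltr_norml; apply/andP; split; lra.
  have [q1 hq1] := rational z.1; have [q2 hq2] := rational z.2.
  exists (choice.pickle (q1, q2, n)); first exact: I.
  rewrite /cover choice.pickleK asboolT.
    by split.
  move=> y [y1 y2]; apply: rU; split=> /=.
    apply: (@ball_splitr _ _ (ratr q1 : R)).
      exact: le_ball (ltW en) _ hq1.
    exact: le_ball (ltW en) _ y1.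
  apply: (@ball_splitr _ _ (ratr q2 : R)).
    exact: le_ball (ltW en) _ hq2.
  exact: le_ball (ltW en) _ y2.
apply: bigcupT_measurable => n; rewrite /cover.
case: choice.unpickle => // q; case: asboolP => // _.
by apply: measurableX; exact: measurable_ball.
Qed.

Lemma continuous_plane_measurable (f : plane R -> R) :
  continuous f -> measurable_fun setT f.
Proof.
move=> cf; apply: (measurability _ (RGenInftyO.measurableE R)).
move=> _ [_ [t ->] <-]; rewrite setTI; apply: open_plane_measurable.
by apply: open_comp => [z _|]; [exact: cf|exact: interval_open].
Qed.

End plane_continuity.

(** * Sums of bumps on a grid: disjoint supports, L1 and L2 norms *)

Section bump_sum_norms.
Variables (R : realType) (p : nat) (I : finType) (n1 n2 : I -> nat) (a : plane R).
Variables (h1 h2 : R).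
Hypotheses (h10 : 0 < h1) (h20 : 0 < h2).
Hypothesis n_inj : injective (fun i => (n1 i, n2 i)).
Implicit Types z : plane R.

Local Notation cell i := (grid_point n1 n2 a h1 h2 i).

Lemma plane_bump_support i z : plane_bump p.+1 (cell i) h1 h2 z != 0 ->
  [/\ h1 * ((n1 i)%:R - 2^-1) < z.1 - a.1 < h1 * ((n1 i)%:R + 2^-1) &
      h2 * ((n2 i)%:R - 2^-1) < z.2 - a.2 < h2 * ((n2 i)%:R + 2^-1)].
Proof.
rewrite mulf_eq0 negb_or => /andP[/bump_neq0 + /bump_neq0].
have aux (x b h : R) k : 0 < h ->
    - 2^-1 < (x - (b + h * k)) / h < 2^-1 -> h * (k - 2^-1) < x - b < h * (k + 2^-1).
  move=> h0; rewrite ltr_pdivlMr// ltr_pdivrMr// => /andP[? ?].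
  by apply/andP; split; lra.
by move=> /(aux _ _ _ _ h10) ? /(aux _ _ _ _ h20) ?.
Qed.

(** In units of the widths, the supports are open squares of side 1 centred at integer points. *)
Lemma plane_bump_disjoint i j z : plane_bump p.+1 (cell i) h1 h2 z != 0 ->
  plane_bump p.+1 (cell j) h1 h2 z != 0 -> i = j.
Proof.
move=> /plane_bump_support[i1 i2] /plane_bump_support[j1 j2].
have aux (h x : R) (k l : nat) : 0 < h -> h * (k%:R - 2^-1) < x < h * (k%:R + 2^-1) ->
    h * (l%:R - 2^-1) < x < h * (l%:R + 2^-1) -> k = l.
  move=> h0 /andP[k1 k2] /andP[l1 l2].
  have : k%:R - 2^-1 < l%:R + 2^-1 :> R by rewrite -(ltr_pM2l h0); lra.
  have : l%:R - 2^-1 < k%:R + 2^-1 :> R by rewrite -(ltr_pM2l h0); lra.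
  move=> ? ?; apply/eqP; rewrite eqn_leq.
  by apply/andP; split; rewrite -ltnS -(ltr_nat R) -natr1; lra.
by apply: n_inj; congr pair; [exact: aux h10 i1 j1|exact: aux h20 i2 j2].
Qed.

Lemma bump_sum_at (c : I -> R) i z : plane_bump p.+1 (cell i) h1 h2 z != 0 ->
  bump_sum p.+1 n1 n2 a h1 h2 c z = c i * plane_bump p.+1 (cell i) h1 h2 z.
Proof.
move=> iz; rewrite /bump_sum (bigD1 i)//= big1 ?addr0// => j ji.
have [->|jz] := eqVneq (plane_bump p.+1 (cell j) h1 h2 z) 0; first by rewrite mulr0.
by move: ji; rewrite (plane_bump_disjoint jz iz) eqxx.
Qed.

Lemma bump_sum_cases z : (exists i, plane_bump p.+1 (cell i) h1 h2 z != 0) \/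
  (forall i, plane_bump p.+1 (cell i) h1 h2 z = 0).
Proof.
have [/existsP|/existsPn h] := boolP [exists i, plane_bump p.+1 (cell i) h1 h2 z != 0].
  by left.
by right=> i; apply/eqP; have := h i; rewrite negbK.
Qed.

Lemma bump_sum_sqr (c : I -> R) z : bump_sum p.+1 n1 n2 a h1 h2 c z ^+ 2 =
  bump_sum (2 * p.+1) n1 n2 a h1 h2 (fun i => c i ^+ 2) z.
Proof.
transitivity (\sum_i (c i * plane_bump p.+1 (cell i) h1 h2 z) ^+ 2).
  have [[i iz]|z0] := bump_sum_cases z.
    rewrite (bump_sum_at c iz) (bigD1 i)//= big1 ?addr0// => j ji.
    have [->|jz] := eqVneq (plane_bump p.+1 (cell j) h1 h2 z) 0.
      by rewrite mulr0 expr2 mul0r.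
    by move: ji; rewrite (plane_bump_disjoint jz iz) eqxx.
  rewrite /bump_sum !big1 ?expr2 ?mul0r// => i _; rewrite z0 ?mulr0//.
  by rewrite expr2 mul0r.
by apply: eq_bigr => i _; rewrite exprMn plane_bump_sqr.
Qed.

Lemma bump_sum_integral q (c : I -> R) : (forall i, 0 <= c i) ->
  (\int[@Leb2 R]_z (bump_sum q n1 n2 a h1 h2 c z)%:E =
   (h1 * h2 * bump_cos q (0 : R) ^+ 2 * \sum_i c i)%:E)%E.
Proof.
move=> c0.
transitivity (\sum_i \int[@Leb2 R]_z ((c i)%:E * (plane_bump q (cell i) h1 h2 z)%:E))%E.
  rewrite -ge0_integral_sum//.
  - by apply: eq_integral => z _; rewrite -sumEFin.
  - move=> i; apply: measurable_funeM; apply/measurable_EFinP.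
    exact: measurable_plane_bump.
  - by move=> i z _; rewrite -EFinM lee_fin mulr_ge0// plane_bump_ge0.
rewrite mulr_sumr -sumEFin; apply: eq_bigr => i _.
rewrite ge0_integralZl_EFin// ?plane_bump_integral//.
- by rewrite -EFinM mulrC.
- by move=> z _; rewrite lee_fin plane_bump_ge0.
- by apply/measurable_EFinP; exact: measurable_plane_bump.
Qed.

Lemma bump_sum_L1 (c : I -> R) :
  ('N[@Leb2 R]_1%:E [EFin \o bump_sum p n1 n2 a h1 h2 c] < +oo)%E.
Proof.
rewrite Lnorm1; apply: (@le_lt_trans _ _
  (\int[@Leb2 R]_z (bump_sum p n1 n2 a h1 h2 (fun i => `|c i|) z)%:E)%E).
  apply: ge0_le_integralT => z; first exact: abse_ge0.
  rewrite lee_fin; apply: le_trans (ler_norm_sum _ _ _) _; apply: ler_sum => i _.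
  by rewrite normrM [X in _ * X]ger0_norm ?plane_bump_ge0.
by rewrite bump_sum_integral// ltry.
Qed.

(** Exact because disjointness removes the cross terms: the square of the sum is again a sum of
    bumps, of doubled exponent. *)
Lemma bump_sum_L2 (c : I -> R) :
  ('N[@Leb2 R]_2%:E [EFin \o bump_sum p.+1 n1 n2 a h1 h2 c])%E =
  (Num.sqrt (h1 * h2 * bump_cos (2 * p.+1) (0 : R) ^+ 2 * \sum_i c i ^+ 2))%:E.
Proof.
rewrite unlock /Lnorm.
have -> : (\int[@Leb2 R]_z `|(EFin \o bump_sum p.+1 n1 n2 a h1 h2 c) z| `^ 2)%E =
    (h1 * h2 * bump_cos (2 * p.+1) (0 : R) ^+ 2 * \sum_i c i ^+ 2)%:E.
  rewrite -bump_sum_integral; last by move=> i; exact: sqr_ge0.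
  apply: eq_integral => z _; rewrite -bump_sum_sqr /= ?poweR_EFin powR_mulrn//.
  by rewrite real_normK// num_real.
rewrite poweR_EFin powR12_sqrt// mulr_ge0//; last by apply: sumr_ge0 => i _; exact: sqr_ge0.
by rewrite mulr_ge0 ?sqr_ge0// mulr_ge0// ltW.
Qed.

End bump_sum_norms.

(** * The perturbed densities *)

Section weight_facts.
Variables (R : realType) (M : R) (w : plane R -> R).
Hypotheses (M0 : 0 < M) (hw : is_weight M w).
Implicit Types z : plane R.

(** At this point [y - x = M / 4], so monotonicity makes the value a lower bound wherever
    [y - x >= M / 4] in [OmegaM]. *)
Definition weight_min : R := w (M / 4, M / 2).

(* The inverse of w where w >= weight_min, and continuous on the whole plane. *)
Definition weight_inv z : R := (Num.max (w z) weight_min)^-1.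

Let corner : OmegaM M (M / 4, M / 2).
Proof. by split; [split|]; rewrite /=; have := M0; lra. Qed.

Lemma weight_min_gt0 : 0 < weight_min.
Proof. by case: hw => _ _ + _ _; apply. Qed.

Lemma weight_min_le z : OmegaM M z -> M / 4 <= z.2 - z.1 -> weight_min <= w z.
Proof.
case: hw => _ _ _ mono _ zM z4; apply: mono => //=.
by apply: le_trans z4; lra.
Qed.

Lemma weight_sqr_le z : OmegaM M z -> w z ^+ 2 <= w2_norm M w.
Proof.
case: hw => _ _ _ _ ub zM; apply: ub_le_sup => //.
by exists z.
Qed.

Lemma weight_le z : OmegaM M z -> w z <= Num.sqrt (w2_norm M w).
Proof.
move=> zM; have w0 : 0 < w z by case: hw => _ _ + _ _; apply.
by rewrite -(ger0_norm (ltW w0)) -sqrtr_sqr ler_wsqrtr// weight_sqr_le.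
Qed.

Lemma w2_norm_gt0 : 0 < w2_norm M w.
Proof.
apply: lt_le_trans (weight_sqr_le corner).
by rewrite exprn_gt0// weight_min_gt0.
Qed.

Lemma weight_inv_gt0 z : 0 < weight_inv z.
Proof. by rewrite invr_gt0 lt_max weight_min_gt0 orbT. Qed.

Lemma weight_inv_le z : weight_inv z <= weight_min^-1.
Proof.
rewrite lef_pV2 ?posrE ?weight_min_gt0 ?le_max ?lexx ?orbT//.
by rewrite lt_max weight_min_gt0 orbT.
Qed.

Lemma weight_invE z : OmegaM M z -> M / 4 <= z.2 - z.1 -> weight_inv z = (w z)^-1.
Proof.
by move=> zM /(weight_min_le zM) h; rewrite /weight_inv; congr (_^-1); apply/max_idPl.
Qed.

Lemma measurable_weight_inv : measurable_fun setT weight_inv.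
Proof.
apply: continuous_plane_measurable => z.
apply: (@continuousV _ _ (fun z => Num.max (w z) weight_min) z).
  by rewrite gt_eqF// lt_max weight_min_gt0 orbT.
have cw : continuous w by case: hw => /(_ 0%N)[].
by apply: continuous_max; [exact: cw|exact: cst_continuous].
Qed.

End weight_facts.

Section perturbed_densities.
Variables (R : realType) (M N : R) (w : plane R -> R).
Hypotheses (M0 : 0 < M) (hw : is_weight M w).
Variables (p k1 k2 : nat).
Hypotheses (k10 : (0 < k1)%N) (k20 : (0 < k2)%N).
Implicit Types z : plane R.

Local Notation J := ('I_k1 * 'I_k2)%type.
Local Notation I := (J * bool)%type.
Local Notation W2 := (w2_norm M w).
Local Notation wmin := (weight_min M w).
Local Notation winv := (weight_inv M w).

Definition col (i : I) : nat := i.1.1.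
(* The bool selects the lower or the upper half of the box [0, M/4] x [M/2, M]. *)
Definition row (i : I) : nat := i.1.2 + i.2 * k2.
Definition width1 : R := M / (4 * k1%:R).
Definition width2 : R := M / (4 * k2%:R).
Local Notation h1 := width1.
Local Notation h2 := width2.
(** The centre of the lowest left cell: the half widths put the bumps at cell centres, and the grid
    then fills the box. *)
Definition corner : plane R := (h1 / 2, M / 2 + h2 / 2).
Local Notation psi i := (plane_bump p.+1 (grid_point col row corner h1 h2 i) h1 h2).
Local Notation b := (bump_cos p.+1 (0 : R)).

Let k1R : 0 < k1%:R :> R. Proof. by rewrite ltr0n. Qed.
Let k2R : 0 < k2%:R :> R. Proof. by rewrite ltr0n. Qed.

Lemma width1_gt0 : 0 < h1. Proof. by rewrite divr_gt0// mulr_gt0. Qed.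
Lemma width2_gt0 : 0 < h2. Proof. by rewrite divr_gt0// mulr_gt0. Qed.
Let h10 := width1_gt0.
Let h20 := width2_gt0.

Lemma col_row_inj : injective (fun i => (col i, row i)).
Proof.
move=> [[i1 i2] i3] [[j1 j2] j3]; rewrite /col /row /= => -[/val_inj -> e].
have e3 : i3 = j3.
  by case: i3 j3 e => [] [] //=; have := ltn_ord i2; have := ltn_ord j2; clear; lia.
by move: e; rewrite e3 => /addIn/val_inj ->.
Qed.

Lemma psi_support i z : psi i z != 0 -> OmegaM M z /\ M / 4 <= z.2 - z.1.
Proof.
move=> /(plane_bump_support h10 h20)[/andP[x1 x2] /andP[y1 y2]].
have e1 : h1 * k1%:R = M / 4 by rewrite /h1; field; rewrite gt_eqF.
have e2 : h2 * k2%:R = M / 4 by rewrite /h2; field; rewrite gt_eqF.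
have c1 : h1 * (col i)%:R + h1 <= M / 4.
  rewrite -e1 -[X in _ + X <= _]mulr1 -mulrDr ler_pM2l// natr1 ler_nat.
  exact: ltn_ord.
have c2 : h2 * (row i)%:R + h2 <= M / 2.
  have -> : M / 2 = h2 * (k2 + k2)%:R by rewrite natrD mulrDr e2; lra.
  rewrite -[X in _ + X <= _]mulr1 -mulrDr ler_pM2l// natr1 ler_nat /row.
  by have := ltn_ord i.1.2; case: (i.2) => /=; clear; lia.
have c3 : 0 <= h1 * (col i)%:R by rewrite mulr_ge0// ltW.
have c4 : 0 <= h2 * (row i)%:R by rewrite mulr_ge0// ltW.
move: x1 x2 y1 y2; rewrite /corner/=.
suff : h1 * ((col i)%:R - 2^-1) < z.1 - h1 / 2 -> z.1 - h1 / 2 < h1 * ((col i)%:R + 2^-1) ->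
    h2 * ((row i)%:R - 2^-1) < z.2 - (M / 2 + h2 / 2) ->
    z.2 - (M / 2 + h2 / 2) < h2 * ((row i)%:R + 2^-1) ->
    [/\ 0 <= z.1, z.1 < z.2, z.2 < M & M / 4 <= z.2 - z.1].
  by move=> h x1 x2 y1 y2; have [] := h x1 x2 y1 y2.
move: (z.1 : R) (z.2 : R) => x y x1 x2 y1 y2.
by split; lra.
Qed.

Lemma psi_weight i z : psi i z != 0 -> w z * winv z = 1.
Proof.
move=> /psi_support[zM z4]; rewrite (weight_invE M0 hw)// mulfV// gt_eqF//.
exact: lt_le_trans (weight_min_gt0 M0 hw) (weight_min_le M0 hw zM z4).
Qed.

Let bb : 0 < b <= 1. Proof. exact: bump_cos0_bounds. Qed.

Definition cell_mass : R := h1 * h2 * b ^+ 2.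

Let S0 : 0 < cell_mass.
Proof. by have /andP[b0 _] := bb; rewrite mulr_gt0 ?exprn_gt0// mulr_gt0. Qed.

Let psi_integral i : (\int[@Leb2 R]_z (psi i z)%:E = cell_mass%:E)%E.
Proof. exact: plane_bump_integral. Qed.

Definition norm_const i : R := fine (\int[@Leb2 R]_z (psi i z * winv z)%:E)%E.

Let measurable_psi_winv i : measurable_fun setT (fun z => psi i z * winv z).
Proof.
apply: measurable_funM; first exact: measurable_plane_bump.
exact: measurable_weight_inv.
Qed.

Let psi_winv_ge0 i z : 0 <= psi i z * winv z.
Proof. by rewrite mulr_ge0 ?plane_bump_ge0// ltW// weight_inv_gt0. Qed.

(** On the support of the bump [winv] lies between [1 / sqrt W2] and [1 / wmin]. The normalisation
    varies with the cell, but stays within fixed factors of the unweighted mass. *)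
Lemma norm_constE i :
  (\int[@Leb2 R]_z (psi i z * winv z)%:E = (norm_const i)%:E)%E /\
  cell_mass / Num.sqrt W2 <= norm_const i <= cell_mass / wmin.
Proof.
have w0 := weight_min_gt0 M0 hw.
have sw0 : 0 < Num.sqrt W2 by rewrite sqrtr_gt0 w2_norm_gt0.
have up : (\int[@Leb2 R]_z (psi i z * winv z)%:E <= (cell_mass / wmin)%:E)%E.
  apply: (@le_trans _ _ (\int[@Leb2 R]_z ((wmin^-1)%:E * (psi i z)%:E))%E).
    apply: ge0_le_integralT => z; rewrite -?EFinM lee_fin//.
    by rewrite mulrC ler_wpM2r ?plane_bump_ge0// weight_inv_le.
  rewrite ge0_integralZl_EFin//.
  - by rewrite psi_integral -EFinM mulrC.
  - by move=> z _; rewrite lee_fin plane_bump_ge0.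
  - by apply/measurable_EFinP; exact: measurable_plane_bump.
  - by rewrite invr_ge0 ltW.
have low : ((cell_mass / Num.sqrt W2)%:E <= \int[@Leb2 R]_z (psi i z * winv z)%:E)%E.
  apply: (@le_trans _ _ (\int[@Leb2 R]_z (((Num.sqrt W2)^-1)%:E * (psi i z)%:E))%E).
    rewrite ge0_integralZl_EFin//.
    - by rewrite psi_integral -EFinM mulrC.
    - by move=> z _; rewrite lee_fin plane_bump_ge0.
    - by apply/measurable_EFinP; exact: measurable_plane_bump.
  apply: ge0_le_integralT => z; rewrite -EFinM lee_fin.
    by rewrite mulr_ge0 ?plane_bump_ge0// invr_ge0 ltW.
  have [->|z0] := eqVneq (psi i z) 0; first by rewrite mulr0 mul0r.
  have [zM z4] := psi_support z0.
  have wz : 0 < w z by exact: lt_le_trans w0 (weight_min_le M0 hw zM z4).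
  rewrite mulrC (weight_invE M0 hw)//; apply: ler_wpM2l; first exact: plane_bump_ge0.
  by rewrite lef_pV2 ?posrE// (weight_le hw).
have fin : (\int[@Leb2 R]_z (psi i z * winv z)%:E)%E \is a fin_num.
  rewrite ge0_fin_numE; first exact: le_lt_trans up (ltry _).
  by apply: integral_ge0 => z _; rewrite lee_fin.
split; first by rewrite fineK.
by rewrite -!lee_fin fineK// low up.
Qed.

Let nc_gt0 i : 0 < norm_const i.
Proof.
have [_ /andP[h _]] := norm_constE i; apply: lt_le_trans h.
by rewrite divr_gt0// sqrtr_gt0 w2_norm_gt0.
Qed.

(** Half-open at the top because [OmegaM] demands [y < M]. *)
Definition box : set (plane R) := `[0, M / 4]%classic `*` `[M / 2, M[%classic.

Definition dens (s : option I) z : R :=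
  if s is Some i then psi i z * winv z / norm_const i
  else 8 / M ^+ 2 * \1_box z.

Let box_OmegaM z : box z -> OmegaM M z.
Proof.
move=> [/=]; rewrite !in_itv/=.
suff : 0 <= z.1 <= M / 4 -> M / 2 <= z.2 < M -> [/\ 0 <= z.1, z.1 < z.2 & z.2 < M].
  by move=> h z1 z2; have [] := h z1 z2.
move: (z.1 : R) (z.2 : R) => x y /andP[x0 x1] /andP[y0 y1].
by have := M0; split; lra.
Qed.

Let measurable_box : measurable box.
Proof. by apply: measurableX. Qed.

Lemma dens_density s : diagram_density M (dens s).
Proof.
case: s => [i|]; split.
- apply: measurable_funM; last exact: measurable_cst.
  exact: measurable_psi_winv.
- by move=> z; rewrite divr_ge0// ltW.
- rewrite /dens; under eq_integral do rewrite mulrC EFinM.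
  rewrite ge0_integralZl_EFin//.
  + by rewrite (norm_constE i).1 -EFinM mulVf// gt_eqF.
  + by move=> z _; rewrite lee_fin.
  + exact/measurable_EFinP.
  + by rewrite invr_ge0 ltW.
- move=> z dz; suff /psi_support[] : psi i z != 0 by [].
  by apply: contra dz => /eqP z0; rewrite /dens z0 !mul0r.
- apply: measurable_funM; first exact: measurable_cst.
  exact: measurable_indic.
- by move=> z; rewrite /dens mulr_ge0 ?divr_ge0 ?sqr_ge0// indicE.
- rewrite /dens; under eq_integral do rewrite EFinM.
  rewrite ge0_integralZl_EFin//; last 2 first.
  + by apply/measurable_EFinP; exact: measurable_indic.
  + by rewrite divr_ge0// sqr_ge0.
  rewrite integral_indic// setIT.
  transitivity ((8 / M ^+ 2)%:E * (lebesgue_measure `[0%R, (M / 4)%R]%classic *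
      lebesgue_measure `[(M / 2)%R, M[%classic))%E.
    by congr (_ * _)%E; apply: product_measure1E; exact: measurable_itv.
  rewrite !lebesgue_measure_itv/= !lte_fin.
  have -> : 0 < M / 4 by rewrite divr_gt0.
  have -> : M / 2 < M by have := M0; lra.
  by rewrite /= -?EFinB -!EFinM; congr EFin; field; rewrite gt_eqF.
- move=> z; rewrite /dens indicE mulf_eq0 negb_or => /andP[_].
  by case: (boolP (z \in box)) => [/set_mem/box_OmegaM//|_]; rewrite eqxx.
Qed.

(* Small enough for the bumps to contribute at most 8 |w^2| / M^2 to w^2 p, as
   much as the uniform part. *)
Definition cell_prob : R := b ^+ 2 / 2.
Local Notation eps := cell_prob.
Local Notation K := (#|{: J}|%:R : R).
Local Notation cw := (@cell_weight R ('I_k1 * 'I_k2)%type eps).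

Lemma cell_prob_bounds : 0 < eps < 1.
Proof.
have /andP[b0 b1] := bb; have : 0 < b ^+ 2 by rewrite exprn_gt0.
have : b ^+ 2 <= 1 by rewrite exprn_ile1// ltW.
by rewrite /eps => ? ?; apply/andP; split; lra.
Qed.
Let eps01 := cell_prob_bounds.

Lemma card_cells_gt0 : (0 < #|{: J}|)%N.
Proof. by rewrite card_prod !card_ord muln_gt0 k10. Qed.

Let K0 : 0 < K. Proof. by rewrite ltr0n card_cells_gt0. Qed.

(** The [K] cells of one half of the box tile a square of side [M / 4]. *)
Let KS0 : K * cell_mass = M ^+ 2 * b ^+ 2 / 16.
Proof.
rewrite card_prod !card_ord natrM /cell_mass /h1 /h2.
by field; rewrite !gt_eqF.
Qed.

Definition mix_dens (delta : R) (v : J -> bool) z : R :=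
  \sum_s cw delta v s * dens s z.

Let cw_ge0 delta v s : 0 <= delta <= 1 -> 0 <= cw delta v s.
Proof. exact: cell_weight_ge0. Qed.

Lemma mix_dens_integral delta v A : 0 <= delta <= 1 -> measurable A ->
  (\int[@Leb2 R]_(z in A) (mix_dens delta v z)%:E =
   \sum_s (cw delta v s)%:E * \int[@Leb2 R]_(z in A) (dens s z)%:E)%E.
Proof.
move=> d01 mA.
transitivity (\int[@Leb2 R]_(z in A)
    (\sum_s (cw delta v s)%:E * (dens s z)%:E))%E.
  by apply: eq_integral => z _; rewrite /mix_dens -sumEFin.
have md s : measurable_fun A (fun z => (dens s z)%:E).
  by apply: measurable_funTS; apply/measurable_EFinP; case: (dens_density s).
have d0 s z : (0 <= (dens s z)%:E)%E by rewrite lee_fin; case: (dens_density s).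
rewrite ge0_integral_sum//.
- apply: eq_bigr => s _; rewrite ge0_integralZl_EFin//.
  exact: cw_ge0.
- by move=> s; exact: measurable_funeM.
- by move=> s z _; rewrite mule_ge0// lee_fin cw_ge0.
Qed.

Lemma mix_dens_density delta v : 0 <= delta <= 1 ->
  diagram_density M (mix_dens delta v).
Proof.
move=> d01; split.
- apply: measurable_sum => s; apply: measurable_funM; first exact: measurable_cst.
  by case: (dens_density s).
- move=> z; apply: sumr_ge0 => s _; rewrite mulr_ge0 ?cw_ge0//.
  by case: (dens_density s).
- rewrite mix_dens_integral// (eq_bigr (fun s => (cw delta v s)%:E)).
    by rewrite sumEFin sum_cell_weight// card_cells_gt0.
  by move=> s _; case: (dens_density s) => _ _ -> _; rewrite mule1.
- move=> z; apply: contraPP => nz; apply/negP; rewrite negbK; apply/eqP.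
  rewrite /mix_dens big1// => s _.
  have [->|dz] := eqVneq (dens s z) 0; first by rewrite mulr0.
  by case: nz; case: (dens_density s) => _ _ _; apply.
Qed.

Lemma mix_densE delta v z : mix_dens delta v z = (1 - eps) * dens None z +
  winv z * bump_sum p.+1 col row corner h1 h2
    (fun i => cw delta v (Some i) / norm_const i) z.
Proof.
rewrite /mix_dens sum_option; congr (_ + _).
by rewrite /bump_sum mulr_sumr; apply: eq_bigr => i _; rewrite /dens; ring.
Qed.

Lemma mix_dens_le delta v z : 0 <= delta <= 1 -> 16 * W2 / M ^+ 2 < N ->
  w z ^+ 2 * mix_dens delta v z <= N.
Proof.
move=> d01 hN; apply: le_trans (ltW hN).
have W20 := w2_norm_gt0 M0 hw.
have M20 : 0 < M ^+ 2 by rewrite exprn_gt0.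
have -> : 16 * W2 / M ^+ 2 = 8 / M ^+ 2 * W2 + 8 / M ^+ 2 * W2 by field; rewrite gt_eqF.
have M8 : 0 <= 8 / M ^+ 2 by rewrite divr_ge0// ltW.
have /andP[e0 e1] := eps01.
rewrite mix_densE mulrDr; apply: lerD.
  rewrite /dens indicE; case: (boolP (z \in box)) => [/set_mem/box_OmegaM zM|_]; last first.
    by rewrite !mulr0 mulr_ge0// ltW.
  have := weight_sqr_le hw zM; have := sqr_ge0 (w z).
  move: (w z ^+ 2) (8 / M ^+ 2) M8 => x y y0 x0 xW.
  rewrite mulr1 mulrCA; apply: (@le_trans _ _ (1 * (x * y))).
    by rewrite ler_wpM2r ?mulr_ge0//; lra.
  by rewrite mul1r mulrC ler_wpM2l.
have [[i iz]|z0] := bump_sum_cases p (@col) (@row) corner h1 h2 z; last first.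
  rewrite /bump_sum big1 ?mulr0 => [|i _]; last by rewrite z0 mulr0.
  by rewrite mulr_ge0// ltW.
rewrite (bump_sum_at h10 h20 col_row_inj _ iz).
have [zM z4] := psi_support iz; have wz := psi_weight iz.
have w0 : 0 < w z by case: hw => _ _ + _ _; apply.
have sW : 0 < Num.sqrt W2 by rewrite sqrtr_gt0.
have wW := weight_le hw zM.
set c := cw _ _ _.
(* The tilt at most doubles a weight, as [1 + delta <= 2]. *)
have c_le : c <= eps / K.
  rewrite /c /cell_weight (_ : eps / K = eps * 2 / (2 * K)); last by field; rewrite gt_eqF.
  apply: ler_wpM2r; first by rewrite invr_ge0 mulr_ge0// ltW.
  apply: ler_wpM2l; first exact: ltW.
  by have /andP[? ?] := d01; case: (v _) (i.2) => [] []; rewrite ?expr0 ?expr1; lra.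
have c0 : 0 <= c by exact: cw_ge0.
have [_ /andP[nc_le _]] := norm_constE i.
have : c / norm_const i <= (eps / K) / (cell_mass / Num.sqrt W2).
  apply: ler_pM => //; first by rewrite invr_ge0 ltW.
  by rewrite lef_pV2 ?posrE// divr_gt0.
(* The value [b^2 / 2] of [eps] gives [eps / (K cell_mass) = 8 / M^2]. *)
have -> : (eps / K) / (cell_mass / Num.sqrt W2) = 8 / M ^+ 2 * Num.sqrt W2.
  have -> : (eps / K) / (cell_mass / Num.sqrt W2) = eps / (K * cell_mass) * Num.sqrt W2.
    by field; rewrite !gt_eqF.
  have /andP[b0 _] := bb.
  by rewrite KS0 /eps; field; rewrite !gt_eqF.
have q0 : 0 <= c / norm_const i by rewrite divr_ge0// ltW.
move: (c / _) q0 => q q0 qle.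
have psi1 := plane_bump_le1 p.+1 (grid_point col row corner h1 h2 i) h1 h2 z.
have psi0 := plane_bump_ge0 p.+1 (grid_point col row corner h1 h2 i) h1 h2 z.
rewrite (_ : w z ^+ 2 * _ = (w z * winv z) * (w z * (q * psi i z))); last by ring.
rewrite wz mul1r.
have qpsi : q * psi i z <= 8 / M ^+ 2 * Num.sqrt W2.
  by apply: le_trans qle; rewrite ler_piMr.
have qpsi0 : 0 <= q * psi i z by exact: mulr_ge0.
apply: le_trans (ler_pM (ltW w0) qpsi0 wW qpsi) _.
by rewrite mulrCA -expr2 sqr_sqrtr// ltW.
Qed.

Lemma mix_dens_diff delta v v0 z :
  w z * (mix_dens 0 v0 z - mix_dens delta v z) =
  bump_sum p.+1 col row corner h1 h2 (fun i =>
    (cw 0 v0 (Some i) - cw delta v (Some i)) / norm_const i) z.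
Proof.
rewrite !mix_densE.
have [[i iz]|z0] := bump_sum_cases p (@col) (@row) corner h1 h2 z; last first.
  by rewrite /bump_sum !big1 ?mulr0 ?addr0 ?subrr ?mulr0// => i _; rewrite z0 mulr0.
rewrite !(bump_sum_at h10 h20 col_row_inj _ iz).
transitivity ((w z * winv z) * ((cw 0 v0 (Some i) -
  cw delta v (Some i)) / norm_const i * psi i z)); last first.
  by rewrite (psi_weight iz) mul1r.
by ring.
Qed.

Definition perturbation (delta : R) (v v0 : J -> bool) (i : I) : R :=
  (cw 0 v0 (Some i) - cw delta v (Some i)) / norm_const i.

(** Squaring removes the signs, so the bounds are uniform in [v]. They do not involve the grid sizes
    either: the area of a cell times the number of bumps is the area of the box. *)
Lemma perturbation_energy delta v v0 :
  2 * delta ^+ 2 * wmin ^+ 2 / M ^+ 2 <=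
  h1 * h2 * \sum_i perturbation delta v v0 i ^+ 2 <= 2 * delta ^+ 2 * W2 / M ^+ 2.
Proof.
have w0 := weight_min_gt0 M0 hw; have W20 := w2_norm_gt0 M0 hw.
have sW : 0 < Num.sqrt W2 by rewrite sqrtr_gt0.
have /andP[b0 _] := bb.
have pE i : perturbation delta v v0 i ^+ 2 = (eps * delta / (2 * K)) ^+ 2 / norm_const i ^+ 2.
  rewrite /perturbation expr_div_n /=; congr (_ / _).
  rewrite !mul0r addr0 mulr1 -mulrBl !expr_div_n; congr (_ / _).
  by case: (v _) (i.2) => [] []; rewrite ?expr0 ?expr1; ring.
have const : h1 * h2 * (2 * K) * ((eps * delta / (2 * K)) ^+ 2 / cell_mass ^+ 2) =
    2 * delta ^+ 2 / M ^+ 2.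
  have -> : h1 * h2 * (2 * K) * ((eps * delta / (2 * K)) ^+ 2 / cell_mass ^+ 2) =
      eps ^+ 2 * delta ^+ 2 / (2 * (K * cell_mass) * b ^+ 2).
    by rewrite /cell_mass; field; rewrite !gt_eqF.
  by rewrite KS0 /eps; field; rewrite !gt_eqF.
have cardI : \sum_(i : I) (1 : R) = 2 * K.
  by rewrite sumr_const card_prod card_bool natrM mulrC.
have bnd i : (eps * delta / (2 * K)) ^+ 2 / cell_mass ^+ 2 * wmin ^+ 2 <=
    perturbation delta v v0 i ^+ 2 <=
    (eps * delta / (2 * K)) ^+ 2 / cell_mass ^+ 2 * W2.
  have [_ /andP[n1 n2]] := norm_constE i; rewrite pE.
  set A := _ ^+ 2; have A0 : 0 <= A by exact: sqr_ge0.
  have -> : A / cell_mass ^+ 2 * wmin ^+ 2 = A / (cell_mass / wmin) ^+ 2.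
    by field; rewrite !gt_eqF.
  have -> : A / cell_mass ^+ 2 * W2 = A / (cell_mass / Num.sqrt W2) ^+ 2.
    by rewrite -[in LHS](sqr_sqrtr (ltW W20)); field; rewrite !gt_eqF.
  have inv_sqr_le (x y : R) : 0 < x -> x <= y -> A / y ^+ 2 <= A / x ^+ 2.
    move=> x0 xy; have y0 := lt_le_trans x0 xy.
    apply: ler_wpM2l => //; rewrite lef_pV2 ?posrE ?exprn_gt0//.
    by apply: lerXn2r; rewrite ?nnegrE// ltW.
  by apply/andP; split; apply: inv_sqr_le => //; rewrite divr_gt0.
rewrite [X in X <= _ <= _](_ : _ = h1 * h2 * \sum_(i : I)
    (1 * ((eps * delta / (2 * K)) ^+ 2 / cell_mass ^+ 2 * wmin ^+ 2))); last first.
  by rewrite -mulr_suml cardI mulrAC -const; ring.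
rewrite [X in _ <= _ <= X](_ : _ = h1 * h2 * \sum_(i : I)
    (1 * ((eps * delta / (2 * K)) ^+ 2 / cell_mass ^+ 2 * W2))); last first.
  by rewrite -mulr_suml cardI mulrAC -const; ring.
have hh : 0 <= h1 * h2 by rewrite mulr_ge0// ltW.
by apply/andP; split; apply: ler_wpM2l => //; apply: ler_sum => i _;
  have /andP[? ?] := bnd i; rewrite mul1r.
Qed.

End perturbed_densities.

(** * The lower bound *)

Section average_over_signs.
Context (d : measure_display) (T : measurableType d) (R : realType).
Variables (J : finType) (eps delta eta : R).
Hypotheses (J0 : (0 < #|J|)%N) (eps01 : 0 < eps < 1) (d01 : 0 <= delta <= 1).
Hypothesis eta0 : 0 < eta.
Variables (nu : option (J * bool) -> probability T R).
Variables (P0 : probability T R) (Pv : {ffun J -> bool} -> probability T R).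
Variable v0 : J -> bool.
Hypothesis P0mix : forall A, measurable A ->
  (P0 A = \sum_s (cell_weight eps 0 v0 s)%:E * nu s A)%E.
Hypothesis Pvmix : forall v A, measurable A ->
  (Pv v A = \sum_s (cell_weight eps delta v s)%:E * nu s A)%E.
Variables n m : nat.
Hypothesis small1 : #|J|%:R * (m%:R * (eps * delta ^+ 2 / #|J|%:R)) ^+ 2 <= 2^-1.
Hypothesis small2 : 2 * (#|J|%:R * (m%:R * (eps * delta ^+ 2 / #|J|%:R)) ^+ 2) <= eta ^+ 2.

Let iid_fine f (P : probability T R) (B : set (m.-tuple T)) : (forall s, 0 <= f s) ->
  (forall A, measurable A -> (P A = \sum_s (f s)%:E * nu s A)%E) -> measurable B ->
  (iid P m B = (\sum_t tuple_weight f t * fine (niid nu t B))%:E)%E.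
Proof.
move=> f0 Pmix mB; rewrite (iid_mixture f0 Pmix)// -sumEFin.
apply: eq_bigr => t _; rewrite EFinM fineK//.
exact: fin_num_measure.
Qed.

(** The conditional probability of [B] given the labels is the randomised test [a] of
    [average_tuple_weight_le]. *)
Lemma sum_iid_le (B : set (m.-tuple T)) : measurable B ->
  (\sum_(v : {ffun J -> bool}) iid (Pv v) m B <=
   #|{ffun J -> bool}|%:R%:E * (iid P0 m B + eta%:E))%E.
Proof.
move=> mB.
have zero01 : 0 <= (0 : R) <= 1 by rewrite lexx ler01.
rewrite (iid_fine (fun s => cell_weight_ge0 eps01 v0 s zero01) P0mix)//.
rewrite (eq_bigr (fun v : {ffun J -> bool} =>
    (\sum_t tuple_weight (cell_weight eps delta v) t * fine (niid nu t B))%:E)); last first.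
  move=> v _; apply: iid_fine => //; first by move=> s; exact: cell_weight_ge0.
  exact: Pvmix.
rewrite sumEFin -EFinD -EFinM lee_fin.
apply: average_tuple_weight_le => // t; apply/andP; split; first exact: fine_ge0.
rewrite -lee_fin fineK; first exact: probability_le1.
exact: fin_num_measure.
Qed.

Lemma sum_prob_test_le (A : set (n.-tuple T * m.-tuple T)) : measurable A ->
  (\sum_(v : {ffun J -> bool}) (iid P0 n \x iid (Pv v) m) A <=
   #|{ffun J -> bool}|%:R%:E * ((iid P0 n \x iid P0 m) A + eta%:E))%E.
Proof.
move=> mA.
have mx (Q : probability T R) : measurable_fun setT (fun x => iid Q m (xsection A x)).
  exact: measurable_fun_xsection.
apply: (@le_trans _ _ (\int[iid P0 n]_x
    \sum_(v : {ffun J -> bool}) iid (Pv v) m (xsection A x))%E).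
  by rewrite ge0_integral_sum.
apply: (@le_trans _ _ (\int[iid P0 n]_x
    (#|{ffun J -> bool}|%:R%:E * (iid P0 m (xsection A x) + eta%:E)))%E).
  apply: ge0_le_integralT => x; first exact: sume_ge0.
  by apply: sum_iid_le; exact: measurable_xsection.
rewrite ge0_integralZl_EFin//; last 2 first.
- by move=> x _; rewrite adde_ge0// lee_fin ltW.
- exact: emeasurable_funD.
rewrite ge0_integralD//; last by move=> x _; rewrite lee_fin ltW.
rewrite integral_cst//.
have e : iid P0 n setT = 1%E by exact: probability_setT.
apply: lee_wpmul2l => //; apply: leeD; first exact: lexx.
by rewrite le_eqVlt; apply/orP; left; apply/eqP; apply: etrans (mule1 _); rewrite -[in RHS]e.
Qed.

End average_over_signs.

Section alternatives_family.
Variables (R : realType) (F : fieldType) (M N : R) (w : plane R -> R).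
Hypotheses (M0 : 0 < M) (hw : is_weight M w) (hN : 16 * w2_norm M w / M ^+ 2 < N).
Variables (p k1 k2 : nat).
Hypotheses (k10 : (0 < k1)%N) (k20 : (0 < k2)%N).
Local Notation J := ('I_k1 * 'I_k2)%type.
Local Notation eps := (@cell_prob R p).

(** The components [nu] are chosen before [delta] and [v]: null and alternatives must mix the same
    laws for their label laws to be comparable. *)
Lemma ex_mix_laws : exists nu : option (J * bool) -> probability (PD R) R,
  forall delta (v : J -> bool), 0 <= delta <= 1 ->
  exists P : probability (PD R) R, [/\ class_P F w M N P,
    is_density (mean P) (mix_dens M w p delta v) &
    forall A, measurable A ->
      (P A = \sum_s (cell_weight eps delta v s)%:E * nu s A)%E].
Proof.
have /choice[nu nuE] : forall s : option (J * bool),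
    exists Q : probability (PD R) R, law_of (dens M w p s) Q.
  move=> s; have [Q [h _ _]] := ex_diagram_law F w N (dens_density M0 hw p k10 k20 s).
  by exists Q.
exists nu => delta v d01.
have [P [PE Pmean Pclass]] :=
  ex_diagram_law F w N (mix_dens_density M0 hw p k10 k20 v d01).
exists P; split=> //; first by apply: Pclass => z; exact: mix_dens_le.
move=> A mA; rewrite PE// (mix_dens_integral M0 hw)//.
  by apply: eq_bigr => s _; rewrite nuE.
by rewrite -[X in measurable X]setTI; exact: measurable_point_diagram.
Qed.
End alternatives_family.

Section separation.
Variables (R : realType) (M : R) (w : plane R -> R).
Hypotheses (M0 : 0 < M) (hw : is_weight M w).
Variables (p k1 k2 : nat).
Hypotheses (k10 : (0 < k1)%N) (k20 : (0 < k2)%N).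
Local Notation J := ('I_k1 * 'I_k2)%type.

(** The lower energy bound gives the separation in L2, the upper one the membership in the Sobolev
    ball. *)
Lemma mix_dens_separated (s1 s2 L A1 A2 delta rho : R) (v v0 : J -> bool) :
  0 < A1 -> 0 < A2 ->
  (forall u : R, (1 + `|u| `^ (2 * s1)) * bump_cos p.+1 u ^+ 2 <= A1 / (1 + u ^+ 2)) ->
  (forall u : R, (1 + `|u| `^ (2 * s2)) * bump_cos p.+1 u ^+ 2 <= A2 / (1 + u ^+ 2)) ->
  0 <= delta ->
  (12 * pi) ^+ 2 * A1 * A2 *
    (width1 M k1 `^ (- (2 * s1)) + width2 M k2 `^ (- (2 * s2))) *
    (2 * delta ^+ 2 * w2_norm M w / M ^+ 2) <= (2 * pi) ^+ 2 * L ^+ 2 ->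
  rho <= delta * weight_min M w * bump_cos (2 * p.+1) (0 : R) / M ->
  separated_pair w (sobolev_ball s1 s2 L) rho
    (mix_dens M w p 0 v0) (mix_dens M w p delta v).
Proof.
move=> A10 A20 hA1 hA2 d0 hE hrho; rewrite /separated_pair.
have -> : (fun z => w z * (mix_dens M w p 0 v0 z - mix_dens M w p delta v z)) =
    bump_sum p.+1 (@col k1 k2) (@row k1 k2) (corner M k1 k2) (width1 M k1) (width2 M k2)
      (perturbation M w p delta v v0).
  by apply/funext => z; exact: mix_dens_diff.
have h10 := width1_gt0 M0 k10; have h20 := width2_gt0 M0 k20.
have inj := @col_row_inj k1 k2.
have /andP[low up] := perturbation_energy M0 hw p k10 k20 delta v v0.
have w0 := weight_min_gt0 M0 hw.
have /andP[b20 _] := bump_cos0_bounds R (2 * p.+1).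
split; last first.
  rewrite bump_sum_L2// lee_fin; apply: le_trans hrho _.
  rewrite -[leLHS]ger0_norm; last by rewrite divr_ge0 ?mulr_ge0// ltW.
  rewrite -sqrtr_sqr ler_wsqrtr//.
  set b2 := bump_cos _ _ in b20 *; set S := \sum_i _ in low *.
  rewrite (_ : _ * b2 ^+ 2 * S = b2 ^+ 2 * (width1 M k1 * width2 M k2 * S)); last by ring.
  apply: le_trans (ler_wpM2l (sqr_ge0 b2) low).
  set wm := weight_min M w in w0 *.
  rewrite (_ : (delta * wm * b2 / M) ^+ 2 = b2 ^+ 2 * (delta ^+ 2 * wm ^+ 2 / M ^+ 2)); last first.
    by field; rewrite gt_eqF.
  apply: ler_wpM2l; first exact: sqr_ge0.
  have : 0 <= delta ^+ 2 * wm ^+ 2 / M ^+ 2.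
    by apply: divr_ge0; [apply: mulr_ge0|]; exact: sqr_ge0.
  by rewrite -[2 * _ * _]mulrA -[2 * _ / _]mulrA; move: (_ / _) => y; lra.
split.
- exact: measurable_bump_sum.
- exact: bump_sum_L1.
- by rewrite bump_sum_L2// ltry.
apply: le_trans (bump_sum_energy_le _ _ h10 h20 inj A10 A20 hA1 hA2) _.
rewrite lee_fin; apply: le_trans hE.
rewrite (_ : _ * _ * _ * \sum_i _ = (12 * pi) ^+ 2 * A1 * A2 *
    (width1 M k1 `^ (- (2 * s1)) + width2 M k2 `^ (- (2 * s2))) *
    (width1 M k1 * width2 M k2 * \sum_i perturbation M w p delta v v0 i ^+ 2)); last by ring.
apply: ler_wpM2l => //.
apply: mulr_ge0; last by rewrite addr_ge0 ?powR_ge0.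
by apply: mulr_ge0; [apply: mulr_ge0; [exact: sqr_ge0|exact: ltW]|exact: ltW].
Qed.

End separation.

(** * Calibration of the grid and of the rate *)

Section rates.
Variable R : realType.

Lemma ex_grid_size (x : R) : 1 <= x -> exists2 k : nat, (0 < k)%N & x <= k%:R <= 2 * x.
Proof.
move=> x1; have x0 : 0 <= x by lra.
exists (Num.truncn x).+1 => //; have /andP[t1 t2] := truncn_itv x0.
by rewrite (ltW t2)/= -natr1; lra.
Qed.

(** A grid of order [r^(-1/s)] makes the Sobolev cost of a width of order [r^(-2)], exactly what a
    squared amplitude of order [r^2] compensates. *)
Lemma width_powR_le (M r s k : R) : 0 < M -> 0 < r -> 0 < s -> 0 < k ->
  k <= 2 * r `^ (- s^-1) -> (M / (4 * k)) `^ (- (2 * s)) * r ^+ 2 <= (8 / M) `^ (2 * s).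
Proof.
move=> M0 r0 s0 k0 kr.
have rs0 : 0 < r `^ (- s^-1) by exact: powR_gt0.
have -> : (M / (4 * k)) `^ (- (2 * s)) = (4 * k / M) `^ (2 * s).
  rewrite powRN -[in RHS]invf_div -[_^-1 in RHS]powR_inv1; last first.
    by rewrite divr_ge0 ?mulr_ge0// ltW.
  by rewrite -powRrM mulN1r powRN.
have s20 : 0 <= 2 * s by rewrite mulr_ge0// ltW.
have le1 : 4 * k / M <= 8 / M * r `^ (- s^-1).
  by rewrite [leRHS]mulrAC ler_pM2r ?invr_gt0//; lra.
have h : (4 * k / M) `^ (2 * s) <= (8 / M * r `^ (- s^-1)) `^ (2 * s).
  apply: ge0_ler_powR le1 => //; rewrite nnegrE ltW//.
    by rewrite divr_gt0// mulr_gt0.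
  by rewrite mulr_gt0// divr_gt0.
apply: le_trans (ler_wpM2r (sqr_ge0 r) h) _.
rewrite powRM ?(ltW rs0)//; last by rewrite ltW// divr_gt0.
rewrite -powRrM.
have -> : - s^-1 * (2 * s) = - 2 by field; rewrite gt_eqF.
rewrite powRN powR_mulrn; last exact: ltW.
by rewrite -mulrA mulVf ?mulr1// expf_neq0// gt_eqF.
Qed.

(** The balance that determines the rate. The chi-square is of order [nu^2 r^4 / K] with [K] of
    order [r^(-1/s1 - 1/s2) = r^(-2/s)], and it stays of order 1 precisely at
    [r = nu^(-s / (2 s + 1))]. *)
Lemma rate_identity (nu s1 s2 : R) (s := 2 / (s1^-1 + s2^-1))
    (r := nu `^ (- (s / (2 * s + 1)))) : 0 < nu -> 0 < s1 -> 0 < s2 ->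
  nu ^+ 2 * r ^+ 4 = r `^ (- s1^-1) * r `^ (- s2^-1).
Proof.
move=> nu0 s10 s20.
have i10 : 0 < s1^-1 by rewrite invr_gt0.
have i20 : 0 < s2^-1 by rewrite invr_gt0.
have s0 : 0 < s by rewrite divr_gt0// addr_gt0.
have pD (x y : R) : nu `^ (x + y) = nu `^ x * nu `^ y.
  by rewrite powRD// (gt_eqF nu0) implybT.
rewrite /r -[nu ^+ 2](powR_mulrn _ (ltW nu0)) -[_ ^+ 4]powR_mulrn ?powR_ge0//.
rewrite -!powRrM -!pD.
congr (nu `^ _).
have -> : - (s / (2 * s + 1)) * - s1^-1 + - (s / (2 * s + 1)) * - s2^-1 =
    s / (2 * s + 1) * (s1^-1 + s2^-1) by ring.
have -> : s1^-1 + s2^-1 = 2 / s by rewrite /s invf_div mulrCA mulfV ?mulr1// gt_eqF.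
by field; rewrite !gt_eqF// addr_gt0// mulr_gt0.
Qed.

End rates.

(** Averaged over [v], the test would reject with probability at least [1 - beta] and at most
    [alpha + gamma]. *)
Lemma test_average_contradiction (R : realType) (F : fieldType) (w : plane R -> R)
    (M N alpha beta gamma : R) (n m : nat) (V : finType)
    (P0 : probability (PD R) R) (Pv : V -> probability (PD R) R)
    (Delta : test R n m) :
  (0 < #|V|)%N -> alpha + beta + gamma < 1 ->
  (prob_test P0 P0 Delta true <= alpha%:E)%E ->
  (forall v, prob_test P0 (Pv v) Delta false <= beta%:E)%E ->
  (\sum_v prob_test P0 (Pv v) Delta true <=
    #|V|%:R%:E * (prob_test P0 P0 Delta true + gamma%:E))%E ->
  False.
Proof.
move=> V0 abg h0 hv hsum.
have mDelta b : measurable (Delta @^-1` [set b]).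
  by rewrite -[X in measurable X]setTI; exact: measurable_funP.
have ge v : ((1 - beta)%:E <= prob_test P0 (Pv v) Delta true)%E.
  have := hv v; rewrite /prob_test.
  pose Q : probability (n.-tuple (PD R) * m.-tuple (PD R))%type R :=
    (iid P0 n \x iid (Pv v) m)%E.
  rewrite -[product_measure1 _ _]/(Q : set _ -> \bar R).
  have -> : Delta @^-1` [set false] = ~` (Delta @^-1` [set true]).
    by apply/seteqP; split => x /=; case: (Delta x).
  rewrite probability_setC//.
  have fin : Q (Delta @^-1` [set true]) \is a fin_num.
    exact: fin_num_measure.
  by rewrite -(fineK fin) -EFinB !lee_fin; lra.
have V1 : 0 < #|V|%:R :> R by rewrite ltr0n.
have : (#|V|%:R%:E * (1 - beta)%:E <= #|V|%:R%:E * (alpha + gamma)%:E)%E.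
  apply: (@le_trans _ _ (\sum_v prob_test P0 (Pv v) Delta true)%E).
    rewrite (_ : (_ * _)%E = (\sum_(v : V) (1 - beta)%:E)%E); first exact: lee_sum.
    by rewrite sumEFin sumr_const -EFinM mulr_natl.
  apply: le_trans hsum _; rewrite EFinD; apply: lee_wpmul2l; first by rewrite lee_fin.
  exact: leeD.
by rewrite -!EFinM lee_fin ler_pM2l//; lra.
Qed.

Theorem theorem4p5 (R : realType) (F : fieldType) (M N : R) (w : plane R -> R)
    (s1 s2 L alpha beta gamma c C : R)
    (hM : 0 < M) (hN : 0 < N) (hw : is_weight M w)
    (hs1 : 0 < s1) (hs2 : 0 < s2) (hL : 0 < L)
    (halpha : 0 < alpha < 1) (hbeta : 0 < beta < 1) (hgamma : 0 < gamma < 1)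
    (habc : alpha + beta + gamma < 1)
    (hc : 0 < c) (hcC : c <= C)
    (hNw : 16 * w2_norm M w / M ^+ 2 < N) :
  let s := 2 / (s1^-1 + s2^-1) in
  exists2 C0 : R, 0 < C0 &
    forall n m : nat, (0 < n)%N -> (0 < m)%N ->
      c * m%:R <= n%:R <= C * m%:R ->
      ((C0 * (n + m)%:R `^ (- (s / (2 * s + 1))))%:E <=
       minimax_rate F w M N n m (sobolev_ball s1 s2 L) alpha beta)%E.
Proof.
move=> s; set e := s / (2 * s + 1).
have s0 : 0 < s by rewrite divr_gt0// addr_gt0// invr_gt0.
have e0 : 0 < e by rewrite divr_gt0// addr_gt0// mulr_gt0.
(* One exponent for both directions: the decay of [bump p.+1] requires [s1 + 1] and [s2 + 1] to be
   at most [p + 1]. *)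
pose p := (Num.truncn (s1 + s2)).+1.
have s12 : s1 + s2 < p%:R by exact: truncnS_gt.
have p1 : s1 + 1 <= p.+1%:R by rewrite -natr1; lra.
have p2 : s2 + 1 <= p.+1%:R by rewrite -natr1; lra.
have [A1 A10 hA1] := bump_cos_decay hs1 p1.
have [A2 A20 hA2] := bump_cos_decay hs2 p2.
have /andP[b20 _] := bump_cos0_bounds R (2 * p.+1).
set b2 := bump_cos _ _ in b20.
have wm0 := weight_min_gt0 hM hw; have W20 := w2_norm_gt0 hM hw.
(* With [delta = A r], the Sobolev energy of every difference is at most [A^2 E], and [B] below is
   the squared radius allowed. *)
pose E := (12 * pi) ^+ 2 * A1 * A2 * ((8 / M) `^ (2 * s1) + (8 / M) `^ (2 * s2)) *
  (2 * w2_norm M w / M ^+ 2).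
have E0 : 0 < E.
  have M8 : 0 < 8 / M by rewrite divr_gt0.
  have P8 (t : R) : 0 < (8 / M) `^ t by exact: powR_gt0.
  have pi12 : 0 < (12 * pi) ^+ 2 :> R by rewrite exprn_gt0// mulr_gt0// pi_gt0.
  apply: mulr_gt0; last by rewrite divr_gt0 ?exprn_gt0// mulr_gt0.
  by apply: mulr_gt0; [apply: mulr_gt0 => //; exact: mulr_gt0|exact: addr_gt0].
pose B := (2 * pi) ^+ 2 * L ^+ 2.
have B0 : 0 < B by rewrite /B mulr_gt0 ?exprn_gt0// mulr_gt0// pi_gt0.
have /andP[g0 g1] := hgamma.
(* The value of [A^2]: the first bound controls the chi-square, the second the Sobolev energy. *)
pose A2r := Num.min (gamma / 2) (B / E).
have A2r0 : 0 < A2r by rewrite lt_min !divr_gt0.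
pose A := Num.sqrt A2r.
have A0 : 0 < A by rewrite sqrtr_gt0.
have AA : A ^+ 2 = A2r by rewrite sqr_sqrtr// ltW.
have Ag : A ^+ 2 <= gamma / 2 by rewrite AA ge_min lexx.
have AE : A ^+ 2 * E <= B by rewrite AA -ler_pdivlMr// ge_min lexx orbT.
have A1' : A <= 1 by rewrite -(@ler_pXn2r _ 2) ?nnegrE ?(ltW A0)// expr1n; lra.
(* The separation from [mix_dens_separated] with [delta = A r], divided by the rate [r]. *)
exists (A * weight_min M w * b2 / M).
  by rewrite divr_gt0// !mulr_gt0.
move=> n m n0 m0 _.
set nu := (n + m)%:R : R; have nu1 : 1 <= nu by rewrite ler1n addn_gt0 n0.
have nu0 : 0 < nu by exact: lt_le_trans nu1.
set r := nu `^ (- e).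
have r0 : 0 < r by exact: powR_gt0.
have r1 : r <= 1.
  rewrite /r powRN invf_le1 ?powR_gt0//.
  by rewrite -[leLHS](powRr0 nu); apply: ler_powR => //; exact: ltW.
have rs (t : R) : 0 < t -> 1 <= r `^ (- t^-1).
  move=> t0; rewrite powRN invf_ge1 ?powR_gt0//.
  have t1 : 0 <= t^-1 by rewrite invr_ge0 ltW.
  by have := ge0_ler_powR t1 (ltW r0 : r \in Num.nneg) (ler01 : 1 \in Num.nneg) r1; rewrite powR1.
have [k1 k10 /andP[k1l k1u]] := ex_grid_size (rs s1 hs1).
have [k2 k20 /andP[k2l k2u]] := ex_grid_size (rs s2 hs2).
set delta := A * r.
have d0 : 0 < delta by rewrite mulr_gt0.
have d01 : 0 <= delta <= 1 by rewrite (ltW d0)/= mulr_ile1// ltW.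
apply: le_ereal_inf_tmp => _ [Delta hDelta <-].
apply: le_ereal_inf_tmp => _ [rho [rho0 hrho] <-].
(* If a test of level [alpha] achieved a radius [rho] below the bound, every constructed alternative
   would be separated enough for the test to detect it. *)
rewrite lee_fin leNgt; apply/negP => rho_lt.
have [nuS hnu] := ex_mix_laws F hM hw hNw p k10 k20.
(* At [delta = 0] the signs disappear from the weights, so any [v0] gives the null. *)
pose v0 : {ffun 'I_k1 * 'I_k2 -> bool} := [ffun=> false].
have [P0 [P0class P0mean P0mix]] := hnu 0 v0 (introT andP (conj (lexx 0) ler01)).
have /choice[Pv hPv] := fun v : {ffun 'I_k1 * 'I_k2 -> bool} => hnu delta v d01.
have K0 := card_cells_gt0 k10 k20.
have /andP[eps0 eps1] := cell_prob_bounds R p.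
set K := (X in (0 < X)%N) in K0; have KR : 0 < K%:R :> R by rewrite ltr0n.
(* Follows from [rate_identity], as [cell_prob] is below 1, [m <= n + m], and [k1], [k2] are at
   least [r^(-1/s1)], [r^(-1/s2)]. *)
have small : K%:R * (m%:R * (cell_prob R p * delta ^+ 2 / K%:R)) ^+ 2 <= A ^+ 4.
  have -> : K%:R * (m%:R * (cell_prob R p * delta ^+ 2 / K%:R)) ^+ 2 =
      A ^+ 4 * (cell_prob R p ^+ 2 * (m%:R ^+ 2 * r ^+ 4 / K%:R)).
    by rewrite /delta; field; rewrite gt_eqF.
  rewrite ler_piMr ?exprn_ge0 ?(ltW A0)//; apply: mulr_ile1.
  - exact: sqr_ge0.
  - by rewrite divr_ge0// mulr_ge0 ?sqr_ge0// exprn_ge0// ltW.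
  - by rewrite expr_le1// ltW.
  rewrite ler_pdivrMr// mul1r; apply: (@le_trans _ _ (nu ^+ 2 * r ^+ 4)).
    rewrite ler_wpM2r ?exprn_ge0 ?(ltW r0)//; apply: lerXn2r; rewrite ?nnegrE ?(ltW nu0)//.
    by rewrite /nu ler_nat leq_addl.
  rewrite (rate_identity nu0 hs1 hs2) -/s -/e -/r /K card_prod !card_ord natrM.
  by apply: ler_pM => //; apply: powR_ge0.
have A4 : A ^+ 4 = (A ^+ 2) ^+ 2 by rewrite -exprM.
(* Yields both smallness conditions on the chi-square: [A^4 <= 1/2], since [gamma <= 1], and
   [2 A^4 <= gamma^2]. *)
have A4g : 4 * A ^+ 4 <= gamma ^+ 2.
  rewrite A4 (_ : 4 * _ = (2 * A ^+ 2) ^+ 2); last by ring.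
  by apply: lerXn2r; rewrite ?nnegrE ?mulr_ge0 ?sqr_ge0// ?(ltW g0)//; lra.
have gg : gamma ^+ 2 <= 1 by rewrite expr_le1// ltW.
apply: (@test_average_contradiction R F w M N alpha beta gamma n m
  {ffun 'I_k1 * 'I_k2 -> bool} P0 Pv Delta) => //.
- by rewrite card_ffun card_bool expn_gt0.
- by apply: le_trans hDelta; apply: ereal_sup_ubound; exists P0.
- move=> v; apply: le_trans hrho; apply: ereal_sup_ubound.
  exists (P0, Pv v) => //; have [Pclass Pmean _] := hPv v; split=> //.
  exists (mix_dens M w p 0 v0), (mix_dens M w p delta v); split=> //.
  apply: (mix_dens_separated hM hw k10 k20 _ _ A10 A20 hA1 hA2 (ltW d0)).
    have w1 := width_powR_le hM r0 hs1 (_ : 0 < k1%:R) k1u.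
    have w2 := width_powR_le hM r0 hs2 (_ : 0 < k2%:R) k2u.
    apply: le_trans AE; rewrite (_ : _ * (2 * delta ^+ 2 * _ / _) =
      A ^+ 2 * ((12 * pi) ^+ 2 * A1 * A2 *
       (width1 M k1 `^ (- (2 * s1)) * r ^+ 2 + width2 M k2 `^ (- (2 * s2)) * r ^+ 2) *
       (2 * w2_norm M w / M ^+ 2))); last first.
      by rewrite /delta; field; rewrite gt_eqF.
    rewrite ler_wpM2l ?sqr_ge0// /E; apply: ler_wpM2r.
      by rewrite divr_ge0 ?sqr_ge0// mulr_ge0// ltW.
    apply: ler_wpM2l; first by rewrite mulr_ge0 ?(ltW A20)// mulr_ge0 ?sqr_ge0// ltW.
    by apply: lerD; [apply: w1|apply: w2]; rewrite ltr0n.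
  apply: ltW; apply: lt_le_trans rho_lt _.
  by rewrite le_eqVlt; apply/orP; left; apply/eqP; rewrite /delta /b2 -/e -/nu -/r; ring.
- apply: (sum_prob_test_le K0 (cell_prob_bounds R p) d01 g0 P0mix).
  + by move=> v A' mA'; have [_ _] := hPv v; apply.
  + by apply: le_trans small _; lra.
  + apply: le_trans (ler_wpM2l _ small) _ => //.
    by have := exprn_ge0 4 (ltW A0); lra.
  + by rewrite -[X in measurable X]setTI; exact: measurable_funP.
Qed.
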